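(* Let $F$ be a finite extension of $\mathbb{Q}_p$ and $h\in\mathrm{Hom}(\Omega_F^t,G)$ (regarded as a tame element of $\mathrm{Hom}(\Omega_F,G)$). If $a\in F_h$ satisfies $A_h=\mathcal{O}_FG\cdot a$, then the reduced resolvend satisfies $\mathbf{r}_G(a)G=u\,\Theta^t_*(f_s)$ for some $u\in\mathcal{H}(\mathcal{O}_FG)$, where $s:=h(\sigma)$.
   Context: $G$ is a finite abelian group of odd order. $F^c$ is an algebraic closure of $F$, $\Omega_F=\mathrm{Gal}(F^c/F)$ acts trivially on $G$; homomorphisms are continuous. For $h\in\mathrm{Hom}(\Omega_F,G)$: $F_h$ is the set of maps $a:G\to F^c$ with $\omega(a(s))=a(h(\omega)s)$, with $G$-action $(s\cdot a)(t)=a(ts)$; $F^h$ is the fixed field of $\ker h$; $A^h$ is the fractional ideal of $\mathcal{O}_{F^h}$ whose square is the inverse different of $F^h/F$; $A_h=\{a\in F_h: a(s)\in A^h\ \forall s\}$. The resolvend is $\mathbf{r}_G(a)=\sum_{s}a(s)s^{-1}\in F^cG$; when invertible, $\mathbf{r}_G(a)G\in(F^cG)^\times/G$ is the reduced resolvend. $\Omega_F$ acts on $F^cG$ through coefficients; $\mathcal{H}(FG)=((F^cG)^\times/G)^{\Omega_F}$ and $\mathcal{H}(\mathcal{O}_FG)=((\mathcal{O}_{F^c}G)^\times/G)^{\Omega_F}$. Tame data: $\pi$ a fixed uniformizer of $F$, $q$ the residue field size, $F^{nr}\subset F^t$ the maximal unramified and maximal tamely ramified extensions, $\Omega_F^t=\mathrm{Gal}(F^t/F)$.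 Fix primitive roots of unity $\zeta_n\in F^c$ ($n\ge1$) with $\zeta_{mn}^m=\zeta_n$, and radicals $\pi^{1/n}$ ($(n,p)=1$) with $(\pi^{1/mn})^m=\pi^{1/n}$. $\sigma\in\Omega_F^t$ fixes $F^{nr}$ and satisfies $\sigma(\pi^{1/n})=\zeta_n\pi^{1/n}$ for all $(n,p)=1$. Stickelberger data: $\hat G=\mathrm{Hom}(G,(F^c)^\times)$ with $\Omega_F$ acting through values. Identify $(F^cG)^\times$ with $\mathrm{Hom}(\mathbb{Z}\hat G,(F^c)^\times)$ by sending $\sum_t x_tt$ to the $\mathbb{Z}$-linear extension of $\chi\mapsto\sum_t x_t\chi(t)$. Let $A_{\hat G}=\{\sum n_\chi\chi:\prod\chi^{n_\chi}=1\}$; restriction to $A_{\hat G}$ identifies $(F^cG)^\times/G$ with $\mathrm{Hom}(A_{\hat G},(F^c)^\times)$ and $\mathcal{H}(FG)$ with $\mathrm{Hom}_{\Omega_F}(A_{\hat G},(F^c)^\times)$. For $\chi\in\hat G$, $s\in G$, let $\upsilon(\chi,s)$ be the unique integer in $[\frac{1-|s|}{2},\frac{|s|-1}{2}]$ with $\chi(s)=\zeta_{|s|}^{\upsilon(\chi,s)}$, and $\langle\chi,s\rangle_*=\upsilon(\chi,s)/|s|$, extended linearly in $\chi$; for $\psi\in A_{\hat G}$ these values are integers. With $m=\exp(G)$ and $\kappa:\Omega_F\to(\mathbb{Z}/m)^\times$ the cyclotomic character, $G(-1)$ is $G$ with $\omega\cdot s=s^{\kappa(\omega)^{-1}}$.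 $\Lambda(FG)^\times$ is the group of $\Omega_F$-equivariant maps $G(-1)\to(F^c)^\times$, and $\Theta^t_*:\Lambda(FG)^\times\to\mathcal{H}(FG)$ is $\Theta^t_*(g)(\psi)=\prod_{s\in G}g(s)^{\langle\psi,s\rangle_*}$ for $\psi\in A_{\hat G}$. For $s$ in $G_{(q-1)}$ (elements of order dividing $q-1$), $f_s\in\Lambda(FG)^\times$ is $f_s(t)=\pi$ if $t=s\ne1$ and $f_s(t)=1$ otherwise. *)

(* Defs.v *)
From HB Require Import structures.
From mathcomp Require Import all_boot all_order all_algebra all_fingroup.
From mathcomp Require Import all_solvable all_field.
From mathcomp Require Import finmap boolp classical_sets.

Set Implicit Arguments.
Unset Strict Implicit.
Unset Printing Implicit Defensive.

Import Order.TTheory GRing.Theory Num.Theory.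
Local Open Scope ring_scope.

(* Subsets of a field are Boolean predicates, through `[< _ >] when they are
   defined by an arbitrary proposition. *)

Section PadicNumbers.

Definition padic_abs (p : nat) (r : rat) : rat :=
  if r == 0 then 0
  else p%:Q ^ ((logn p `|denq r|)%:Z - (logn p `|numq r|)%:Z).

(* (K, abs) is the completion of the rationals for the p-adic absolute value.
   Taking abs rational-valued is harmless: its values are 0 and powers of p. *)
Record is_Qp (p : nat) (K : fieldType) (abs : K -> rat) : Prop := IsQp {
  Qp_abs0 : forall x, (abs x == 0) = (x == 0);
  Qp_absM : {morph abs : x y / x * y};
  Qp_absD : forall x y, abs (x + y) <= Num.max (abs x) (abs y);
  Qp_abs_rat : forall r : rat, abs (ratr r) = padic_abs p r;
  Qp_dense : forall x (e : rat), 0 < e -> exists r : rat, abs (x - ratr r) < e;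
  Qp_complete : forall u : nat -> K,
    (forall e : rat, 0 < e -> exists N, forall m n,
       (N <= m)%N -> (N <= n)%N -> abs (u m - u n) < e) ->
    exists l, forall e : rat, 0 < e -> exists N, forall n,
       (N <= n)%N -> abs (u n - l) < e
}.

End PadicNumbers.

Section GaloisGroup.

Variables (F K : fieldType) (i : {rmorphism F -> K}).

Definition is_aut (f : K -> K) : Prop :=
  [/\ zmod_morphism f, monoid_morphism f, bijective f
    & forall x, f (i x) = i x].

(* Gal(K/F), for K an extension of F by i. *)
Record GalGroup := Gal { gal_fun :> K -> K; _ : `[< is_aut gal_fun >] }.

HB.instance Definition _ := [isSub for gal_fun].
HB.instance Definition _ := [Choice of GalGroup by <:].

Lemma galP (w : GalGroup) : is_aut w.
Proof. by apply/asboolP; case: w. Qed.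

Lemma gal_inj (w : GalGroup) : injective w.
Proof. by case: (galP w) => _ _ /bij_inj. Qed.

Lemma gal_fix (w : GalGroup) x : w (i x) = i x.
Proof. by case: (galP w). Qed.

Lemma gal_eqP (v w : GalGroup) : v =1 w -> v = w.
Proof. by move=> vw; apply/val_inj/funext. Qed.

HB.instance Definition _ (w : GalGroup) :=
  GRing.isZmodMorphism.Build K K (gal_fun w)
    (let: And4 aw _ _ _ := galP w in aw).
HB.instance Definition _ (w : GalGroup) :=
  GRing.isMonoidMorphism.Build K K (gal_fun w)
    (let: And4 _ mw _ _ := galP w in mw).

Lemma is_aut_id : is_aut id.
Proof. by split=> //; exists id. Qed.

Lemma is_aut_comp (v w : GalGroup) : is_aut (v \o w).
Proof.
split=> [x y|||x] /=; rewrite ?rmorphB ?gal_fix //.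
  by split=> [|x y] /=; rewrite ?rmorph1 ?rmorphM.
by apply: bij_comp; [case: (galP v) | case: (galP w)].
Qed.

Lemma gal_inv_subproof (w : GalGroup) :
  exists g, [/\ is_aut g, cancel w g & cancel g w].
Proof.
have [_ _ [g wK gK] _] := galP w; exists g; split=> //; split.
- by move=> x y; apply: (@gal_inj w); rewrite rmorphB /= !gK.
- split=> [|x y] /=; apply: (@gal_inj w); first by rewrite gK rmorph1.
  by rewrite rmorphM /= !gK.
- by exists w.
- by move=> x; apply: (@gal_inj w); rewrite gK gal_fix.
Qed.

Definition gal_one : GalGroup := Gal (asboolT is_aut_id).
Definition gal_mul (v w : GalGroup) : GalGroup :=
  Gal (asboolT (is_aut_comp v w)).
Definition gal_inv (w : GalGroup) : GalGroup :=
  let: exist _ P := cid (gal_inv_subproof w) in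
  let: And3 ag _ _ := P in Gal (asboolT ag).

Lemma gal_invK (w : GalGroup) : cancel (gal_inv w) w.
Proof. by rewrite /gal_inv; case: cid => g [ag wK gK]. Qed.

Lemma gal_Kinv (w : GalGroup) : cancel w (gal_inv w).
Proof. by rewrite /gal_inv; case: cid => g [ag wK gK]. Qed.

Lemma gal_mulA : associative gal_mul.
Proof. by move=> u v w; apply: gal_eqP. Qed.
Lemma gal_mul1 : left_id gal_one gal_mul.
Proof. by move=> w; apply: gal_eqP. Qed.
Lemma gal_mulr1 : right_id gal_one gal_mul.
Proof. by move=> w; apply: gal_eqP. Qed.
Lemma gal_mulV : left_inverse gal_one gal_inv gal_mul.
Proof. by move=> w; apply: gal_eqP => x; apply: gal_Kinv. Qed.
Lemma gal_mulrV : right_inverse gal_one gal_inv gal_mul.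
Proof. by move=> w; apply: gal_eqP => x; apply: gal_invK. Qed.

HB.instance Definition _ :=
  isGroup.Build GalGroup gal_mulA gal_mul1 gal_mulr1 gal_mulV gal_mulrV.

(* Continuity for the Krull topology on Gal(K/F) and the discrete topology on
   the target: the automorphisms agreeing with w on a finite subset of K form
   a basis of neighbourhoods of w. *)
Definition gal_continuous (T : Type) (h : GalGroup -> T) : Prop :=
  forall w : GalGroup, exists S : seq K, forall v : GalGroup,
    {in S, v =1 w} -> h v = h w.

End GaloisGroup.

Section LocalField.

Variables (Qp : fieldType) (abs : Qp -> rat) (F : fieldExtType Qp).
Variables (Fc : closedFieldType) (iota : {rmorphism F -> Fc}).

(* All extensions of F are subfields of Fc. *)

Definition base_field : {pred Fc} := fun x => `[< exists y, x = iota y >].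

Definition subextension (K : {pred Fc}) : Prop :=
  divring_closed K /\ {subset base_field <= K}.

Definition is_basis (K : {pred Fc}) n (b : 'I_n -> Fc) : Prop :=
  (forall j, b j \in K) /\
  (forall x, x \in K ->
     exists! c : 'rV[F]_n, x = \sum_j iota (c 0 j) * b j).

Definition finite_extension (K : {pred Fc}) : Prop :=
  subextension K /\ exists n (b : 'I_n -> Fc), is_basis K b.

(* The trace of multiplication by x on the F-vector space K. *)
Definition is_trace (K : {pred Fc}) (x : Fc) (t : F) : Prop :=
  exists n (b : 'I_n -> Fc) (M : 'M[F]_n),
    [/\ is_basis K b, forall i, x * b i = \sum_j iota (M i j) * b j
      & t = \tr M].

(* The integral closure of Zp = {y | abs y <= 1} in Fc. *)
Definition integers : {pred Fc} := fun x =>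
  `[< exists2 P : {poly Qp}, P \is monic &
        (forall i, abs P`_i <= 1) /\
        root (map_poly (iota \o in_alg F) P) x >].

Definition integers_of (K : {pred Fc}) : {pred Fc} :=
  [pred x | (x \in K) && (x \in integers)].

Definition unit_of (K : {pred Fc}) : {pred Fc} :=
  [pred x | [&& x != 0, x \in integers_of K & x^-1 \in integers_of K]].

(* z generates the ideal of non-units of the ring of integers of K. *)
Definition is_uniformizer (K : {pred Fc}) (z : Fc) : Prop :=
  [/\ z \in K, z != 0 &
      forall x, (x \in integers_of K) && (x \notin unit_of K) <->
                exists2 y, y \in integers_of K & x = z * y].

Definition ramification_index (K : {pred Fc}) (e : nat) : Prop :=
  exists z Z, [/\ is_uniformizer base_field z, is_uniformizer K Z
                & z / Z ^+ e \in unit_of K].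

(* Residue fields are finite, hence perfect, so that separability of the
   residue extension is automatic in the next two definitions. *)
Definition unramified (K : {pred Fc}) : Prop :=
  finite_extension K /\ ramification_index K 1.

Definition tame (p : nat) (K : {pred Fc}) : Prop :=
  finite_extension K /\ exists2 e, ramification_index K e & coprime e p.

Definition compositum (P : {pred Fc} -> Prop) : {pred Fc} := fun x =>
  `[< forall K, subextension K -> (forall L, P L -> {subset L <= K}) ->
        x \in K >].

Definition Fnr : {pred Fc} := compositum unramified.
Definition Ft (p : nat) : {pred Fc} := compositum (tame p).

(* The residue field of F, where pi is a uniformizer, has q elements. *)
Definition residue_card (pi : F) (q : nat) : Prop :=
  exists red : F -> 'I_q,
    (forall c, exists2 x, iota x \in integers & red x = c) /\
    (forall x y, iota x \in integers -> iota y \in integers ->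
       red x = red y <->
       exists2 z, iota z \in integers & x - y = pi * z).

Definition is_fractional_ideal (K I : {pred Fc}) : Prop :=
  [/\ {subset I <= K}, exists2 x, x \in I & x != 0,
      (forall x y, x \in I -> y \in I -> x + y \in I),
      (forall c x, c \in integers_of K -> x \in I -> c * x \in I)
    & exists2 d, d \in integers_of K & d != 0 /\
        forall x, x \in I -> d * x \in integers_of K].

Definition ideal_mul (I J : {pred Fc}) : {pred Fc} := fun x =>
  `[< exists2 s : seq (Fc * Fc),
        {in s, forall u, (u.1 \in I) && (u.2 \in J)} &
        x = \sum_(u <- s) u.1 * u.2 >].

Definition inverse_different (K : {pred Fc}) : {pred Fc} := fun x =>
  `[< x \in K /\ forall y, y \in integers_of K ->
        exists2 t, is_trace K (x * y) t & iota t \in integers >].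

(* The square root of the inverse different. It is unique when it exists; the
   default value pred0 is not a fractional ideal. *)
Definition sqrt_inverse_different (K : {pred Fc}) : {pred Fc} :=
  xget (pred0 : Fc -> bool)
    [set I : Fc -> bool | is_fractional_ideal K I /\
       ideal_mul I I =i inverse_different K].

End LocalField.

Section TameField.

Variables (Qp : fieldType) (abs : Qp -> rat) (F : fieldExtType Qp).
Variables (Fc : closedFieldType) (iota : {rmorphism F -> Fc}) (p : nat).

Lemma compositum_divring_closed P : divring_closed (compositum iota P).
Proof.
split=> [|x y xP yP|x y xP yP]; apply/asboolP => K sK LK;
  have [[K1 KB KD] _] := sK.
- exact: K1.
- by apply: KB; [move/asboolP: xP | move/asboolP: yP]; apply.
- by apply: KD; [move/asboolP: xP | move/asboolP: yP]; apply.
Qed.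

Lemma base_compositum P x : iota x \in compositum iota P.
Proof. by apply/asboolP => K [_ sK] _; apply/sK/asboolP; exists x. Qed.

HB.instance Definition _ :=
  GRing.isDivringClosed.Build Fc (Ft abs iota p)
    (@compositum_divring_closed (tame abs iota p)).

(* The maximal tamely ramified extension of F in Fc, as a field. *)
Record tame_field := TameField {
  tame_val :> Fc; tame_valP : tame_val \in Ft abs iota p }.

HB.instance Definition _ := [isSub for tame_val].
HB.instance Definition _ := [Choice of tame_field by <:].
HB.instance Definition _ := [SubChoice_isSubIntegralDomain of tame_field by <:].
HB.instance Definition _ := [SubIntegralDomain_isSubField of tame_field by <:].

Definition tame_emb (x : F) : tame_field :=
  TameField (base_compositum (tame abs iota p) x).

Lemma tame_emb_zmod : zmod_morphism tame_emb.
Proof. by move=> x y; apply: val_inj; rewrite /= rmorphB. Qed.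
Lemma tame_emb_monoid : monoid_morphism tame_emb.
Proof.
by split=> [|x y]; apply: val_inj; rewrite /= ?rmorph1 ?rmorphM.
Qed.

HB.instance Definition _ :=
  GRing.isZmodMorphism.Build F tame_field tame_emb tame_emb_zmod.
HB.instance Definition _ :=
  GRing.isMonoidMorphism.Build F tame_field tame_emb tame_emb_monoid.

End TameField.

Section Restriction.

Variables (Qp : fieldType) (abs : Qp -> rat) (F : fieldExtType Qp).
Variables (Fc : closedFieldType) (iota : {rmorphism F -> Fc}) (p : nat).
Implicit Types (w : GalGroup iota) (K L : {pred Fc}).

Let img w K : {pred Fc} := fun y => gal_inv w y \in K.

Local Lemma mem_img w K x : (w x \in img w K) = (x \in K).
Proof. by rewrite unfold_in gal_Kinv. Qed.

Local Lemma integers_gal_sub w x :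
  x \in integers abs iota -> w x \in integers abs iota.
Proof.
move/asboolP=> [P Pm [Pi Px]]; apply/asboolP; exists P => //; split=> //.
have := rmorph_root w Px; rewrite -map_poly_comp.
by rewrite (eq_map_poly (g := iota \o in_alg F)) // => y /=; rewrite gal_fix.
Qed.

Local Lemma integers_gal w x :
  (w x \in integers abs iota) = (x \in integers abs iota).
Proof.
apply/idP/idP; last exact: integers_gal_sub.
by move/(integers_gal_sub (gal_inv w)); rewrite gal_Kinv.
Qed.

Local Lemma integers_of_img w K x :
  (w x \in integers_of abs iota (img w K)) = (x \in integers_of abs iota K).
Proof. by rewrite !inE mem_img integers_gal. Qed.

Local Lemma unit_of_img w K x :
  (w x \in unit_of abs iota (img w K)) = (x \in unit_of abs iota K).
Proof.
rewrite [in LHS]inE [in RHS]inE -fmorphV !integers_of_img.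
by rewrite fmorph_eq0.
Qed.

Local Lemma subextension_img w K :
  subextension iota K -> subextension iota (img w K).
Proof.
case=> [[K1 KB KD] sK]; split; first split.
- by rewrite -(rmorph1 w) mem_img.
- by move=> x y xK yK; rewrite unfold_in rmorphB; apply: KB.
- by move=> x y xK yK; rewrite unfold_in fmorph_div; apply: KD.
move=> x /asboolP[y ->]; rewrite -(gal_fix w) mem_img.
by apply: sK; apply/asboolP; exists y.
Qed.

Local Lemma basis_img w K n (b : 'I_n -> Fc) :
  is_basis iota K b -> is_basis iota (img w K) (w \o b).
Proof.
case=> bK Kb; split=> [j|x xK] /=; first by rewrite mem_img.
have sumE (c : 'rV[F]_n) : \sum_j iota (c 0 j) * w (b j) =
    w (\sum_j iota (c 0 j) * b j).
  by rewrite rmorph_sum; apply: eq_bigr => j _; rewrite rmorphM /= gal_fix.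
have [c [cE cU]] := Kb _ xK; exists c; split=> [|d dE].
  by rewrite sumE -cE gal_invK.
by apply: cU; rewrite dE sumE gal_Kinv.
Qed.

Local Lemma uniformizer_img w K z :
  is_uniformizer abs iota K z -> is_uniformizer abs iota (img w K) (w z).
Proof.
case=> Kz z0 zK; split=> [||x]; first by rewrite mem_img.
  by rewrite fmorph_eq0.
rewrite -{1 2}(gal_invK w x) integers_of_img unit_of_img; split.
  case/zK=> y yK xE; exists (w y); first by rewrite integers_of_img.
  by rewrite -rmorphM -xE /= gal_invK.
case=> y; rewrite -{1 2}(gal_invK w y) integers_of_img => yK ->.
by apply/zK; exists (gal_inv w y); rewrite // rmorphM /= !gal_Kinv.
Qed.

Local Lemma tame_img w K : tame abs iota p K -> tame abs iota p (img w K).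
Proof.
case=> [[sK [n [b bK]]] [e [z [Z [uz uZ zZ]]] ep]]; split.
  by split; [exact: subextension_img | exists n, (w \o b); exact: basis_img].
exists e => //; exists z, (w Z); split=> //; first exact: uniformizer_img.
suff wz : w z = z by rewrite -{1}wz -rmorphXn -fmorph_div unit_of_img.
by have [/asboolP[y ->] _ _] := uz; rewrite gal_fix.
Qed.

Lemma Ft_gal w x : x \in Ft abs iota p -> w x \in Ft abs iota p.
Proof.
move=> /asboolP xFt; apply/asboolP => K sK tK.
have : x \in img (gal_inv w) K.
  apply: xFt; first exact: subextension_img.
  move=> L tL y yL; have := tK _ (tame_img w tL) (w y).
  rewrite mem_img => /(_ yL) wyK.
  by rewrite -(gal_Kinv w y) mem_img.
by rewrite -{1}(gal_Kinv w x) mem_img.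
Qed.

Definition res_fun w (x : tame_field abs iota p) : tame_field abs iota p :=
  TameField (Ft_gal w (tame_valP x)).

Lemma res_subproof w : is_aut (tame_emb abs iota p) (res_fun w).
Proof.
split.
- by move=> x y; apply: val_inj; rewrite /= rmorphB.
- by split=> [|x y]; apply: val_inj; rewrite /= ?rmorph1 ?rmorphM.
- exists (res_fun (gal_inv w)) => x; apply: val_inj => /=.
    exact: gal_Kinv.
  exact: gal_invK.
- by move=> x; apply: val_inj; rewrite /= gal_fix.
Qed.

(* Restriction Gal(Fc/F) -> Gal(Ft/F). *)
Definition res w : GalGroup (tame_emb abs iota p) :=
  Gal (asboolT (res_subproof w)).

End Restriction.

Section Resolvend.

Variables (Qp : fieldType) (abs : Qp -> rat) (F : fieldExtType Qp).
Variables (Fc : closedFieldType) (iota : {rmorphism F -> Fc}).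
Variable gT : finGroupType.

(* F^h *)
Definition fixed_field (h : GalGroup iota -> gT) : {pred Fc} := fun x =>
  `[< forall w, h w = 1%g -> w x = x >].

(* F_h *)
Definition galois_algebra (h : GalGroup iota -> gT) : {pred {ffun gT -> Fc}} :=
  fun a => `[< forall (w : GalGroup iota) s, w (a s) = a (h w * s)%g >].

Definition gact (s : gT) (a : {ffun gT -> Fc}) : {ffun gT -> Fc} :=
  [ffun t => a (t * s)%g].

(* A_h *)
Definition sqrt_module (h : GalGroup iota -> gT) : {pred {ffun gT -> Fc}} :=
  [pred a | (a \in galois_algebra h) &&
    [forall s, a s \in sqrt_inverse_different abs iota (fixed_field h)]].

(* O_F G . a *)
Definition integral_span (a : {ffun gT -> Fc}) : {pred {ffun gT -> Fc}} :=
  fun b => `[< exists2 c : {ffun gT -> F},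
                 forall s, iota (c s) \in integers abs iota &
                 forall t, b t = \sum_s iota (c s) * gact s a t >].

(* An element x of the group algebra Fc G is the function of its coefficients;
   the ring structure that {ffun gT -> Fc} inherits from Fc is pointwise and
   is not the one of Fc G. *)
Definition gconv (x y : {ffun gT -> Fc}) : {ffun gT -> Fc} :=
  [ffun t => \sum_s x s * y (s^-1 * t)%g].

Definition gdelta (s : gT) : {ffun gT -> Fc} := [ffun t => (t == s)%:R].

Definition gal_coef (w : GalGroup iota) (x : {ffun gT -> Fc})
    : {ffun gT -> Fc} :=
  [ffun t => w (x t)].

(* The units of R G, for a subring R of Fc. *)
Definition gunit (R : {pred Fc}) (x : {ffun gT -> Fc}) : Prop :=
  (forall t, x t \in R) /\
  exists y : {ffun gT -> Fc},
    [/\ forall t, y t \in R, gconv x y = gdelta 1 & gconv y x = gdelta 1].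

(* The class of x belongs to ((R G)^* / G)^Gal(Fc/F). *)
Definition in_calH (R : {pred Fc}) (x : {ffun gT -> Fc}) : Prop :=
  gunit R x /\
  forall w : GalGroup iota, exists s, gal_coef w x = gconv x (gdelta s).

(* The coefficient at t of \sum_s a(s) s^-1 is a(t^-1). *)
Definition resolvend (a : {ffun gT -> Fc}) : {ffun gT -> Fc} :=
  [ffun t => a (t^-1)%g].

End Resolvend.

Section Stickelberger.

Variables (Fc : closedFieldType) (gT : finGroupType).

(* Hom(G, Fc^* ); the values are nonzero since chi 1 = 1. *)
Record Ghat := MkGhat {
  Ghat_fun :> {ffun gT -> Fc};
  _ : (Ghat_fun 1%g == 1) &&
      [forall s, forall t, Ghat_fun (s * t)%g == Ghat_fun s * Ghat_fun t] }.

HB.instance Definition _ := [isSub for Ghat_fun].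
HB.instance Definition _ := [Choice of Ghat by <:].

(* The free abelian group on Ghat. *)
Definition ZGhat := {fsfun Ghat -> int with 0}.

Definition in_AGhat (psi : ZGhat) : Prop :=
  forall s, \prod_(chi <- finsupp psi) chi s ^ psi chi = 1.

(* The homomorphism ZGhat -> Fc^* attached to a unit x of Fc G; its restriction
   to the psi in AGhat depends on, and determines, the class x G. *)
Definition geval (x : {ffun gT -> Fc}) (psi : ZGhat) : Fc :=
  \prod_(chi <- finsupp psi) (\sum_t x t * chi t) ^ psi chi.

Variable zeta : nat -> Fc.

Definition upsilon (chi : Ghat) (s : gT) : int :=
  xget 0 [set v : int | (1 - #[s]%g%:Z)%:Q / 2 <= v%:Q <= (#[s]%g%:Z - 1)%:Q / 2
                        /\ chi s = zeta #[s]%g ^ v].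

Definition stickelberger (psi : ZGhat) (s : gT) : rat :=
  \sum_(chi <- finsupp psi)
    (psi chi)%:Q * ((upsilon chi s)%:Q / #[s]%g%:R).

(* The rational exponent is an integer when psi is in AGhat. *)
Definition Theta (g : gT -> Fc) (psi : ZGhat) : Fc :=
  \prod_s g s ^ numq (stickelberger psi s).

Variables (F : fieldType) (iota : {rmorphism F -> Fc}).

(* A natural number representing the cyclotomic character at w modulo the
   exponent of G. *)
Definition cyclotomic_char (w : GalGroup iota) : nat :=
  let m := exponent [set: gT] in
  xget 0%N [set k : nat | w (zeta m) = zeta m ^+ k].

(* The action of w on G(-1). *)
Definition twisted_act (w : GalGroup iota) (s : gT) : gT :=
  (s ^+ expg_invn [set: gT] (cyclotomic_char w))%g.

Definition in_Lambda (g : gT -> Fc) : Prop :=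
  (forall s, g s != 0) /\
  forall (w : GalGroup iota) s, w (g s) = g (twisted_act w s).

Definition prime_f (pi : F) (s t : gT) : Fc :=
  if (t == s) && (s != 1%g) then iota pi else 1.

End Stickelberger.

(* Main.v *)
Require Import Defs.
From HB Require Import structures.
From mathcomp Require Import all_boot all_order all_algebra all_fingroup.
From mathcomp Require Import all_solvable all_field.
From mathcomp Require Import finmap boolp classical_sets.
From mathcomp Require Import ring zify.

Set Implicit Arguments.
Unset Strict Implicit.
Unset Printing Implicit Defensive.

Import Order.TTheory GRing.Theory Num.Theory.
Local Open Scope ring_scope.

(* Write s = h sigma, e = #[s], r = r_G(a), let rad e be the chosen e-th root of
   pi, and let theta be the element of Fc<s> on which each character chi takes
   the value (rad e)^(- upsilon(chi, s)). Then u := r theta satisfies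
   r = u Theta(f_s) on A_Ghat. A coefficient of u is, up to the unit e, a sum of
   products x_k (rad e)^(-k) with |k| < e/2, where x_k is a sum of unit multiples
   of values of a and is an eigenvector of sigma with eigenvalue zeta_e^k. The
   valuation of x_k lies in (k/e) v(pi) + Z v(pi), and exceeds - v(pi)/2 because
   the square of A^h is the inverse different of a tame extension; hence
   x_k (rad e)^(-k) is integral. Write [-1] for the inversion of G. The module
   A_h is free on a and its own dual for the trace form, so r^-1 = c r^[-1] with c
   in O_F G; as theta theta^[-1] = 1, u^-1 = c u^[-1] is integral as well.

   The ring Zp[y], for an integral y, is p-adically complete: contractions of it
   have fixed points, which gives inverses, idempotents, roots of one-units and
   Teichmuller representatives without appeal to Hensel's lemma. *)

(** * Extension of automorphisms *)

(** The Galois group is infinite, but every tame extension lies in a union of fields F(zeta_N,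
    pi^(1/n)) with N prime to p and n dividing N. By continuity h factors through the finite Galois
    group of one such field, whose inertia group is generated by sigma. There w sigma w^-1 =
    sigma^k, k being the cyclotomic exponent of w; as G is abelian, this forces zeta_e into F, which
    makes e divide q - 1, makes f_s equivariant, and lets Galois act on theta by translations. Since
    e is odd, the exponents k with |k| < e/2 form a symmetric set of representatives modulo e.
    Symmetry gives theta theta^[-1] = 1, and |k| < e/2 makes the bound - v(pi)/2 just sufficient: an
    integer j with j + k/e > -1/2 is nonnegative. No valuation is constructed: for x in the fixed
    field of h, v(x) = (j/e) v(pi) is expressed by x^e / pi^j being a unit. Likewise discriminants
    are replaced by explicit dual families made of powers of zeta_N and pi^(1/n), whose duality is
    the orthogonality of roots of unity. *)

Section PartialMorphisms.

Local Open Scope classical_set_scope.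
Local Open Scope ring_scope.

Variables (F : fieldType) (Fc : closedFieldType) (iota : {rmorphism F -> Fc}).
Hypothesis alg : forall x : Fc, algebraicOver iota x.

(* X is the graph of an F-morphism from a subring of Fc to Fc. *)
Record morphism_graph (X : set (Fc * Fc)) : Prop := MorphismGraph {
  graph_base : forall c, X (iota c, iota c);
  graph_sub : forall a b, X a -> X b -> X (a - b);
  graph_mul : forall a b, X a -> X b -> X (a * b);
  graph_fun : forall y, X (0, y) -> y = 0 }.

Section Graph.

Variables (X : set (Fc * Fc)) (gX : morphism_graph X).

Lemma graph1 : X 1.
Proof. by have := graph_base gX 1; rewrite !rmorph1. Qed.

Lemma graph0 : X 0.
Proof. by rewrite -(subrr 1); apply: (graph_sub gX graph1 graph1). Qed.

Lemma graph_add a b : X a -> X b -> X (a + b).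
Proof.
move=> Xa Xb; rewrite -[b]opprK; apply: (graph_sub gX) => //.
by rewrite -sub0r; apply: (graph_sub gX graph0).
Qed.

Lemma graph_inj x y z : X (x, y) -> X (x, z) -> y = z.
Proof.
move=> xy xz; apply: subr0_eq; apply: (graph_fun gX).
by rewrite -(subrr x); apply: (graph_sub gX xy xz).
Qed.

Lemma graph_horner (P : {poly F}) x y :
  X (x, y) -> X ((map_poly iota P).[x], (map_poly iota P).[y]).
Proof.
move=> xy; elim/poly_ind: P => [|P c IH].
  by rewrite rmorph0 !horner0; apply: graph0.
rewrite rmorphD rmorphM /= map_polyX map_polyC !hornerE.
exact: (graph_add (graph_mul gX IH xy) (graph_base gX c)).
Qed.

(** The domain is algebraic over F, so the inverse of x is a polynomial in x: from P(x) x + c = 0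
    with c nonzero, x^-1 = - P(x) / c. The image y satisfies the same equation. A zero constant term
    is divided out by the induction. *)
Lemma graph_inv x y : X (x, y) -> X (x^-1, y^-1).
Proof.
move=> xy; have [x0|x0] := eqVneq x 0.
  by move: xy; rewrite x0 => /(graph_fun gX)->; rewrite invr0; apply: graph0.
have [P P0 Px] := alg x; elim/poly_ind: P P0 Px => [|P c IH]; first by rewrite eqxx.
have [->|c0] := eqVneq c 0.
  rewrite addr0 => P0 rP; apply: IH.
    by apply: contra_neq P0 => ->; rewrite mul0r.
  by move: rP; rewrite rmorphM /= map_polyX rootM rootX (negPf x0) orbF.
move=> _ Px.
have cx0 : iota c != 0 by rewrite fmorph_eq0.
have Pxy := graph_horner P xy.
have inv z : root (map_poly iota (P * 'X + c%:P)) z ->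
    z^-1 = (map_poly iota P).[z] * iota (- c^-1).
  rewrite /root rmorphD rmorphM /= map_polyX map_polyC !hornerE => /eqP zE.
  have z0 : z != 0.
    by apply: contraNneq cx0 => z0; rewrite -zE z0 mulr0 add0r.
  have zE' : (map_poly iota P).[z] * z = - iota c by apply/eqP; rewrite -addr_eq0 zE.
  apply: (mulIf z0); rewrite mulVf // mulrAC zE' rmorphN fmorphV.
  by rewrite mulNr mulrN opprK divff.
have Py : root (map_poly iota (P * 'X + c%:P)) y.
  have := graph_horner (P * 'X + c%:P) xy.
  by rewrite (rootP Px) => /(graph_fun gX)/rootP.
rewrite (inv x) // (inv y) //.
exact: (graph_mul gX Pxy (graph_base gX _)).
Qed.

Definition graph_pred : {pred Fc * Fc} := fun z => `[< X z >].

Lemma graph_subring : subring_closed graph_pred.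
Proof.
split=> [|a b /asboolP Xa /asboolP Xb|a b /asboolP Xa /asboolP Xb].
- exact/asboolP/graph1.
- exact/asboolP/(graph_sub gX).
- exact/asboolP/(graph_mul gX).
Qed.

HB.instance Definition _ :=
  GRing.isSubringClosed.Build (Fc * Fc)%type graph_pred graph_subring.

(** As a field type the graph supports polynomial division; its two projections are the inclusion of
    the domain and the partial morphism. *)
Record graph_field := GraphField {
  graph_val :> Fc * Fc; graph_valP : graph_val \in graph_pred }.

HB.instance Definition _ := [isSub for graph_val].
HB.instance Definition _ := [Choice of graph_field by <:].
HB.instance Definition _ := [SubChoice_isSubComNzRing of graph_field by <:].

Lemma graph_inv_subproof (z : graph_field) :
  ((val z).1^-1, (val z).2^-1) \in graph_pred.
Proof.
by case: z => -[x y] Xz; apply/asboolP/graph_inv; apply: asboolW Xz.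
Qed.

Definition graph_field_inv z := GraphField (graph_inv_subproof z).

Lemma graph_mulVf z : z != 0 -> graph_field_inv z * z = 1.
Proof.
case: z => -[x y] Xz z0; apply: val_inj; rewrite rmorphM rmorph1 /=.
have Xxy : X (x, y) := asboolW Xz.
have x0 : x != 0.
  apply: contraNneq z0 => x0; apply/eqP/val_inj; rewrite rmorph0 /= x0.
  by move: Xxy; rewrite x0 => /(graph_fun gX)->.
have y0 : y != 0.
  apply: contraNneq z0 => y0; apply/eqP/val_inj; rewrite rmorph0 /= y0.
  move: Xxy; rewrite y0 => Xxy.
  have [->//|x1] := eqVneq x 0.
  have := graph_mul gX (graph_inv Xxy) Xxy; rewrite invr0.
  have -> : (x^-1, 0) * (x, 0) = (1, 0) :> Fc * Fc.
    by congr (_, _); rewrite ?mulVf ?mulr0.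
  by move/(graph_inj graph1)/eqP; rewrite oner_eq0.
by congr (_, _); rewrite mulVf.
Qed.

Lemma graph_inv0 : graph_field_inv 0 = 0.
Proof. by apply: val_inj; rewrite rmorph0; congr (_, _); apply: invr0. Qed.

HB.instance Definition _ :=
  GRing.ComNzRing_isField.Build graph_field graph_mulVf graph_inv0.

(** [P1] is the minimal polynomial of x over the domain and [P2] its image. Sending x to a root of
    [P2] is well defined because [P1] divides every polynomial vanishing at x. Both are exposed so
    that a caller can choose the root. *)
Lemma graph_adjoin (x : Fc) : (forall y, ~ X (x, y)) ->
  exists P1 P2 : {poly Fc}, [/\ P1 \is monic, root P1 x,
     (forall i, X (P1`_i, P2`_i)), size P2 = size P1
    & forall x', root P2 x' ->
        exists X', [/\ morphism_graph X', X `<=` X' & X' (x, x')]].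
Proof.
move=> Xx.
pose e1 : {rmorphism graph_field -> Fc} := fst \o val.
pose e2 : {rmorphism graph_field -> Fc} := snd \o val.
have e12 z : X (e1 z, e2 z) by case: z => -[u v] uv; apply: asboolW uv.
pose cand n := `[< exists2 P : {poly graph_field},
  P != 0 & root (map_poly e1 P) x /\ size P = n >].
have e_base c : (iota c, iota c) \in graph_pred by apply/asboolP/(graph_base gX).
have /ex_minnP[n /asboolP[P P0 [Px Pn]] minP] : exists n, cand n.
  have [Q Q0 Qx] := alg x.
  pose Q' : {poly graph_field} := \poly_(i < size Q) GraphField (e_base Q`_i).
  have Q'E : map_poly e1 Q' = map_poly iota Q.
    apply/polyP => i; rewrite !coef_map coef_poly.
    case: ltnP => // ?; rewrite nth_default //.
    exact: etrans (rmorph0 e1) (esym (rmorph0 iota)).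
  exists (size Q'); apply/asboolP; exists Q'; last by rewrite Q'E.
  by rewrite -(map_poly_eq0 e1) Q'E map_poly_eq0.
have dvdP (f : {poly graph_field}) : root (map_poly e1 f) x -> P %| f.
  move=> fx; apply/modp_eq0P/eqP/negPn/negP => R0.
  have : (n <= size (f %% P)%R)%N.
    apply: minP; apply/asboolP; exists (f %% P) => //; split=> //.
    apply/rootP; move/rootP: fx; rewrite {1}(divp_eq f P) rmorphD rmorphM /=.
    by rewrite hornerD hornerM (rootP Px) mulr0 add0r.
  by rewrite -Pn leqNgt ltn_modp P0.
pose M := (lead_coef P)^-1 *: P.
have M0 : lead_coef P != 0 by rewrite lead_coef_eq0.
have MM : M \is monic by rewrite monicE lead_coefZ mulVf.
exists (map_poly e1 M), (map_poly e2 M); split.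
- by rewrite map_monic.
- by rewrite map_polyZ rootZ // fmorph_eq0 invr_eq0.
- by move=> i; rewrite !coef_map; apply: e12.
- by rewrite !size_map_poly.
move=> x' Mx'.
have Px' : root (map_poly e2 P) x'.
  by move: Mx'; rewrite map_polyZ rootZ // fmorph_eq0 invr_eq0.
pose X' : set (Fc * Fc) := [set z | exists f : {poly graph_field},
  z = ((map_poly e1 f).[x], (map_poly e2 f).[x'])].
have XX' : X `<=` X'.
  move=> [u v] Xuv; have uv : (u, v) \in graph_pred by apply/asboolP.
  by exists (GraphField uv)%:P; rewrite !map_polyC !hornerC.
exists X'; split=> //; last by exists 'X; rewrite !map_polyX !hornerX.
split.
- by move=> c; apply/XX'/(graph_base gX).
- by move=> _ _ [f ->] [g ->]; exists (f - g); rewrite !rmorphB !hornerE.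
- by move=> _ _ [f ->] [g ->]; exists (f * g); rewrite !rmorphM !hornerM.
- move=> y [f [/esym/rootP fx ->]]; have /dvdpP[g fE] := dvdP f fx.
  suff : (map_poly e2 f).[x'] = 0 by [].
  by rewrite fE rmorphM hornerM (rootP Px') mulr0.
Qed.

End Graph.

Lemma graph_extend (X0 : set (Fc * Fc)) : morphism_graph X0 ->
  exists w : GalGroup iota, forall x y, X0 (x, y) -> w x = y.
Proof.
move=> gX0; pose P X := X = set0 \/ (morphism_graph X /\ X0 `<=` X).
have chainP G : G `<=` P -> total_on G subset -> P (\bigcup_(X in G) X).
  move=> GP Gtot.
  have [[Y [GY Y0]]|all0] := pselect (exists Y, G Y /\ Y <> set0); last first.
    left; apply/seteqP; split=> // z [Y GY Yz]; apply: all0; exists Y.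
    by split=> // Y0; rewrite Y0 in Yz.
  right; have good Z z : G Z -> Z z -> morphism_graph Z.
    by move=> GZ Zz; have [Z0|[]] := GP _ GZ; first by rewrite Z0 in Zz.
  have [//|[gY XY]] := GP _ GY.
  have op2 (op : Fc * Fc -> Fc * Fc -> Fc * Fc) a b :
    (forall Z, morphism_graph Z -> Z a -> Z b -> Z (op a b)) ->
    (\bigcup_(X in G) X) a -> (\bigcup_(X in G) X) b ->
    (\bigcup_(X in G) X) (op a b).
    move=> opP [A GA Aa] [B GB Bb].
    have [AB|BA] := Gtot _ _ GA GB.
      by exists B => //; apply: opP; [exact: good GB Bb | apply: AB | ].
    by exists A => //; apply: opP; [exact: good GA Aa | | apply: BA].
  split; last by move=> z /XY Yz; exists Y.
  split.
  - by move=> c; exists Y => //; apply: graph_base gY c.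
  - by move=> a b; apply: (op2 (fun a b => a - b)) => Z gZ; apply: graph_sub.
  - by move=> a b; apply: (op2 *%R) => Z gZ; apply: graph_mul.
  - by move=> y [Z GZ Zy]; apply: (graph_fun (good _ _ GZ Zy) Zy).
have [X [PX maxX]] := Zorn_bigcup chainP.
have X0n0 : X0 <> set0.
  by move=> X00; have := graph_base gX0 0; rewrite X00.
have [gX X0X] : morphism_graph X /\ X0 `<=` X.
  case: PX => // XE; case: (maxX X0); last by right; split.
  by rewrite XE; split=> //; rewrite subset0.
have dom x : exists y, X (x, y).
  apply: contrapT => /forallNP Xx.
  have [P1 [P2 [P1m P1x _ P12 ext]]] := graph_adjoin gX Xx.
  have [x' P2x'] : exists x', root P2 x'.
    apply/closed_rootP; rewrite P12 neq_ltn; apply/orP; right.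
    by rewrite (root_size_gt1 _ P1x) // monic_neq0.
  have [X' [gX' XX' X'x]] := ext x' P2x'.
  apply: (maxX X'); last by right; split=> // z /X0X/XX'.
  by split=> // X'X; apply: (Xx x'); apply: X'X.
have [w wP] := choice dom.
have wE x y : X (x, y) -> w x = y by move=> /(graph_inj gX (wP x)).
have w_inj : injective w.
  move=> x y wxy; apply: subr0_eq; apply: contrapT => /eqP xy0.
  have := graph_sub gX (wP x) (wP y); rewrite wxy => Xd.
  have := graph_mul gX Xd (graph_inv gX Xd).
  have -> : ((x, w y) - (y, w y)) * ((x - y)^-1, (w y - w y)^-1) =
    (1, 0) :> Fc * Fc.
    by apply: injective_projections; rewrite /= ?subrr ?mul0r ?mulfV.
  by move/(graph_inj gX (graph1 gX))/eqP; rewrite oner_eq0.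
have w_aut : is_aut iota w.
  split.
  - by move=> x y; apply: wE; apply: (graph_sub gX (wP x) (wP y)).
  - split=> [|x y]; first exact: wE (graph1 gX).
    exact: wE (graph_mul gX (wP x) (wP y)).
  (* The finite set of roots of a polynomial over F is mapped injectively into itself, hence onto
     itself. *)
  - have w_surj y : exists x, w x = y.
      have [Q Q0 Qy] := alg y.
      have [rs rsE] := closed_field_poly_normal (map_poly iota Q).
      have Q0' : lead_coef (map_poly iota Q) != 0 by rewrite lead_coef_eq0 map_poly_eq0.
      have rsP z : root (map_poly iota Q) z = (z \in undup rs).
        by rewrite rsE rootZ // root_prod_XsubC mem_undup.
      have wQ z : root (map_poly iota Q) z -> root (map_poly iota Q) (w z).
        move=> /rootP Qz; apply/rootP; have := graph_horner gX Q (wP z).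
        by rewrite Qz => /(graph_fun gX).
      have sub : {subset map w (undup rs) <= undup rs}.
        by move=> _ /mapP[z zr ->]; rewrite -rsP wQ // rsP.
      have uw : uniq (map w (undup rs)) by rewrite map_inj_uniq // undup_uniq.
      have [_ mE] := uniq_min_size uw sub (eq_leq (esym (size_map w _))).
      by move: Qy; rewrite rsP -mE => /mapP[x _ ->]; exists x.
    have [g gP] := choice w_surj; exists g => // x.
    by apply: w_inj; rewrite gP.
  - by move=> x; exact: wE (graph_base gX x).
by exists (Defs.Gal (asboolT w_aut)) => x y /X0X /wE.
Qed.

(** Characteristic zero supplies a second root to send x to: if x were the only root of its minimal
    polynomial over E, of degree d, the subleading coefficient would be - d x and x would lie in
    E. *)
Lemma gal_moves (E : {pred Fc}) x : [pchar Fc] =i pred0 ->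
  divring_closed E -> (forall c, iota c \in E) -> x \notin E ->
  exists2 w : GalGroup iota, {in E, forall y, w y = y} & w x != x.
Proof.
move=> char0 [E1 EB ED] FE xE.
have E0 : 0 \in E by rewrite -(subrr 1); apply: EB.
have EV y : y \in E -> y^-1 \in E by move=> yE; rewrite -div1r; apply: ED.
have EM y z : y \in E -> z \in E -> y * z \in E.
  by move=> yE zE; rewrite -[z]invrK; apply/ED/EV.
pose X0 : set (Fc * Fc) := [set z | z.1 \in E /\ z.2 = z.1].
have gX0 : morphism_graph X0.
  split=> [c|[a a'] [b b'] [/= aE ->] [/= bE ->]|
    [a a'] [b b'] [/= aE ->] [/= bE ->]|y [] //]; split=> //=.
    exact: EB.
  exact: EM.
have Xx y : ~ X0 (x, y) by case=> /= xE'; rewrite xE' in xE.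
have [P1 [P2 [P1m P1x P12 sP12 ext]]] := graph_adjoin gX0 Xx.
have P2E : P2 = P1.
  by apply/polyP => i; have [_ /= ->] := P12 i.
have [rs P1E] := closed_field_poly_normal P1.
rewrite (monicP P1m) scale1r in P1E.
have [x' P1x' x'x] : exists2 x', root P1 x' & x' != x.
  have [/hasP[x' x'r x'x]|/hasPn rsx] := boolP (has (predC1 x) rs).
    by exists x' => //; rewrite P1E root_prod_XsubC.
  have xr : x \in rs by rewrite -root_prod_XsubC -P1E.
  have n0 : size rs != 0%N by case: (rs) xr.
  have := coefPn_prod_XsubC n0; rewrite -P1E.
  rewrite (eq_big_seq (fun=> x)); last by move=> y /rsx /negPn/eqP.
  rewrite big_const_seq count_predT iter_addr_0 => coE.
  case/negP: xE; have -> : x = - P1`_(size rs).-1 * (size rs)%:R^-1.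
    rewrite coE opprK -[x *+ _]mulr_natr mulfK //.
    by rewrite ((pcharf0P _).1 char0).
  apply: EM; first by rewrite -sub0r; apply: EB => //; have [] := P12 (size rs).-1.
  by rewrite -(rmorph_nat iota); apply: EV.
have [|X' [gX' X0X' X'x]] := ext x'; first by rewrite P2E.
have [w wP] := graph_extend gX'.
exists w => [y yE|]; last by rewrite (wP _ _ X'x).
by apply/wP/X0X'.
Qed.

Lemma gal_fixed_base x : [pchar Fc] =i pred0 ->
  (forall w : GalGroup iota, w x = x) -> exists c, x = iota c.
Proof.
move=> char0 wx; pose E : {pred Fc} := fun x => `[< exists c, x = iota c >].
have [/asboolP//|xE] := boolP (x \in E).
have Ed : divring_closed E.
  split=> [|_ _ /asboolP[c ->] /asboolP[d ->]|_ _ /asboolP[c ->] /asboolP[d ->]].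
  - by apply/asboolP; exists 1; rewrite rmorph1.
  - by apply/asboolP; exists (c - d); rewrite rmorphB.
  - by apply/asboolP; exists (c / d); rewrite fmorph_div.
have EF c : iota c \in E by apply/asboolP; exists c.
by have [w _ /eqP[]] := gal_moves char0 Ed EF xE.
Qed.

End PartialMorphisms.

(** * The field Qp *)

Section PadicField.

Variables (p : nat) (p_prime : prime p).
Variables (Qp : fieldType) (abs : Qp -> rat) (QpP : is_Qp p abs).

Let abs0 : abs 0 = 0. Proof. by apply/eqP; rewrite (Qp_abs0 QpP). Qed.

Lemma Qp_abs1 : abs 1 = 1.
Proof.
have a0 : abs 1 != 0 by rewrite (Qp_abs0 QpP) oner_eq0.
by apply: (mulfI a0); rewrite -(Qp_absM QpP) !mulr1.
Qed.

(** Nonnegativity of [abs] is not a field of [is_Qp]; the value -1 at -1 is excluded by the formula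
    on rationals. *)
Lemma Qp_absN x : abs (- x) = abs x.
Proof.
have N1 : abs (-1) = 1.
  have : abs (-1) * abs (-1) = 1 by rewrite -(Qp_absM QpP) mulrNN mulr1 Qp_abs1.
  rewrite -expr2 => /eqP; rewrite sqrf_eq1 => /orP[/eqP//|/eqP aN].
  have := Qp_abs_rat QpP (-1)%:~R; rewrite ratr_int rmorphN1 aN /padic_abs.
  move=> E; suff : (0 : rat) <= -1 by [].
  rewrite E; case: (_ == _) => //; rewrite exprz_ge0 // ler0z.
by rewrite -mulN1r (Qp_absM QpP) N1 mul1r.
Qed.

Lemma Qp_abs_ge0 x : 0 <= abs x.
Proof. by have := Qp_absD QpP x (- x); rewrite subrr abs0 le_max Qp_absN orbb. Qed.

Lemma Qp_absB x y : abs (x - y) <= Num.max (abs x) (abs y).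
Proof. by rewrite -(Qp_absN y) (Qp_absD QpP). Qed.

Lemma Qp_absX x n : abs (x ^+ n) = abs x ^+ n.
Proof.
elim: n => [|n IH]; first by rewrite !expr0 Qp_abs1.
by rewrite !exprS (Qp_absM QpP) IH.
Qed.

Lemma Qp_absV x : abs x^-1 = (abs x)^-1.
Proof.
have [->|x0] := eqVneq x 0; first by rewrite invr0 abs0 invr0.
have a0 : abs x != 0 by rewrite (Qp_abs0 QpP).
by apply: (mulfI a0); rewrite -(Qp_absM QpP) !mulfV // Qp_abs1.
Qed.

Lemma Qp_abs_p : abs p%:R = p%:R^-1.
Proof.
have := Qp_abs_rat QpP p%:R; rewrite ratr_nat => ->.
have p0 := prime_gt0 p_prime.
rewrite /padic_abs pnatr_eq0 -(negbK (p == 0%N)) -lt0n p0 /=.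
have -> : numq p%:R = p by rewrite -[p%:R]/(p%:~R) numq_int.
have -> : denq p%:R = 1 by rewrite -[p%:R]/(p%:~R) denq_int.
by rewrite absz1 absz_nat logn1 logn_prime ?eqxx.
Qed.

Lemma Qp_abs_p_lt1 : abs p%:R < 1.
Proof.
by rewrite Qp_abs_p invf_lt1 ?ltr1n ?ltr0n ?prime_gt1 ?prime_gt0.
Qed.

Lemma Qp_abs_p_gt0 : 0 < abs p%:R.
Proof. by rewrite Qp_abs_p invr_gt0 ltr0n prime_gt0. Qed.

Lemma Qp_p_neq0 : p%:R != 0 :> Qp.
Proof. by rewrite -(Qp_abs0 QpP) gt_eqF // Qp_abs_p_gt0. Qed.

Lemma Qp_abs_nat n : abs n%:R <= 1.
Proof.
elim: n => [|n IH]; first by rewrite abs0.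
by rewrite -natr1 (le_trans (Qp_absD QpP _ _)) // ge_max IH Qp_abs1.
Qed.

Lemma Qp_abs_int (n : int) : abs n%:~R <= 1.
Proof.
by case: n => n; rewrite ?NegzE ?mulrNz ?Qp_absN Qp_abs_nat.
Qed.

Lemma Qp_char0 : [pchar Qp] =i pred0.
Proof.
apply/pcharf0P => n; rewrite -(Qp_abs0 QpP).
have := Qp_abs_rat QpP n%:R; rewrite ratr_nat => ->; rewrite /padic_abs pnatr_eq0.
case: (n == 0%N); first by rewrite eqxx.
rewrite expfz_eq0; apply/negP => /andP[_]; rewrite intr_eq0 => /eqP[p0].
by move: (prime_gt0 p_prime); rewrite p0.
Qed.

Lemma Qp_intr_eq0 (a : int) : (a%:~R == 0 :> Qp) = (a == 0).
Proof.
by case: a => n; rewrite ?NegzE ?mulrNz ?oppr_eq0 -pmulrn ((pcharf0P _).1 Qp_char0).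
Qed.

Lemma Qp_abs_coprime n : coprime n p -> abs n%:R = 1.
Proof.
move=> cnp; apply/eqP; rewrite eq_le Qp_abs_nat /= leNgt; apply/negP => n1.
have n0 : (0 < n)%N.
  case: n cnp n1 => // /eqP; rewrite gcd0n => p1.
  by have := p_prime; rewrite p1.
have [u v E _] := egcdnP p n0.
rewrite (eqP (_ : gcdn n p == 1%N)) // in E.
have : abs 1 < 1.
  have -> : 1 = u%:R * n%:R - v%:R * p%:R :> Qp.
    by rewrite -!natrM E natrD addrAC subrr add0r.
  apply: le_lt_trans (Qp_absB _ _) _; rewrite gt_max !(Qp_absM QpP).
  rewrite (le_lt_trans (ler_piMl (Qp_abs_ge0 _) (Qp_abs_nat _)) n1).
  exact: le_lt_trans (ler_piMl (Qp_abs_ge0 _) (Qp_abs_nat _)) Qp_abs_p_lt1.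
by rewrite Qp_abs1 ltxx.
Qed.

Lemma Qp_abs_int_lt1 (a : int) : abs a%:~R < 1 -> exists b : int, a = p%:Z * b.
Proof.
move=> a1; suff /dvdzP[b ->] : (p%:Z %| a)%Z by exists b; rewrite mulrC.
rewrite dvdzE /=; apply: contraLR a1 => pa; rewrite -leNgt.
suff -> : abs a%:~R = abs `|a|%N%:R by rewrite Qp_abs_coprime // coprime_sym prime_coprime.
by case: a {pa} => n //; rewrite NegzE mulrNz Qp_absN abszN.
Qed.

Lemma Qp_abs_denq r : abs (ratr r) <= 1 -> abs (denq r)%:~R = 1.
Proof.
move=> r1; apply/eqP; rewrite eq_le Qp_abs_int leNgt; apply/negP => d1.
have [b dE] := Qp_abs_int_lt1 d1.
have d0 : (denq r)%:~R != 0 :> Qp by rewrite Qp_intr_eq0 denq_eq0.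
have rE : (numq r)%:~R = ratr r * (denq r)%:~R :> Qp by rewrite /ratr mulfVK.
have : abs (numq r)%:~R < 1.
  by rewrite rE (Qp_absM QpP) (le_lt_trans (ler_piMl (Qp_abs_ge0 _) r1)).
move=> /Qp_abs_int_lt1[c nE].
have := coprime_num_den r; rewrite nE dE !abszM !absz_nat coprimeMl.
rewrite coprimeMr /coprime gcdnn; have := prime_gt1 p_prime.
by case: (p) => [|[]].
Qed.

Lemma Qp_denseP x : abs x <= 1 -> forall e, 0 < e -> exists a b : int,
  [/\ abs b%:~R = 1, b != 0 & abs (x - a%:~R / b%:~R) < e].
Proof.
move=> x1 e e0; have me0 : 0 < Num.min 1 e by rewrite lt_min ltr01.
have [r] := Qp_dense QpP x me0; rewrite lt_min => /andP[r1 re].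
exists (numq r), (denq r); split; [|by rewrite denq_eq0|by []].
apply: Qp_abs_denq; have -> : ratr r = x - (x - ratr r) by rewrite subKr.
by rewrite (le_trans (Qp_absB _ _)) // ge_max x1 ltW.
Qed.

(** Discreteness of the values is known on Q only and is carried over by density: a rational a / b
    within 1/p of x, with b a p-adic unit, has its numerator divisible by p. *)
Lemma Qp_lt1_dvd x : abs x < 1 -> abs (x / p%:R) <= 1.
Proof.
move=> x1; have [a [b [b1 b0 ab]]] := Qp_denseP (ltW x1) Qp_abs_p_gt0.
have : abs a%:~R < 1.
  have -> : a%:~R = (x - (x - a%:~R / b%:~R)) * b%:~R :> Qp.
    by rewrite subKr mulfVK // Qp_intr_eq0.
  rewrite (Qp_absM QpP) b1 mulr1 (le_lt_trans (Qp_absB _ _)) // gt_max x1.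
  exact: lt_trans ab Qp_abs_p_lt1.
move=> /Qp_abs_int_lt1[c aE].
rewrite (Qp_absM QpP) Qp_absV ler_pdivrMr ?mul1r ?Qp_abs_p_gt0 //.
rewrite -(subrK (a%:~R / b%:~R) x) (le_trans (Qp_absD QpP _ _)) // ge_max ltW //=.
rewrite !(Qp_absM QpP) Qp_absV b1 invr1 mulr1 aE rmorphM (Qp_absM QpP).
by rewrite ler_piMr ?Qp_abs_ge0 ?Qp_abs_int.
Qed.

Lemma Qp_digit x : abs x <= 1 ->
  exists n : 'I_p, exists2 y, abs y <= 1 & x = n%:R + p%:R * y.
Proof.
move=> x1; have [a [b [b1 b0 ab]]] := Qp_denseP x1 ltr01.
have cbp : coprimez b p.
  rewrite coprimez_sym coprimezE absz_nat prime_coprime //.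
  apply/negP => pb; have /dvdzP[c bE] : (p %| b)%Z by rewrite dvdzE.
  have : abs b%:~R < 1.
    rewrite bE rmorphM (Qp_absM QpP).
    exact: le_lt_trans (ler_piMl (Qp_abs_ge0 _) (Qp_abs_int _)) Qp_abs_p_lt1.
  by rewrite b1 ltxx.
have /coprimezP[[u v] /= uv] := cbp.
(* As u is inverse to b modulo p, z is the residue of a / b. *)
pose z := modz (a * u) p.
have z0 : 0 <= z by rewrite modz_ge0 // eqz_nat gtn_eqF ?prime_gt0.
have zp : (`|z| < p)%N.
  by rewrite -ltz_nat gez0_abs // ltz_pmod // ltz_nat prime_gt0.
exists (Ordinal zp), ((x - `|z|%N%:R) / p%:R); last first.
  by rewrite mulrC mulfVK ?Qp_p_neq0 // addrC subrK.
apply: Qp_lt1_dvd.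
have -> : x - `|z|%N%:R = (x - a%:~R / b%:~R) + (a%:~R - z%:~R * b%:~R) / b%:~R :> Qp.
  rewrite mulrBl mulfK ?Qp_intr_eq0 // addrA subrK.
  by rewrite -{2}(gez0_abs z0).
apply: le_lt_trans (Qp_absD QpP _ _) _; rewrite gt_max ab /=.
rewrite (Qp_absM QpP) Qp_absV b1 invr1 mulr1 -rmorphM -rmorphB /=.
have -> : a - z * b = (a * v + (a * u %/ p)%Z * b) * p.
  have zE : z = a * u - (a * u %/ p)%Z * p.
    by apply/esym/eqP; rewrite subr_eq addrC -divz_eq.
  by rewrite {1}zE -{1}[a]mulr1 -uv; ring.
rewrite rmorphM (Qp_absM QpP).
exact: le_lt_trans (ler_piMl (Qp_abs_ge0 _) (Qp_abs_int _)) Qp_abs_p_lt1.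
Qed.

Lemma Qp_abs_small (e : rat) : 0 < e -> exists N, forall n, (N <= n)%N -> abs p%:R ^+ n < e.
Proof.
move=> e0; have [N eN] : exists N : nat, e^-1 < N%:R.
  exists (Num.truncn e^-1).+1; exact: truncnS_gt.
exists N => n Nn; rewrite Qp_abs_p exprVn -[ltRHS]invrK ltf_pV2 ?posrE.
- apply: lt_le_trans eN _; rewrite -natrX ler_nat (leq_trans Nn) //.
  by rewrite ltnW // ltn_expl // prime_gt1.
- by rewrite exprn_gt0 // ltr0n prime_gt0.
- by rewrite invr_gt0.
Qed.

(** Completeness in the form used below, with divisibility by powers of p in place of estimates. *)
Lemma Qp_series (c : nat -> Qp) : (forall n, abs (c n) <= 1) ->
  exists l, forall n, exists2 d, abs d <= 1 &
    l = \sum_(i < n) p%:R ^+ i * c i + p%:R ^+ n * d.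
Proof.
move=> c1; pose S n := \sum_(i < n) p%:R ^+ i * c i.
have Sn n m : (n <= m)%N -> abs (S m - S n) <= abs p%:R ^+ n.
  move=> /subnK <-; elim: (m - n)%N => [|k IH].
    by rewrite subrr abs0 exprn_ge0 ?Qp_abs_ge0.
  rewrite addSn /S big_ord_recr /= -/(S _) addrAC (le_trans (Qp_absD QpP _ _)) //.
  rewrite ge_max IH (Qp_absM QpP) Qp_absX (le_trans (ler_piMr _ (c1 _))) //.
    by rewrite exprn_ge0 ?Qp_abs_ge0.
  by rewrite exprD ler_piMl ?exprn_ge0 ?exprn_ile1 ?Qp_abs_ge0 ?Qp_abs_nat.
have [l lP] : exists l, forall e : rat, 0 < e -> exists N, forall n,
    (N <= n)%N -> abs (S n - l) < e.
  apply: (Qp_complete QpP) => e /Qp_abs_small[N Np]; exists N => m n Nm Nn.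
  have [mn|/ltnW nm] := leqP m n; last exact: le_lt_trans (Sn _ _ nm) (Np _ Nn).
  by rewrite -Qp_absN opprB (le_lt_trans (Sn _ _ mn)) ?Np.
exists l => n; have p0 : p%:R ^+ n != 0 :> Qp by rewrite expf_neq0 ?Qp_p_neq0.
exists ((l - S n) / p%:R ^+ n); last by rewrite mulrC mulfVK // addrC subrK.
rewrite (Qp_absM QpP) Qp_absV Qp_absX ler_pdivrMr ?mul1r ?exprn_gt0 ?Qp_abs_p_gt0 //.
have [N NP] := lP _ (exprn_gt0 n Qp_abs_p_gt0).
rewrite -(subrK (S (maxn N n)) l) -addrA (le_trans (Qp_absD QpP _ _)) // ge_max.
by rewrite -Qp_absN opprB ltW ?NP ?leq_maxl // Sn // leq_maxr.
Qed.

End PadicField.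

(** Arithmetic core of [eigen_integer], where x = e j with j negative: 2 x + 2 k + e is at most - 2
    e + (e - 1) + e. *)
Lemma eigen_valuation_arith (e m : nat) (k x : int) : (absz k <= m)%N ->
  e = m.*2.+1 -> x <= - e%:Z -> 0 < 2 * x + 2 * k + e%:Z -> False.
Proof. lia. Qed.

(** * Integers and their p-adic completeness *)

Section LocalTameResolvends.

Variables (p : nat) (p_prime : prime p).
Variables (Qp : fieldType) (abs : Qp -> rat) (QpP : is_Qp p abs).
Variables (F : fieldExtType Qp) (Fc : closedFieldType).
Variables (iota : {rmorphism F -> Fc}).
Hypothesis Fc_alg : forall x : Fc, algebraicOver iota x.

Notation O := (integers abs iota).

Definition Qp_emb (c : Qp) : Fc := iota (in_alg F c).

Lemma Qp_emb_zmod : zmod_morphism Qp_emb.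
Proof. by move=> x y; rewrite /Qp_emb !rmorphB. Qed.
Lemma Qp_emb_monoid : monoid_morphism Qp_emb.
Proof. by split=> [|x y]; rewrite /Qp_emb ?rmorph1 ?rmorphM. Qed.

HB.instance Definition _ := GRing.isZmodMorphism.Build Qp Fc Qp_emb Qp_emb_zmod.
HB.instance Definition _ :=
  GRing.isMonoidMorphism.Build Qp Fc Qp_emb Qp_emb_monoid.

Lemma coef_Qp_emb (P : {poly Qp}) i : (map_poly Qp_emb P)`_i = Qp_emb P`_i.
Proof. exact: coef_map. Qed.

Definition Zp_pred : {pred Qp} := fun x => abs x <= 1.

Lemma Zp_subring : subring_closed Zp_pred.
Proof.
split=> [|x y|x y]; rewrite !unfold_in.
- by rewrite (Qp_abs1 QpP).
- by move=> x1 y1; rewrite (le_trans (Qp_absB QpP _ _)) // ge_max x1 y1.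
- by move=> x1 y1; rewrite (Qp_absM QpP) mulr_ile1 ?(Qp_abs_ge0 QpP).
Qed.

HB.instance Definition _ := GRing.isSubringClosed.Build Qp Zp_pred Zp_subring.

(** A ring type for Zp allows integrality to be phrased with [integralOver], whose closure
    properties make [O] a ring. *)
Record Zp := MkZp { Zp_val :> Qp; _ : Zp_val \in Zp_pred }.

HB.instance Definition _ := [isSub for Zp_val].
HB.instance Definition _ := [Choice of Zp by <:].
HB.instance Definition _ := [SubChoice_isSubComNzRing of Zp by <:].

Definition Zp_emb (c : Zp) : Fc := Qp_emb (val c).

Lemma Zp_emb_zmod : zmod_morphism Zp_emb.
Proof. by move=> x y; rewrite /Zp_emb !rmorphB. Qed.
Lemma Zp_emb_monoid : monoid_morphism Zp_emb.
Proof. by split=> [|x y]; rewrite /Zp_emb ?rmorph1 ?rmorphM. Qed.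

HB.instance Definition _ := GRing.isZmodMorphism.Build Zp Fc Zp_emb Zp_emb_zmod.
HB.instance Definition _ :=
  GRing.isMonoidMorphism.Build Zp Fc Zp_emb Zp_emb_monoid.

Lemma lift_poly (P : {poly Qp}) : (forall i, abs P`_i <= 1) ->
  exists Q : {poly Zp}, P = map_poly val Q.
Proof.
move=> P1; exists (\poly_(i < size P) insubd (0 : Zp) P`_i).
apply/polyP => i; rewrite coef_map coef_poly; case: ltnP => [iP|Pi].
  by rewrite [RHS]insubdK //; apply: P1.
by rewrite nth_default.
Qed.

Lemma integersE x : x \in O <-> integralOver Zp_emb x.
Proof.
split=> [/asboolP[P Pm [P1 Px]]|[Q Qm Qx]].
  have [Q PQ] := lift_poly P1; exists Q.
    rewrite monicE; apply/eqP/val_inj; rewrite rmorph1 -(monicP Pm) PQ.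
    by rewrite lead_coef_map_inj //; apply: val_inj.
  by rewrite map_poly_comp -PQ.
apply/asboolP; exists (map_poly val Q).
  by rewrite monicE lead_coef_map_inj ?(monicP Qm) ?rmorph1 //; apply: val_inj.
split=> [i|]; last by rewrite -map_poly_comp.
by rewrite coef_map; case: (Q`_i).
Qed.

Lemma integers_subring : subring_closed O.
Proof.
split=> [|x y /integersE Ox /integersE Oy|x y /integersE Ox /integersE Oy];
  apply/integersE; [exact: integral1 | exact: integral_sub | exact: integral_mul].
Qed.

HB.instance Definition _ := GRing.isSubringClosed.Build Fc O integers_subring.

Lemma root_integer P x : P \is monic -> root P x -> P \is a polyOver O -> x \in O.
Proof.
move=> Pm Px /allP PO; apply/integersE/(integral_root_monic Pm Px) => y yP.
exact/integersE/PO.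
Qed.

Lemma Zp_emb_integer z : Zp_emb z \in O.
Proof. exact/integersE/integral_id. Qed.

(** Zp is integrally closed: if abs x > 1, a monic equation of degree n over Zp would bound (abs
    x)^n by (abs x)^(n-1). *)
Lemma Qp_emb_integer x : (Qp_emb x \in O) = (abs x <= 1).
Proof.
apply/idP/idP => [/asboolP[P Pm [P1]]|x1]; last first.
  by have := @Zp_emb_integer (MkZp (x1 : x \in Zp_pred)).
rewrite fmorph_root => /rootP Px; rewrite leNgt; apply/negP => x1.
have [n sP] : exists n, size P = n.+1.
  by exists (size P).-1; rewrite prednK // size_poly_gt0 monic_neq0.
have xn : abs (x ^+ n) <= abs x ^+ n.-1.
  have -> : x ^+ n = - \sum_(i < n) P`_i * x ^+ i.
    move/monicP: Pm Px; rewrite lead_coefE horner_coef sP /= big_ord_recr /= => ->.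
    by rewrite mul1r addrC => /eqP; rewrite addr_eq0 => /eqP.
  rewrite (Qp_absN QpP); elim/big_ind: _ => [||i _].
  - by rewrite (eqP (_ : abs 0 == 0)) ?(Qp_abs0 QpP) // exprn_ge0 ?(Qp_abs_ge0 QpP).
  - by move=> u v u1 v1; rewrite (le_trans (Qp_absD QpP _ _)) // ge_max u1.
  - rewrite (Qp_absM QpP) (Qp_absX QpP) (le_trans (ler_piMl _ (P1 _))) //.
      by rewrite exprn_ge0 ?(Qp_abs_ge0 QpP).
    by rewrite ler_eXn2l //; case: n i {sP} => [[]//|n i]; rewrite -ltnS.
move: xn Px; case: n sP => [|n] sP; last by rewrite (Qp_absX QpP) ler_eXn2l // ltnn.
move=> _; have /size_poly1P[c c0 PE] : size P == 1%N by rewrite sP.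
by rewrite PE hornerC => c00; rewrite c00 eqxx in c0.
Qed.

Lemma Qp_emb_integral (x : Fc) : integralOver Qp_emb x.
Proof.
have [P Pm Px] := (integral_algebraic iota x).1 (Fc_alg x).
apply: (integral_root_monic (p := map_poly iota P)); rewrite ?map_monic //.
apply/(integral_poly Qp_emb) => i; rewrite coef_map; apply: integral_rmorph.
have [Q QE] := polyOver1P (minPolyOver 1 P`_i).
apply/integral_algebraic; exists Q.
  rewrite -(map_poly_eq0 (in_alg F)) -QE; exact: monic_neq0 (monic_minPoly _ _).
by rewrite -QE root_minPoly.
Qed.

Notation pc := (p%:R : Fc).

Lemma pc_neq0 : pc != 0.
Proof. by rewrite -(rmorph_nat Qp_emb) fmorph_eq0 (Qp_p_neq0 p_prime QpP). Qed.

Lemma Fc_char0 : [pchar Fc] =i pred0.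
Proof. by move=> n; rewrite -(Qp_char0 p_prime QpP n) (fmorph_pchar Qp_emb). Qed.

Lemma pc_inv_notinteger : pc^-1 \notin O.
Proof.
rewrite -(rmorph_nat Qp_emb) -fmorphV Qp_emb_integer (Qp_absV QpP) (Qp_abs_p p_prime QpP).
by rewrite invrK -ltNge ltr1n prime_gt1.
Qed.

Lemma nat_inv_integer n : coprime n p -> (n%:R : Fc)^-1 \in O.
Proof.
move=> np; rewrite -(rmorph_nat Qp_emb) -fmorphV Qp_emb_integer (Qp_absV QpP).
by rewrite (Qp_abs_coprime p_prime QpP) // invr1.
Qed.

Lemma clear_denom_Qp (x : Qp) : exists k, abs (p%:R ^+ k * x) <= 1.
Proof.
have [->|x0] := eqVneq x 0.
  exists 0%N; rewrite mulr0 (eqP (_ : abs 0 == 0)) ?(Qp_abs0 QpP) //.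
have ax : 0 < abs x by rewrite lt_def (Qp_abs_ge0 QpP) (Qp_abs0 QpP) x0.
have [N /(_ N (leqnn N)) NP] := Qp_abs_small p_prime QpP (eq_ind _ is_true ax _ (esym (invr_gt0 _))).
exists N; rewrite (Qp_absM QpP) (Qp_absX QpP) ltW //.
by rewrite -ltr_pdivlMr // mul1r.
Qed.

Lemma clear_denom (x : Fc) : exists k, pc ^+ k * x \in O.
Proof.
have [P Pm Px] := Qp_emb_integral x.
have [k kP] : exists k, forall i, abs (p%:R ^+ k * P`_i) <= 1.
  have /choice[k kP] := fun i => clear_denom_Qp P`_i.
  exists (\max_(i < size P) k i)%N => i.
  have [iP|Pi] := ltnP i (size P); last first.
    by rewrite nth_default // mulr0 (eqP (_ : abs 0 == 0)) ?(Qp_abs0 QpP).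
  rewrite -(subnK (leq_bigmax (Ordinal iP))) exprD -mulrA (Qp_absM QpP) mulr_ile1 ?(Qp_abs_ge0 QpP) //.
  by rewrite (Qp_absX QpP) exprn_ile1 ?(Qp_abs_ge0 QpP) ?(Qp_abs_nat QpP).
set c := p%:R ^+ k in kP; exists k.
have c1 : abs c <= 1 by rewrite (Qp_absX QpP) exprn_ile1 ?(Qp_abs_ge0 QpP) ?(Qp_abs_nat QpP).
pose n := (size P).-1; have sP : size P = n.+1.
  by rewrite prednK // size_poly_gt0 monic_neq0.
(* [Q] is the monic polynomial annihilating c x. *)
pose Q := \poly_(i < n.+1) (P`_i * c ^+ (n - i)).
have Pn : P`_n = 1 by move/monicP: Pm; rewrite lead_coefE.
have Qn : P`_n * c ^+ (n - n) != 0 by rewrite Pn subnn mulr1 oner_eq0.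
apply: (@root_integer (map_poly Qp_emb Q)).
- by rewrite map_monic monicE lead_coef_poly ?Pn ?subnn ?mulr1 ?oner_eq0.
- apply/rootP; rewrite horner_coef size_map_poly (size_poly_eq Qn).
  transitivity (pc ^+ k ^+ n * (map_poly Qp_emb P).[x]); last by rewrite (rootP Px) mulr0.
  rewrite horner_coef size_map_poly sP mulr_sumr; apply: eq_bigr => i _.
  rewrite !coef_Qp_emb coef_poly ltn_ord !(rmorphM, rmorphXn) rmorph_nat.
  have -> : pc ^+ k ^+ n = pc ^+ k ^+ (n - i) * pc ^+ k ^+ i.
    by rewrite -exprD subnK // leq_ord.
  by rewrite exprMn; ring.
- apply/polyOverP => i; rewrite coef_Qp_emb Qp_emb_integer coef_poly.
  case: ltnP => ii; last by rewrite (eqP (_ : abs 0 == 0)) ?(Qp_abs0 QpP).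
  have [->|] := eqVneq i n; first by rewrite Pn subnn mulr1 (Qp_abs1 QpP).
  rewrite ltnS in ii; move=> ni; have : (0 < n - i)%N by rewrite subn_gt0 ltn_neqAle ni.
  case: (n - i)%N => // d _; rewrite exprS mulrA [P`_i * c]mulrC (Qp_absM QpP) mulr_ile1 ?(Qp_abs_ge0 QpP) //.
  by rewrite (Qp_absX QpP) exprn_ile1 ?(Qp_abs_ge0 QpP).
Qed.

(** For nonzero x some p^k x^-1 is integral, and its product with x / p^(k+1) is p^-1, which is
    not. *)
Lemma integers_archimedean x : (forall n, x / pc ^+ n \in O) -> x = 0.
Proof.
move=> xO; apply/eqP/negPn/negP => x0; have [k kO] := clear_denom x^-1.
case/negP: pc_inv_notinteger.
have -> : pc^-1 = (x / pc ^+ k.+1) * (pc ^+ k * x^-1).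
  have P0 : pc ^+ k != 0 by rewrite expf_neq0 ?pc_neq0.
  transitivity (pc^-1 * (x * x^-1) * ((pc ^+ k)^-1 * pc ^+ k)).
    by rewrite divff // mulVf // !mulr1.
  by rewrite exprS invfM; ring.
exact: rpredM.
Qed.

(** * Limits and contractions in Zp[y] *)

Section Monogenic.

Variable y : Fc.

Definition Zp_adjoin : {pred Fc} := fun x =>
  `[< exists f : {poly Zp}, x = (map_poly Zp_emb f).[y] >].

Lemma Zp_adjoin_subring : subring_closed Zp_adjoin.
Proof.
split=> [|_ _ /asboolP[f ->] /asboolP[g ->]|_ _ /asboolP[f ->] /asboolP[g ->]];
  apply/asboolP.
- by exists 1; rewrite rmorph1 hornerC.
- by exists (f - g); rewrite rmorphB hornerD hornerN.
- by exists (f * g); rewrite rmorphM hornerM.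
Qed.

HB.instance Definition _ :=
  GRing.isSubringClosed.Build Fc Zp_adjoin Zp_adjoin_subring.

Notation R := Zp_adjoin.

Lemma Zp_adjoin_gen : y \in R.
Proof. by apply/asboolP; exists 'X; rewrite map_polyX hornerX. Qed.

Lemma Zp_adjoin_base z : Zp_emb z \in R.
Proof. by apply/asboolP; exists z%:P; rewrite map_polyC hornerC. Qed.

Lemma Zp_adjoin_Qp c : abs c <= 1 -> Qp_emb c \in R.
Proof. by move=> c1; apply: (Zp_adjoin_base (MkZp (c1 : c \in Zp_pred))). Qed.

Lemma Zp_adjoin_inv n : coprime n p -> (n%:R)^-1 \in R.
Proof.
move=> np; rewrite -(rmorph_nat Qp_emb) -fmorphV; apply: Zp_adjoin_Qp.
by rewrite (Qp_absV QpP) (Qp_abs_coprime p_prime QpP) // invr1.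
Qed.

Hypothesis yO : y \in O.

Lemma Zp_adjoin_integer x : x \in R -> x \in O.
Proof.
move=> /asboolP[f ->]; apply: rpred_horner => //.
by apply/polyOverP => i; rewrite coef_map; apply: Zp_emb_integer.
Qed.

(** Division by a monic polynomial of y leaves d generators over Zp. They may be dependent:
    generation is enough to carry limits over from Zp. *)
Lemma Zp_adjoin_coord : exists d, forall x, x \in R ->
  exists c : 'I_d -> Zp, x = \sum_i Zp_emb (c i) * y ^+ i.
Proof.
have [P Pm Py] := (integersE y).1 yO; exists (size P) => _ /asboolP[f ->].
pose g := Pdiv.Ring.rmodp f P; exists (fun i => g`_i).
rewrite {1}(Pdiv.RingMonic.rdivp_eq Pm f) rmorphD rmorphM hornerD hornerM.
rewrite (rootP Py) mulr0 add0r -/g (@horner_coef_wide _ (size P)).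
  by apply: eq_bigr => i _; rewrite coef_map.
rewrite (leq_trans (size_poly _ _)) // ltnW // Pdiv.Ring.ltn_rmodpN0 //.
exact: monic_neq0.
Qed.

(** The quotients of the increments by p^n are expanded in powers of y, and each coordinate is
    summed by [Qp_series]. *)
Lemma Zp_adjoin_lim (u : nat -> Fc) : u 0%N \in R ->
  (forall n, (u n.+1 - u n) / pc ^+ n \in R) ->
  exists l, forall n, (l - u n) / pc ^+ n \in R.
Proof.
move=> u0 uR; have [d coord] := Zp_adjoin_coord.
have /choice[c cE] := fun n => coord _ (uR n).
have p0 n : pc ^+ n != 0 by rewrite expf_neq0 ?pc_neq0.
have /choice[l lE] := fun i : 'I_d =>
  Qp_series p_prime QpP (fun n => (valP (c n i) : abs (val (c n i)) <= 1)).
pose L := u 0%N + \sum_i Qp_emb (l i) * y ^+ i; exists L => n.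
have uE : u n = u 0%N + \sum_i Qp_emb (\sum_(k < n) p%:R ^+ k * val (c k i)) * y ^+ i.
  elim: n => [|n IH].
    by rewrite big1 ?addr0 // => i _; rewrite big_ord0 rmorph0 mul0r.
  rewrite -[u n.+1](subrK (u n)) -[u n.+1 - _](divfK (p0 n)) cE {}IH addrCA.
  congr (_ + _); rewrite mulr_suml -big_split; apply: eq_bigr => i _.
  rewrite big_ord_recr /=. rewrite rmorphD rmorphM rmorphXn rmorph_nat.
  by rewrite -[Zp_emb _]/(Qp_emb (val _)); ring.
have /choice[e eE] : forall i, exists e, abs e <= 1 /\
    l i = \sum_(k < n) p%:R ^+ k * val (c k i) + p%:R ^+ n * e.
  by move=> i; have [e] := lE i n; exists e.
have -> : (L - u n) / pc ^+ n = \sum_i Qp_emb (e i) * y ^+ i.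
  apply: (canLR (mulfK (p0 n))); rewrite uE /L opprD addrACA subrr add0r -sumrB.
  rewrite mulr_suml; apply: eq_bigr => i _; rewrite (eE i).2 rmorphD rmorphM rmorphXn rmorph_nat.
  by ring.
by apply: rpred_sum => i _; rewrite rpredM ?rpredX ?Zp_adjoin_gen // Zp_adjoin_Qp // (eE i).1.
Qed.

(** The iterates from 0 converge; the limit is fixed because T l - l is divisible by every power of
    p. *)
Lemma Zp_adjoin_fixpoint (T : Fc -> Fc) : (forall x, x \in R -> T x \in R) ->
  (forall x z, x \in R -> z \in R ->
    exists2 r, r \in R & T x - T z = pc * (x - z) * r) ->
  exists2 x, x \in R & T x = x.
Proof.
move=> TR Tp; have p0 n : pc ^+ n != 0 by rewrite expf_neq0 ?pc_neq0.
pose u n := iter n T 0; have uR n : u n \in R by elim: n => [|n IH]; [exact: rpred0 | exact: TR].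
have u_step n : (u n.+1 - u n) / pc ^+ n \in R.
  elim: n => [|n IH]; first by rewrite expr0 divr1 rpredB.
  have [r rR rE] := Tp _ _ (uR n.+1) (uR n); rewrite -/(u n.+2) in rE.
  suff -> : (u n.+2 - u n.+1) / pc ^+ n.+1 = (u n.+1 - u n) / pc ^+ n * r by exact: rpredM.
  transitivity (pc * pc^-1 * ((u n.+1 - u n) / pc ^+ n * r)).
    by rewrite rE exprS invfM; ring.
  by rewrite mulfV ?pc_neq0 // mul1r.
have [l lP] := Zp_adjoin_lim (uR 0%N) u_step.
have lR : l \in R.
  by rewrite -(subrK (u 0%N) l) rpredD // -[_ - _]divr1 -(expr0 pc).
exists l => //; apply/subr0_eq/integers_archimedean => n; apply: Zp_adjoin_integer.
have [r rR rE] := Tp _ _ lR (uR n).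
have -> : (T l - l) / pc ^+ n =
    pc * ((l - u n) / pc ^+ n) * r + (u n.+1 - u n) / pc ^+ n - (l - u n) / pc ^+ n.
  have -> : T l = T (u n) + pc * (l - u n) * r by rewrite -rE addrC subrK.
  by rewrite -[u n.+1]/(T (u n)); move: (u n) (T (u n)) => v w; ring.
by rewrite rpredB // rpredD // rpredM // rpredM // rpred_nat.
Qed.

Lemma Zp_adjoin_lipschitz (f : {poly Fc}) x z : f \is a polyOver R ->
  x \in R -> z \in R -> exists2 r, r \in R & f.[x] - f.[z] = (x - z) * r.
Proof.
move=> + xR zR; elim/poly_ind: f => [|f c IH] fR.
  by exists 0; rewrite ?rpred0 // !hornerC subrr mulr0.
have [|r rR rE] := IH.
  by apply/polyOverP => i; have /polyOverP/(_ i.+1) := fR; rewrite coefD coefMX coefC addr0.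
exists (r * x + f.[z]).
  rewrite rpredD ?rpredM //; apply: rpred_horner => //.
  by apply/polyOverP => i; have /polyOverP/(_ i.+1) := fR; rewrite coefD coefMX coefC addr0.
rewrite !hornerE; have -> : f.[x] = f.[z] + (x - z) * r by rewrite -rE addrC subrK.
by ring.
Qed.

Lemma Zp_adjoin_unit r : r \in R -> exists2 v, v \in R & v * (1 + pc * r) = 1.
Proof.
move=> rR; have [||v vR vE] := @Zp_adjoin_fixpoint (fun x => 1 - pc * r * x).
- by move=> x xR; rewrite rpredB ?rpred1 // !rpredM // rpred_nat.
- by move=> x z xR zR; exists (- r); rewrite ?rpredN //; ring.
by exists v => //; rewrite mulrDr mulr1 -{1}vE; ring.
Qed.

Lemma Zp_adjoin_root k r : coprime k p -> r \in R ->
  exists2 x, x \in R & (1 + pc * x) ^+ k = 1 + pc * r.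
Proof.
move=> kp rR.
(* [W] collects the terms of degree at least two. The equation becomes k x = r - p W(x), a
   contraction because k is a unit. *)
have [W WR WE] : exists2 W : {poly Fc}, W \is a polyOver R &
    forall x, (1 + pc * x) ^+ k = 1 + k%:R * pc * x + pc ^+ 2 * W.[x].
  elim: {kp} k => [|k [W WR WE]].
    by exists 0 => [|x]; rewrite ?rpred0 // expr0 horner0; ring.
  exists (W + k%:R *: 'X^2 + pc *: ('X * W)).
    by rewrite !rpredD // polyOverZ ?rpred_nat ?polyOverXn // rpredM ?polyOverX.
  move=> x; rewrite exprS WE !(hornerD, hornerZ, hornerXn, hornerM, hornerX).
    by rewrite -[k.+1%:R]natr1; ring.
have k0 : k%:R != 0 :> Fc.
  rewrite ((pcharf0P _).1 Fc_char0); apply: contraTneq kp => ->.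
  by rewrite /coprime gcd0n gtn_eqF // prime_gt1.
have [||x xR xE] := @Zp_adjoin_fixpoint (fun x => (r - pc * W.[x]) / k%:R).
- move=> x xR; rewrite rpredM ?Zp_adjoin_inv // rpredB // rpredM ?rpred_nat //.
  exact: rpred_horner.
- move=> x z xR zR; have [s sR sE] := Zp_adjoin_lipschitz WR xR zR.
  exists (- s / k%:R); first by rewrite rpredM ?Zp_adjoin_inv ?rpredN.
  have -> : W.[x] = W.[z] + (x - z) * s by rewrite -sE addrC subrK.
  by ring.
exists x => //; rewrite WE -[k%:R * _ * _]mulrAC -[k%:R * x]mulrC.
by rewrite -{1}xE divfK //; ring.
Qed.

Lemma Zp_adjoin_idempotent e : e \in R -> (e ^+ 2 - e) / pc \in R ->
  exists2 x, x \in R & e + pc * x = 0 \/ e + pc * x = 1.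
Proof.
move=> eR; set c := _ / _ => cR.
have : e ^+ 2 = e + pc * c by rewrite mulrC divfK ?pc_neq0 // addrC subrK.
move: c cR => c cR cE.
have uR : 1 - 2 * e \in R by rewrite rpredB ?rpred1 // rpredM ?rpred_nat.
(* Idempotence of e + p x amounts to (1 - 2 e) x = c + p x^2. Multiplying by 1 - 2 e, whose square
   is 1 + 4 p c, turns this into a fixed-point equation for a contraction. *)
have [||x xR xE] := @Zp_adjoin_fixpoint
  (fun x => (1 - 2 * e) * (c + pc * x ^+ 2) - 4 * pc * c * x).
- move=> x xR; apply: rpredB; apply: rpredM => //.
    by rewrite rpredD // rpredM ?rpred_nat // rpredX.
  by rewrite !rpredM ?rpred_nat.
- move=> x z xR zR; exists ((1 - 2 * e) * (x + z) - 4 * c); last by ring.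
  by rewrite rpredB // rpredM ?rpred_nat // rpredD.
exists x => //.
have [v _ vE] := @Zp_adjoin_unit (4 * c) (rpredM (rpred_nat _ _) cR).
have u0 : 1 - 2 * e != 0.
  apply: contra_eq_neq vE => e0.
  have -> : 1 + pc * (4 * c) = (1 - 2 * e) ^+ 2 by ring: cE.
  by rewrite e0 expr0n mulr0 eq_sym oner_eq0.
have : (e + pc * x) * (e + pc * x - 1) = 0.
  apply: (mulfI u0); rewrite mulr0.
  have : (1 - 2 * e) ^+ 2 * x = (1 - 2 * e) * (c + pc * x ^+ 2).
    have -> : (1 - 2 * e) ^+ 2 = 1 + 4 * pc * c by ring: cE.
    by rewrite mulrDl mul1r -{1}xE subrK.
  move=> xE'.
  transitivity (pc * ((1 - 2 * e) * (c + pc * x ^+ 2) - (1 - 2 * e) ^+ 2 * x)); last by rewrite xE' subrr mulr0.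
  by ring: cE.
move=> /eqP; rewrite mulf_eq0 subr_eq0 => /orP[]/eqP; by [left|right].
Qed.

End Monogenic.

(** Zp[y] is finite modulo p, so the powers of y are eventually periodic modulo p, and a large
    multiple of the period is an exponent giving an idempotent. *)
Lemma power_idempotent y : y \in O ->
  exists2 m, (0 < m)%N & ((y ^+ m) ^+ 2 - y ^+ m) / pc \in Zp_adjoin y.
Proof.
move=> yO; have [d coord] := Zp_adjoin_coord yO.
have yR k : y ^+ k \in Zp_adjoin y by rewrite rpredX // Zp_adjoin_gen.
have /choice[c cE] := fun k => coord _ (yR k).
have /choice[dg dgE] : forall z : Zp, exists n : 'I_p, exists2 t, abs t <= 1 & val z = n%:R + p%:R * t.
  by move=> z; apply: (Qp_digit p_prime QpP); case: z.
pose D k := [ffun i => dg (c k i)].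
have Deq k l : D k = D l -> (y ^+ k - y ^+ l) / pc \in Zp_adjoin y.
  move=> Dkl; rewrite (cE k) (cE l) -sumrB mulr_suml; apply: rpred_sum => i _.
  have [t t1 kE] := dgE (c k i); have [t' t1' lE] := dgE (c l i).
  have nE : dg (c k i) = dg (c l i) by move/ffunP/(_ i): Dkl; rewrite !ffunE.
  rewrite -mulrBl /Zp_emb kE lE nE -rmorphB opprD addrACA subrr add0r -mulrBr.
  rewrite rmorphM rmorph_nat mulrAC [pc * _]mulrC mulfK ?pc_neq0 // rmorphB.
  by rewrite rpredM ?yR // rpredB // Zp_adjoin_Qp.
have [k [r r0 kr]] : exists k, exists2 r, (0 < r)%N & (y ^+ (k + r) - y ^+ k) / pc \in Zp_adjoin y.
  have /injectivePn[i [j ij Dij]] : ~~ injectiveb (fun i : 'I_(#|{ffun 'I_d -> 'I_p}|.+1) => D i).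
    by apply/negP => /injectiveP/leq_card; rewrite card_ord ltnn.
  wlog lij : i j ij Dij / (i < j)%N.
    by move=> H; move: (ij); rewrite -val_eqE neq_ltn => /orP[l|l]; [apply: H l | apply: H l; rewrite // eq_sym].
  by exists i, (j - i)%N; rewrite ?subn_gt0 // subnKC 1?ltnW //; apply: Deq.
have step n q : (k <= n)%N -> (y ^+ (n + q * r) - y ^+ n) / pc \in Zp_adjoin y.
  move=> kn; elim: q => [|q IH]; first by rewrite mul0n addn0 subrr mul0r rpred0.
  have -> : (y ^+ (n + q.+1 * r) - y ^+ n) / pc =
    (y ^+ (n + q * r) - y ^+ n) / pc + (y ^+ (k + r) - y ^+ k) / pc * y ^+ (n - k + q * r).
    set e := (n - k + q * r)%N.
    have -> : (n + q.+1 * r = k + r + e)%N by rewrite /e; nia.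
    have -> : (n + q * r = k + e)%N by rewrite /e; nia.
    by rewrite !exprD; ring.
  by rewrite rpredD // rpredM.
(* A multiple of the period r beyond the preperiod k. *)
exists (r * k.+1)%N; first by rewrite muln_gt0 r0.
rewrite -exprM mulnC mul2n -addnn {2}mulnC; apply: step.
by apply: leq_trans (leqnSn k) _; rewrite leq_pmull.
Qed.

(** The idempotent lifts to Zp[y], a domain, where it is 0 or 1. Keeping x in Zp[y] keeps later
    constructions inside any subextension containing y. *)
Lemma power_dichotomy y : y \in O -> exists2 m, (0 < m)%N &
  exists2 x, x \in Zp_adjoin y & y ^+ m = pc * x \/ y ^+ m = 1 + pc * x.
Proof.
move=> yO; have [m m0 mR] := power_idempotent yO.
have ymR : y ^+ m \in Zp_adjoin y by rewrite rpredX // Zp_adjoin_gen.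
have [x xR xE] := Zp_adjoin_idempotent yO ymR mR; exists m => //.
exists (- x); first by rewrite rpredN.
rewrite mulrN; case: xE => [/eqP|xE]; last by right; apply/eqP; rewrite eq_sym subr_eq eq_sym; apply/eqP.
by rewrite addr_eq0 => /eqP; left.
Qed.

Lemma one_plus_unit r : r \in O -> (1 + pc * r)^-1 \in O.
Proof.
move=> rO; have [v vR vE] := Zp_adjoin_unit rO (Zp_adjoin_gen r).
have -> : (1 + pc * r)^-1 = v.
  by apply: (mulIf (_ : 1 + pc * r != 0)); rewrite ?vE ?mulVf //;
    apply: contra_eq_neq vE => ->; rewrite mulr0 eq_sym oner_eq0.
exact: Zp_adjoin_integer vR.
Qed.

Lemma one_plus_neq0 r : r \in O -> 1 + pc * r != 0.
Proof.
move=> rO; apply: contraNneq pc_inv_notinteger => r0.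
have -> : pc^-1 = - r; last by rewrite rpredN.
by apply: (mulfI pc_neq0); rewrite mulfV ?pc_neq0 // mulrN; apply/eqP; rewrite -addr_eq0 r0.
Qed.

Lemma integer_nilpotent_or_unit y : y \in O ->
  (exists2 m, (0 < m)%N & y ^+ m / pc \in O) \/ y^-1 \in O.
Proof.
move=> yO; have [m m0 [x /(Zp_adjoin_integer yO) xO [yE|yE]]] := power_dichotomy yO.
  by left; exists m => //; rewrite yE mulrC mulKf ?pc_neq0.
right; case: m m0 yE => // m _ yE.
have u0 := one_plus_neq0 xO; rewrite -yE exprS in u0.
have y0 : y != 0 by apply: contraNneq u0 => ->; rewrite mul0r.
have -> : y^-1 = y ^+ m * (1 + pc * x)^-1.
  by rewrite -yE exprSr invfM mulrA mulfV ?mul1r // expf_neq0.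
by rewrite rpredM ?rpredX ?one_plus_unit.
Qed.

(** By the geometric sum, 1 - t divides 1 - t^m, which is 1 modulo p. *)
Lemma integer_sub_nilpotent t m : t \in O -> t ^+ m / pc \in O -> (1 - t)^-1 \in O.
Proof.
move=> tO; set r := _ / _ => rO.
have tE : t ^+ m = pc * r by rewrite mulrC divfK ?pc_neq0.
have u0 : 1 - t ^+ m != 0 by rewrite tE -mulrN one_plus_neq0 ?rpredN.
have uE : 1 - t ^+ m = (1 - t) * \sum_(i < m) t ^+ i.
  by rewrite -[LHS]opprB subrX1 -mulNr opprB.
have -> : (1 - t)^-1 = (\sum_(i < m) t ^+ i) * (1 - t ^+ m)^-1.
  have := u0; rewrite uE mulf_eq0 => /norP[u1 u2].
  by rewrite invfM mulrCA mulfV // mulr1.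
rewrite rpredM ?rpred_sum // => [i _|]; first exact: rpredX.
by rewrite tE -mulrN one_plus_unit ?rpredN.
Qed.

Lemma root_inv_integer G z : G \is a polyOver O -> root G z ->
  G`_0 != 0 -> (G`_0)^-1 \in O -> z^-1 \in O.
Proof.
move=> /polyOverP GO Gz u0 uO; have G0 : G != 0 by apply: contraNneq u0 => ->; rewrite coef0.
have z0 : z != 0.
  by apply: contraNneq u0 => z0; move: Gz; rewrite z0 /root horner_coef0.
have [n sG] : exists n, size G = n.+1.
  by exists (size G).-1; rewrite prednK // size_poly_gt0.
(* The reversed polynomial over the constant term of [G]: monic, with root z^-1. *)
pose V := \poly_(j < n.+1) (G`_(n - j) / G`_0).
have Vn : G`_(n - n) / G`_0 = 1 by rewrite subnn mulfV.
have Vn0 : G`_(n - n) / G`_0 != 0 by rewrite Vn oner_eq0.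
apply: (@root_integer V).
- by rewrite monicE lead_coef_poly // Vn.
- apply/rootP; rewrite horner_coef (size_poly_eq Vn0).
  transitivity (z ^- n / G`_0 * G.[z]); last by rewrite (rootP Gz) mulr0.
  rewrite horner_coef sG mulr_sumr (reindex_inj rev_ord_inj); apply: eq_bigr => j _.
  rewrite coef_poly ltn_ord /= subSS subKn ?leq_ord //.
  have -> : z ^- n = z^-1 ^+ (n - j) * z^-1 ^+ j by rewrite -exprD subnK ?leq_ord // exprVn.
  have zz : z^-1 ^+ j * z ^+ j = 1 by rewrite -exprMn mulVf // expr1n.
  transitivity (G`_j / G`_0 * z^-1 ^+ (n - j) * (z^-1 ^+ j * z ^+ j)); last by ring.
  by rewrite zz mulr1.
- apply/polyOverP => j; rewrite coef_poly; case: ifP => _; last exact: rpred0.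
  by rewrite rpredM.
Qed.

(** The scaling is by the last coefficient of largest absolute value, so that modulo p the
    polynomial becomes monic of degree i, its Weierstrass degree. *)
Lemma normalized_polynomial x : exists Q : {poly Qp}, exists i, [/\
  forall j, abs Q`_j <= 1, Q`_i = 1, forall j, (i < j)%N -> abs Q`_j < 1
   & root (map_poly Qp_emb Q) x].
Proof.
have [P Pm Px] := Qp_emb_integral x.
have a0 : abs 0 = 0 by apply/eqP; rewrite (Qp_abs0 QpP).
pose good i := `[< forall j, abs P`_j <= abs P`_i >] && (i < size P)%N.
have ub i : good i -> (i <= size P)%N by move=> /andP[_ /ltnW].
have ex : exists i, good i.
  have n0 : (0 < size P)%N by rewrite size_poly_gt0 monic_neq0.
  have [i _ iP] := @arg_maxP _ _ _ (Ordinal n0) xpredT (fun i => abs P`_i) isT.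
  exists i; rewrite /good ltn_ord andbT; apply/asboolP => j.
  have [jP|Pj] := ltnP j (size P); first exact: (iP (Ordinal jP)).
  by rewrite [P`_j]nth_default // a0 (Qp_abs_ge0 QpP).
have [i /andP[/asboolP iP iPs] imax] := ex_maxnP ex ub.
have ai : 0 < abs P`_i.
  have := iP (size P).-1; rewrite -lead_coefE (monicP Pm) (Qp_abs1 QpP).
  exact: lt_le_trans.
have Pi0 : P`_i != 0 by rewrite -(Qp_abs0 QpP) gt_eqF.
exists ((P`_i)^-1 *: P), i; split.
- move=> j; rewrite coefZ (Qp_absM QpP) (Qp_absV QpP) mulrC ler_pdivrMr // mul1r.
  exact: iP.
- by rewrite coefZ mulVf.
- move=> j ij; rewrite coefZ (Qp_absM QpP) (Qp_absV QpP) mulrC ltr_pdivrMr // mul1r.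
  rewrite lt_neqAle iP andbT; apply: contraTneq ij => jE; rewrite -leqNgt imax //.
  apply/andP; split; first by apply/asboolP => k; rewrite jE.
  rewrite ltnNge; apply: contraTN ai => Pj; rewrite -jE.
  by rewrite [P`_j]nth_default // a0 ltxx.
- by rewrite map_polyZ rootZ // fmorph_eq0 invr_eq0.
Qed.

(* A point x with |x - c| >= 1 for an integer c such that Q(c) is a unit has
   1 / (x - c) integral; this replaces Newton polygons by integral closure. *)
Lemma integer_or_inv x : x \in O \/ x^-1 \in O.
Proof.
have [Q [i [Q1 Qi Qlt Qx]]] := normalized_polynomial x.
have [p0 p0'] := (Qp_p_neq0 p_prime QpP, pc_neq0).
have coefO (f : {poly Qp}) : (forall j, abs f`_j <= 1) -> map_poly Qp_emb f \is a polyOver O.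
  by move=> f1; apply/polyOverP => j; rewrite coef_Qp_emb Qp_emb_integer.
have a0 : abs 0 = 0 by apply/eqP; rewrite (Qp_abs0 QpP).
pose T := \poly_(j < i.+1) Q`_j.
have T1 j : abs T`_j <= 1 by rewrite coef_poly; case: ifP; rewrite ?a0.
have Ti : Q`_i != 0 by rewrite Qi oner_eq0.
have Tm : T \is monic by rewrite monicE lead_coef_poly // Qi.
have [E E1 QE] : exists2 E : {poly Qp}, forall j, abs E`_j <= 1 & Q = T + p%:R *: E.
  exists (p%:R^-1 *: (Q - T)); last by rewrite scalerA mulfV // scale1r addrC subrK.
  move=> j; rewrite coefZ mulrC; apply: (Qp_lt1_dvd p_prime QpP).
  rewrite coefB coef_poly; case: ltnP => [_|ij]; last by rewrite subr0 Qlt.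
  by rewrite subrr a0.
(* A root c is integral and satisfies T(c) c = 1. As Q and T agree modulo p, Q(c) c is 1 modulo p
   and Q(c) has an integral inverse. *)
pose W := map_poly Qp_emb T * 'X - 1.
have sW : size W = i.+2.
  rewrite /W size_addl size_mulX ?map_poly_eq0 ?monic_neq0 // size_map_poly size_poly_eq //.
  by rewrite size_polyN size_poly1.
have [c Wc] : exists c, root W c by apply/closed_rootP; rewrite sW.
have cE : (map_poly Qp_emb T).[c] * c = 1.
  by move/rootP: Wc; rewrite /W hornerD hornerMX hornerN hornerC => /subr0_eq.
have cO : c \in O.
  apply: (root_integer _ Wc); last by rewrite rpredB ?rpred1 // rpredM ?polyOverX ?coefO.
  rewrite monicE /W lead_coefDl ?lead_coefMX ?lead_coef_map ?(monicP Tm) ?rmorph1 //.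
  by rewrite size_polyN size_poly1 size_mulX ?map_poly_eq0 ?monic_neq0 // size_map_poly size_poly_eq.
set w := (map_poly Qp_emb E).[c] * c.
have wO : w \in O by rewrite rpredM // rpred_horner // coefO.
have uE : (map_poly Qp_emb Q).[c] * c = 1 + pc * w.
  by rewrite {1}QE rmorphD /= map_polyZ hornerD hornerZ rmorph_nat mulrDl cE -mulrA.
have u0 := one_plus_neq0 wO.
have [xc|xc] := eqVneq x c; first by left; rewrite xc.
have z0 : x - c != 0 by rewrite subr_eq0.
have tO : (x - c)^-1 \in O.
  pose G := map_poly Qp_emb Q \Po ('X + c%:P).
  have G0 : G`_0 = (map_poly Qp_emb Q).[c].
    by rewrite -horner_coef0 horner_comp hornerD hornerX hornerC add0r.
  have Qc0 : (map_poly Qp_emb Q).[c] != 0.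
    by apply: contraNneq u0 => Qc0; rewrite -uE Qc0 mul0r.
  apply: (@root_inv_integer G); rewrite ?G0 //.
  - by rewrite polyOver_comp ?coefO // rpredD ?polyOverX ?polyOverC.
  - by rewrite /root horner_comp hornerD hornerX hornerC subrK.
  - have -> : (map_poly Qp_emb Q).[c]^-1 = c * (1 + pc * w)^-1.
      rewrite -uE invfM mulrCA mulfV ?mulr1 //.
      by apply: contraNneq u0 => c0; rewrite -uE c0 mulr0.
    by rewrite rpredM ?one_plus_unit.
case: (integer_nilpotent_or_unit tO) => [[m m0 tm]|]; last first.
  by rewrite invrK => zO; left; rewrite -(subrK c x) rpredD.
(* Here t is nilpotent modulo p, and x^-1 = t / (1 + c t). *)
right; set t := (x - c)^-1 in tO tm.
have -> : x^-1 = t * (1 - - (c * t))^-1.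
  by rewrite -invfM opprK mulrDr mulr1 mulrCA mulfV ?mulr1 ?subrK.
rewrite rpredM //; apply: (@integer_sub_nilpotent _ m); first by rewrite rpredN rpredM.
by rewrite -mulNr exprMn -mulrA rpredM ?rpredX ?rpredN.
Qed.

(** The maximal ideal of [O]. The encoding records only that x has no integral inverse; integrality
    of x then follows from [integer_or_inv]. *)
Definition mideal : {pred Fc} := fun x => (x == 0) || (x^-1 \notin O).
Notation mm := mideal.

Lemma midealE x : (x \in mm) = (x == 0) || (x^-1 \notin O).
Proof. by []. Qed.

Lemma mideal0 : 0 \in mm. Proof. by rewrite unfold_in eqxx. Qed.

Lemma mideal_integer x : x \in mm -> x \in O.
Proof.
rewrite unfold_in => /orP[/eqP->|xV]; first exact: rpred0.
by case: (integer_or_inv x) => // xO; rewrite xO in xV.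
Qed.

Lemma notin_mideal x : (x \notin mm) = (x != 0) && (x^-1 \in O).
Proof. by rewrite unfold_in negb_or negbK. Qed.

Lemma mideal1 : 1 \notin mm.
Proof. by rewrite notin_mideal oner_eq0 invr1 rpred1. Qed.

Lemma mideal_p : pc \in mm.
Proof. by rewrite unfold_in pc_inv_notinteger orbT. Qed.

Lemma midealM c x : c \in O -> x \in mm -> c * x \in mm.
Proof.
move=> cO; apply: contraLR; rewrite !notin_mideal mulf_eq0 negb_or invfM.
move=> /andP[/andP[c0 x0] cxO]; rewrite x0 -[x^-1]mul1r -(mulfV c0) -mulrA.
exact: rpredM.
Qed.

Lemma midealN x : x \in mm -> - x \in mm.
Proof. by move=> xm; rewrite -mulN1r midealM ?rpredN ?rpred1. Qed.

Lemma midealD x y : x \in mm -> y \in mm -> x + y \in mm.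
Proof.
have [->|y0] := eqVneq y 0; first by rewrite addr0.
have [->|x0] := eqVneq x 0; first by rewrite add0r.
move=> xm ym; case: (integer_or_inv (x / y)) => cO.
  have -> : x + y = (x / y + 1) * y by rewrite mulrDl divfK // mul1r.
  by rewrite midealM // rpredD ?rpred1.
have -> : x + y = ((x / y)^-1 + 1) * x by rewrite invf_div mulrDl divfK // mul1r addrC.
by rewrite midealM // rpredD ?rpred1.
Qed.

Lemma mideal_sum (I : Type) (r : seq I) (P : pred I) E :
  (forall i, P i -> E i \in mm) -> \sum_(i <- r | P i) E i \in mm.
Proof. by move=> Em; elim/big_ind: _ => //; [exact: mideal0 | exact: midealD]. Qed.

Lemma mideal_prime x y : x * y \in mm -> x \in mm \/ y \in mm.
Proof.
move=> xym; apply/orP; apply: contraLR xym; rewrite negb_or !notin_mideal.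
by move=> /andP[/andP[x0 xO] /andP[y0 yO]]; rewrite mulf_neq0 // invfM rpredM.
Qed.

Lemma midealX x n : (0 < n)%N -> (x ^+ n \in mm) = (x \in mm).
Proof.
case: n => // n _; apply/idP/idP => [|xm]; last first.
  by rewrite exprSr midealM // rpredX // mideal_integer.
by elim: n => [|n IH]; rewrite ?expr1 // exprS => /mideal_prime[].
Qed.

Lemma mideal_nilpotent x : x \in mm -> exists2 m, (0 < m)%N & x ^+ m / pc \in O.
Proof.
move=> xm; have [->|x0] := eqVneq x 0.
  by exists 1%N; rewrite // expr1 mul0r rpred0.
case: (integer_nilpotent_or_unit (mideal_integer xm)) => // xO.
by move: xm; rewrite unfold_in (negPf x0) xO.
Qed.

(** The valuation has rank one: some power of x is divisible by p, which reduces the claim to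
    [integers_archimedean]. *)
Lemma mideal_archimedean x y : x \in mm -> x != 0 ->
  (forall n, y / x ^+ n \in O) -> y = 0.
Proof.
move=> xm x0 yO; have [m _ xp] := mideal_nilpotent xm.
apply: integers_archimedean => n.
have -> : y / pc ^+ n = y / x ^+ (m * n) * (x ^+ m / pc) ^+ n.
  by rewrite exprM expr_div_n mulrA divfK // !expf_neq0.
by rewrite rpredM ?rpredX.
Qed.

Lemma nat_notin_mideal n : coprime n p -> n%:R \notin mm.
Proof.
move=> np; rewrite notin_mideal nat_inv_integer // andbT.
rewrite ((pcharf0P _).1 Fc_char0); apply: contraTneq np => ->.
by rewrite /coprime gcd0n gtn_eqF // prime_gt1.
Qed.

(** If xi differs from 1, the sum of its first N powers is 0, yet it is N modulo [mm], and N is a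
    unit. *)
Lemma root_unity_mideal N xi : coprime N p -> xi ^+ N = 1 -> xi - 1 \in mm -> xi = 1.
Proof.
move=> Np xiN xi1; apply/subr0_eq/eqP.
have := subrX1 xi N; rewrite xiN subrr => /esym/eqP; rewrite mulf_eq0 => /orP[//|/eqP s0].
have xiO : xi \in O by rewrite -(subrK 1 xi) rpredD ?rpred1 // mideal_integer.
case/negP: (nat_notin_mideal Np).
have -> : N%:R = \sum_(i < N) (1 - xi ^+ i).
  by rewrite sumrB s0 subr0 sumr_const card_ord.
apply: mideal_sum => i _; rewrite -opprB subrX1 mulrC midealN // midealM //.
by apply: rpred_sum => j _; apply: rpredX.
Qed.

Lemma frobenius_mideal w : w \in O -> (1 + w) ^+ p - 1 - w ^+ p \in mm.
Proof.
move=> wO; rewrite exprDn -(big_mkord xpredT (fun i => 1 ^+ (p - i) * w ^+ i *+ 'C(p, i))).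
rewrite big_nat_recr //= big_ltn ?prime_gt0 // bin0 binn subnn subn0.
rewrite !expr1n !mul1r expr0 !mulr1n.
rewrite [X in X - _](_ : _ = \sum_(1 <= i < p) 1 ^+ (p - i) * w ^+ i *+ 'C(p, i) + w ^+ p).
  rewrite addrK big_nat.
  apply: mideal_sum => i /andP[i0 ip]; rewrite expr1n mul1r.
  have /dvdnP[c ->] := prime_dvd_bin p_prime (introT andP (conj i0 ip)).
  by rewrite mulrnA -[_ *+ p]mulr_natr midealM ?mideal_p // rpredMn // rpredX.
by rewrite -[1 + _ + _]addrA addrAC subrr add0r.
Qed.

(** Frobenius is injective on the residue field. *)
Lemma pth_root_unit x a : x \in O -> x ^+ (p ^ a) - 1 \in mm -> x - 1 \in mm.
Proof.
move=> xO; elim: a => [|a IH]; first by rewrite expn0 expr1.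
rewrite expnSr exprM => xm; apply: IH; set z := x ^+ (p ^ a) in xm *.
have zO : z - 1 \in O by rewrite rpredB ?rpred1 ?rpredX.
rewrite -(midealX _ (prime_gt0 p_prime)).
have := frobenius_mideal zO; rewrite [1 + (z - 1)]addrC subrK => zm.
have -> : (z - 1) ^+ p = (z ^+ p - 1) - (z ^+ p - 1 - (z - 1) ^+ p) by rewrite subKr.
by rewrite midealD // midealN.
Qed.

Lemma one_unit_integer x : x - 1 \in mm -> x \in O.
Proof. by move=> xm; rewrite -(subrK 1 x) rpredD ?rpred1 // mideal_integer. Qed.

Lemma one_unit_notin x : x - 1 \in mm -> x \notin mm.
Proof.
move=> xm; apply: contraNN mideal1 => xm'.
by rewrite -(subKr x 1) midealD // midealN.
Qed.

Lemma one_unitM x y : x - 1 \in mm -> y - 1 \in mm -> x * y - 1 \in mm.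
Proof.
move=> xm ym; have -> : x * y - 1 = x * (y - 1) + (x - 1) by ring.
by rewrite midealD // midealM // one_unit_integer.
Qed.

Lemma one_unitV x : x - 1 \in mm -> x^-1 - 1 \in mm.
Proof.
move=> xm; have := one_unit_notin xm; rewrite notin_mideal => /andP[x0 xO].
have -> : x^-1 - 1 = - x^-1 * (x - 1) by rewrite mulrBr mulNr mulVf // mulr1 opprK addrC.
by rewrite midealM // rpredN.
Qed.

Lemma one_unitX x n : x - 1 \in mm -> x ^+ n - 1 \in mm.
Proof.
move=> xm; elim: n => [|n IH]; first by rewrite expr0 subrr mideal0.
by rewrite exprS one_unitM.
Qed.

(** * One-units and Teichmuller representatives in a subextension *)

Section Subextension.

Variables (L : {pred Fc}) (Lsub : subextension iota L).

Lemma base_subextension c : iota c \in L.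
Proof. by case: Lsub => _; apply; apply/asboolP; exists c. Qed.

Lemma subext_sub x y : x \in L -> y \in L -> x - y \in L.
Proof. by case: Lsub => -[_ LB _] _; apply: LB. Qed.

Lemma subext_div x y : x \in L -> y \in L -> x / y \in L.
Proof. by case: Lsub => -[_ _ LD] _; apply: LD. Qed.

Lemma subext1 : 1 \in L.
Proof. by case: Lsub => -[]. Qed.

Lemma subext_add x y : x \in L -> y \in L -> x + y \in L.
Proof.
move=> xL yL; rewrite -[y]opprK -[- y]sub0r -(subrr 1).
by rewrite !subext_sub ?subext1.
Qed.

Lemma subext_inv x : x \in L -> x^-1 \in L.
Proof. by move=> xL; rewrite -div1r subext_div ?subext1. Qed.

Lemma subext_mul x y : x \in L -> y \in L -> x * y \in L.
Proof. by move=> xL yL; rewrite -[y]invrK subext_div ?subext_inv. Qed.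

Lemma subext_exp x n : x \in L -> x ^+ n \in L.
Proof.
move=> xL; elim: n => [|n IH]; first by rewrite expr0 subext1.
by rewrite exprS subext_mul.
Qed.

Lemma Zp_adjoin_subextension r x : r \in L -> x \in Zp_adjoin r -> x \in L.
Proof.
move=> rL /asboolP[f ->]; elim/poly_ind: f => [|f c IH].
  by rewrite rmorph0 horner0 -(rmorph0 iota) base_subextension.
rewrite rmorphD rmorphM /= map_polyX map_polyC hornerD hornerM hornerX hornerC.
by rewrite subext_add ?subext_mul // base_subextension.
Qed.

(** [Zp_adjoin_root] needs an element that is 1 modulo p, and only a power c^M is known to be one.
    The prime-to-p part of M is removed by [root_unity_mideal], the remaining p^a by a Bezout
    relation with k. *)
Lemma one_unit_root c k : c \in L -> c - 1 \in mm -> coprime k p ->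
  exists g, [/\ g \in L, g ^+ k = c & g - 1 \in mm].
Proof.
move=> cL cm kp; have cO := one_unit_integer cm.
have mp x : x \in O -> pc * x \in mm by move=> xO; rewrite mulrC midealM ?mideal_p.
have [a [x xR xE]] : exists a, exists2 x, x \in Zp_adjoin c & c ^+ (p ^ a) = 1 + pc * x.
  have [M M0 [x xR [xE|xE]]] := power_dichotomy cO.
    have := one_unit_notin (one_unitX M cm).
    by rewrite xE mp ?(Zp_adjoin_integer cO).
  have [a [N Np ME]] : exists a, exists2 N, coprime N p & M = (p ^ a * N)%N.
    have [N pN ME] := pfactor_coprime p_prime M0.
    by exists (logn p M), N; [rewrite coprime_sym | rewrite mulnC].
  exists a; have [z zR zE] := Zp_adjoin_root cO Np xR; exists z => //.
  set g := 1 + _ in zE *.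
  have gm : g - 1 \in mm by rewrite addrC addKr mp ?(Zp_adjoin_integer cO).
  have := one_unit_notin gm; rewrite notin_mideal => /andP[g0 _].
  apply: (divIf g0); rewrite divff //; apply: (root_unity_mideal Np).
    by rewrite expr_div_n zE -xE -exprM -ME divff // xE -zE expf_neq0.
  by rewrite one_unitM ?one_unitV ?one_unitX.
have [z zR zE] := Zp_adjoin_root cO kp xR; set g := 1 + _ in zE.
have gm : g - 1 \in mm by rewrite addrC addKr mp ?(Zp_adjoin_integer cO).
have gL : g \in L.
  by rewrite (Zp_adjoin_subextension cL) // rpredD ?rpred1 // rpredM ?rpred_nat.
have k0 : (0 < k)%N by case: k kp {zE} => //; rewrite /coprime gcd0n gtn_eqF ?prime_gt1.
have pa0 : (0 < p ^ a)%N by rewrite expn_gt0 prime_gt0.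
have [u v uv _] := egcdnP k pa0.
have /eqP cpk : coprime (p ^ a) k by rewrite coprimeXl // coprime_sym.
have c0 : c != 0 by have := one_unit_notin cm; rewrite notin_mideal => /andP[].
(* Here u p^a = v k + 1 and g^k = c^(p^a), so the k-th power is c. *)
exists (g ^+ u / c ^+ v); split.
- by rewrite subext_div ?subext_exp.
- rewrite expr_div_n -exprM mulnC exprM zE -xE -!exprM -[(p ^ a * u)%N]mulnC uv cpk.
  by rewrite exprD expr1 mulrC mulKf ?expf_neq0.
- by rewrite one_unitM ?one_unitV ?one_unitX.
Qed.

(** Some y^M is 1 modulo p. With N the prime-to-p part of M, y^N is a one-unit, and dividing y by an
    N-th root of it that is a one-unit leaves a root of unity with the same residue. *)
Lemma teichmuller y : y \in L -> y \in O -> y \notin mm -> exists tau, exists N,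
  [/\ tau \in L, (0 < N)%N, coprime N p, tau ^+ N = 1 & y - tau \in mm].
Proof.
move=> yL yO ym; have [M M0 [x xR [xE|xE]]] := power_dichotomy yO.
  case/negP: ym; rewrite -(midealX _ M0) xE mulrC midealM ?mideal_p //.
  exact: Zp_adjoin_integer xR.
have [N pN ME] := pfactor_coprime p_prime M0.
have Np : coprime N p by rewrite coprime_sym.
have N0 : (0 < N)%N by move: M0; rewrite ME muln_gt0 => /andP[].
have yN : y ^+ N - 1 \in mm.
  apply: (@pth_root_unit _ (logn p M)); first by rewrite rpredX.
  rewrite -exprM -ME xE addrC addKr mulrC midealM ?mideal_p //.
  exact: Zp_adjoin_integer xR.
have [g [gL gE gm]] := one_unit_root (subext_exp N yL) yN Np.
have := one_unit_notin gm; rewrite notin_mideal => /andP[g0 gV].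
exists (y / g), N; split=> //; first by rewrite subext_div.
  rewrite expr_div_n gE divff // expf_neq0 //.
  by apply: contraNneq ym => ->; apply: mideal0.
have -> : y - y / g = y / g * (g - 1) by rewrite mulrBr divfK // mulr1.
by rewrite midealM // rpredM.
Qed.

End Subextension.

(** * Galois action and uniformizers *)

Notation Om := (GalGroup iota).

Lemma gal_integer (w : Om) x : (w x \in O) = (x \in O).
Proof. exact: Defs.integers_gal. Qed.

Lemma gal_mideal (w : Om) x : (w x \in mm) = (x \in mm).
Proof. by rewrite !midealE -fmorphV gal_integer fmorph_eq0. Qed.

Lemma gal_base x : (forall w : Om, w x = x) -> exists c, x = iota c.
Proof. by move=> wx; apply: (gal_fixed_base Fc_alg Fc_char0 wx). Qed.

Definition fixed_by (P : Om -> Prop) : {pred Fc} :=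
  fun x => `[< forall w, P w -> w x = x >].

Lemma fixed_by_subextension P : subextension iota (fixed_by P).
Proof.
split; first split=> [|x y /asboolP xP /asboolP yP|x y /asboolP xP /asboolP yP].
- by apply/asboolP => w _; rewrite rmorph1.
- by apply/asboolP => w Pw; rewrite rmorphB /= xP // yP.
- by apply/asboolP => w Pw; rewrite fmorph_div /= xP // yP.
by move=> _ /asboolP[c ->]; apply/asboolP => w _; apply: gal_fix.
Qed.

Lemma subextension_moves L x : subextension iota L -> x \notin L ->
  exists2 w : Om, {in L, forall y, w y = y} & w x != x.
Proof.
move=> Lsub; case: (Lsub) => Ldiv _; apply: (gal_moves Fc_alg) => // [|c].
  exact: Fc_char0.
exact: base_subextension.
Qed.

Lemma base_subext : subextension iota (base_field iota).
Proof.
split=> //; split=> [|_ _ /asboolP[c ->] /asboolP[d ->]|_ _ /asboolP[c ->] /asboolP[d ->]].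
- by apply/asboolP; exists 1; rewrite rmorph1.
- by apply/asboolP; exists (c - d); rewrite rmorphB.
- by apply/asboolP; exists (c / d); rewrite fmorph_div.
Qed.

Lemma uniformizerP L Z : subextension iota L -> is_uniformizer abs iota L Z ->
  [/\ Z \in L, Z != 0, Z \in mm & forall x, x \in L -> x \in mm -> x / Z \in O].
Proof.
move=> Lsub [ZL Z0 ZP]; split=> // [|x xL xm].
  rewrite midealE (negPf Z0) /=; apply/negP => ZV.
  have /(ZP Z).2 : exists2 y, y \in integers_of abs iota L & Z = Z * y.
    exists 1; rewrite ?mulr1 // inE; apply/andP; split; last exact: rpred1.
    by case: Lsub => -[].
  move=> /andP[ZO]; rewrite inE Z0 ZO /= inE ZV andbT.
  by rewrite subext_inv.
have /(ZP x).1[y] : (x \in integers_of abs iota L) && (x \notin unit_of abs iota L).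
  rewrite !inE xL mideal_integer //= negb_and negbK.
  by move: xm; rewrite midealE => /orP[->//|/negPf->]; rewrite !andbF orbT.
by rewrite inE => /andP[_ yO] ->; rewrite mulrC mulKf.
Qed.

Lemma uniformizer_intro L Z : subextension iota L -> Z \in L -> Z != 0 -> Z \in mm ->
  (forall x, x \in L -> x \in mm -> x / Z \in O) -> is_uniformizer abs iota L Z.
Proof.
move=> Lsub ZL Z0 Zm ZP; split=> // x; split=> [/andP[]|[y]].
  rewrite !inE => /andP[xL xO] xu; exists (x / Z); last by rewrite mulrC divfK.
  rewrite inE ZP ?andbT //; first by case: Lsub => -[_ _ LD] _; apply: LD.
  move: xu; rewrite xL xO /= midealE; case: eqP => //= _.
  by rewrite (subext_inv Lsub xL).
rewrite inE => /andP[yL yO] ->; have xm : Z * y \in mm by rewrite mulrC midealM.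
rewrite !inE mideal_integer // andbT; apply/andP; split.
  exact: (subext_mul Lsub ZL yL).
move: xm; rewrite midealE => /orP[->//|/negPf->].
by rewrite !andbF.
Qed.

Lemma sum_root_unity N (xi : Fc) : xi ^+ N = 1 ->
  \sum_(i < N) xi ^+ i = (xi == 1)%:R * N%:R.
Proof.
move=> xiN; case: eqP => [->|/eqP xi1].
  by rewrite (eq_bigr (fun=> 1)) ?sumr_const ?card_ord ?mul1r // => i _; rewrite expr1n.
have := subrX1 xi N; rewrite xiN subrr mul0r => /esym/eqP.
by rewrite mulf_eq0 subr_eq0 (negPf xi1) => /eqP.
Qed.

Lemma finite_quotient (X : seq Fc) : (forall (w : Om) x, x \in X -> w x \in X) ->
  exists (gT : finGroupType) (phi : Om -> gT),
    {morph phi : v w / (v * w)%g} /\ forall w, phi w = 1%g <-> {in X, forall x, w x = x}.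
Proof.
move=> stable.
pose act (w : Om) (x : seq_sub X) : seq_sub X := SeqSub (stable w _ (ssvalP x)).
have act_inj w : injective (act w).
  by move=> x y [/gal_inj xy]; apply: val_inj.
(* Permutations compose in the opposite order to automorphisms, hence the inverse. *)
exists {perm (seq_sub X)}, (fun w => (perm (@act_inj w))^-1%g); split.
  move=> v w; rewrite -invMg; congr (_^-1)%g; apply/permP => x.
  by rewrite permM !permE; apply: val_inj.
move=> w; split=> [/eqP|wX].
  rewrite invg_eq1 => /eqP w1 x xX; have /permP/(_ (SeqSub xX)) := w1.
  by rewrite permE perm1 => /(congr1 val).
apply/eqP; rewrite invg_eq1; apply/eqP/permP => x; rewrite permE perm1.
by apply: val_inj; rewrite /= wX // ssvalP.
Qed.

(** * Traces through finite quotients of the Galois group *)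

Section Traces.

Variables (gT : finGroupType) (phi : Om -> gT).
Hypothesis phiM : {morph phi : v w / (v * w)%g}.
Variable U : Om -> Prop.
Hypotheses (U1 : U 1%g) (UM : forall v w, U v -> U w -> U (v * w)%g)
  (UV : forall v, U v -> U v^-1%g).

Lemma quotient1 : phi 1%g = 1%g.
Proof. by apply: (mulgI (phi 1%g)); rewrite -phiM !mulg1. Qed.

Lemma quotientV w : phi w^-1%g = (phi w)^-1%g.
Proof. by apply: (mulgI (phi w)); rewrite -phiM !mulgV quotient1. Qed.

Definition quotient_img : {set gT} := [set t | `[< exists2 w, U w & phi w = t >]].

Definition quotient_rep (t : gT) : Om := xget 1%g [set w | U w /\ phi w = t]%classic.

(** On the field fixed by ker phi the chosen lifts do not matter, and this is the trace down to the
    elements fixed by U. *)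
Definition partial_trace (x : Fc) : Fc := \sum_(t in quotient_img) quotient_rep t x.

Definition quotient_fixed : {pred Fc} := fixed_by (fun w => phi w = 1%g).

Lemma quotient_imgP t : t \in quotient_img <-> exists2 w, U w & phi w = t.
Proof. by rewrite inE; split=> /asboolP. Qed.

Lemma quotient_mem w : U w -> phi w \in quotient_img.
Proof. by move=> Uw; apply/quotient_imgP; exists w. Qed.

Lemma quotient_repP t : t \in quotient_img -> U (quotient_rep t) /\ phi (quotient_rep t) = t.
Proof.
move=> /quotient_imgP[w Uw wt].
exact: (@xgetPex _ 1%g [set w | U w /\ phi w = t]%classic (ex_intro _ w (conj Uw wt))).
Qed.

Lemma quotient_act x v w : x \in quotient_fixed -> phi v = phi w -> v x = w x.
Proof.
move=> /asboolP xfix vw; apply: (@gal_inj _ _ _ v^-1%g).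
have -> : v^-1%g (v x) = x by apply: gal_Kinv.
by rewrite -[v^-1%g _]/((v^-1 * w)%g x) xfix // phiM quotientV vw mulVg.
Qed.

Lemma quotient_img_mulr w t : U w -> (phi w * t \in quotient_img)%g = (t \in quotient_img).
Proof.
move=> Uw; apply/idP/idP => /quotient_imgP[v Uv vt]; apply/quotient_imgP.
  by exists (w^-1 * v)%g; [apply/UM/Uv/UV | rewrite phiM quotientV vt mulKg].
by exists (w * v)%g; [exact: UM | rewrite phiM vt].
Qed.

Lemma gal_partial_trace w x : U w -> x \in quotient_fixed ->
  w (partial_trace x) = partial_trace x.
Proof.
move=> Uw xfix; rewrite rmorph_sum [RHS](reindex_inj (mulgI (phi w))) /=.
apply: eq_big => [t|t tU]; first by rewrite quotient_img_mulr.
rewrite -[w _]/((w * quotient_rep t)%g x); apply: quotient_act => //.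
have [Ut tE] := quotient_repP tU; have wtU := tU; rewrite -(quotient_img_mulr _ Uw) in wtU.
by have [_ ->] := quotient_repP wtU; rewrite phiM tE.
Qed.

Lemma partial_trace_integer x : x \in O -> partial_trace x \in O.
Proof. by move=> xO; apply: rpred_sum => t _; rewrite gal_integer. Qed.

Lemma partial_trace_mideal x : x \in mm -> partial_trace x \in mm.
Proof. by move=> xm; apply: mideal_sum => t _; rewrite gal_mideal. Qed.

End Traces.

Section Tower.

Variables (gT gT' : finGroupType) (phi : Om -> gT) (psi : Om -> gT').
Hypotheses (phiM : {morph phi : v w / (v * w)%g}) (psiM : {morph psi : v w / (v * w)%g}).
Hypothesis phi_psi : forall w, phi w = 1%g -> psi w = 1%g.

Let U := fun w => psi w = 1%g.
Let T := fun _ : Om => True.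

Lemma kernelP : [/\ U 1%g, (forall v w, U v -> U w -> U (v * w)%g)
  & forall v, U v -> U v^-1%g].
Proof.
split; first exact: quotient1.
  by move=> v w Uv Uw; rewrite /U psiM Uv Uw mulg1.
by move=> v Uv; rewrite /U quotientV // Uv invg1.
Qed.

Lemma quotient_ker v w : phi v = phi w -> psi v = psi w.
Proof.
move=> vw; apply/eqP; rewrite eq_mulgV1 -quotientV // -psiM; apply/eqP/phi_psi.
by rewrite phiM quotientV // vw mulgV.
Qed.

(** Transitivity of the trace: the fibres of the map from the image of phi to that of psi are the
    cosets of the image of ker psi. *)
Lemma partial_trace_tower x : x \in quotient_fixed phi ->
  partial_trace psi T (partial_trace phi U x) = partial_trace phi T x.
Proof.
move=> xfix; have [U1 UM UV] := kernelP.
rewrite {3}/partial_trace (partition_big (fun m => psi (quotient_rep phi T m))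
  (mem (quotient_img psi T))) /=; last by move=> m _; apply: quotient_mem.
apply: eq_bigr => t tT; set v := quotient_rep psi T t.
have vt : psi v = t by have [] := quotient_repP tT.
rewrite rmorph_sum [RHS](reindex_inj (mulgI (phi v))) /=.
have repE k : k \in quotient_img phi U -> psi (quotient_rep phi T (phi v * k)%g) = t.
  move=> /quotient_imgP[w Uw <-]; rewrite -phiM.
  have [_ E] := quotient_repP (quotient_mem phi (I : T (v * w)%g)).
  by rewrite (quotient_ker E) psiM Uw mulg1.
apply: eq_big => [k|k kU].
  apply/idP/andP => [kU|[/quotient_imgP[w _ wE] /eqP kt]].
    split; last exact/eqP/repE.
    have /quotient_imgP[w Uw <-] := kU.
    by apply/quotient_imgP; exists (v * w)%g; rewrite ?phiM.
  apply/quotient_imgP; exists (v^-1 * w)%g; last by rewrite phiM quotientV // wE mulKg.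
  have [_ E] := quotient_repP (quotient_mem phi (I : T w)).
  rewrite wE in E; rewrite /U psiM quotientV // vt -kt -wE.
  by rewrite (quotient_ker (etrans (congr1 phi (congr1 _ wE)) (etrans E (esym wE)))) mulVg.
rewrite -[v _]/((v * quotient_rep phi U k)%g x); apply: (quotient_act phiM xfix).
have [_ kE] := quotient_repP kU; rewrite phiM kE.
have /quotient_imgP[w Uw wk] := kU.
have vkT : (phi v * k)%g \in quotient_img phi T by rewrite -wk -phiM; apply: quotient_mem.
by have [_ ->] := quotient_repP vkT.
Qed.

End Tower.

Variable pi : F.
Hypothesis pi_uniformizer : is_uniformizer abs iota (base_field iota) (iota pi).
Variable zeta : nat -> Fc.
Hypothesis zeta_prim : forall n, (0 < n)%N -> n.-primitive_root (zeta n).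

Notation piF := (iota pi).

Lemma piF_neq0 : piF != 0.
Proof. by case: (uniformizerP base_subext pi_uniformizer). Qed.

Lemma piF_mideal : piF \in mm.
Proof. by case: (uniformizerP base_subext pi_uniformizer). Qed.

Lemma fixed_mideal_div x : (forall w : Om, w x = x) -> x \in mm -> x / piF \in O.
Proof.
move=> /gal_base[c ->]; case: (uniformizerP base_subext pi_uniformizer) => _ _ _; apply.
by apply/asboolP; exists c.
Qed.

Definition integral_unit : {pred Fc} := fun x => (x \in O) && (x \notin mm).
Notation OU := integral_unit.

Lemma in_integral_unit x : (x \in OU) = (x \in O) && (x \notin mm).
Proof. by []. Qed.

Lemma integral_unitE x : (x \in OU) = [&& x != 0, x \in O & x^-1 \in O].
Proof. by rewrite in_integral_unit notin_mideal andbCA. Qed.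

Lemma integral_unitM x y : x \in OU -> y \in OU -> x * y \in OU.
Proof.
rewrite !integral_unitE => /and3P[x0 xO xV] /and3P[y0 yO yV].
by rewrite mulf_neq0 // invfM !rpredM.
Qed.

Lemma integral_unitV x : (x^-1 \in OU) = (x \in OU).
Proof. by rewrite !integral_unitE invr_eq0 invrK [(_^-1 \in O) && _]andbC. Qed.

Lemma integral_unit1 : 1 \in OU.
Proof. by rewrite integral_unitE oner_eq0 invr1 rpred1. Qed.

Lemma integral_unitX x n : x \in OU -> x ^+ n \in OU.
Proof.
move=> xU; elim: n => [|n IH]; first by rewrite expr0 integral_unit1.
by rewrite exprS integral_unitM.
Qed.

Lemma integral_unitXz x (n : int) : x \in OU -> x ^ n \in OU.
Proof.
by move=> xU; case: n => n; rewrite ?NegzE -?exprnN ?integral_unitV ?integral_unitX.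
Qed.

Lemma integer_root x k : (0 < k)%N -> x ^+ k \in O -> x \in O.
Proof.
case: k => // k _ xO; case: (integer_or_inv x) => // xV.
have [->|x0] := eqVneq x 0; first exact: rpred0.
have -> : x = x ^+ k.+1 * x^-1 ^+ k by rewrite exprS exprVn mulfK ?expf_neq0.
by rewrite rpredM // rpredX.
Qed.

Lemma integral_unit_root x n : (0 < n)%N -> x ^+ n \in OU -> x \in OU.
Proof.
move=> n0; rewrite !integral_unitE expf_eq0 n0 => /and3P[-> xO xV].
by rewrite (integer_root n0 xO) (integer_root n0) // exprVn.
Qed.

(** A spanning family of least size is a basis, since a nontrivial relation would express one member
    by the others. *)
Lemma span_basis (K : {pred Fc}) n (b : 'I_n -> Fc) : (forall j, b j \in K) ->
  (forall x, x \in K -> exists c : 'I_n -> F, x = \sum_j iota (c j) * b j) ->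
  exists n (b : 'I_n -> Fc), is_basis iota K b.
Proof.
move=> bK bspan.
pose spans m := `[< exists2 b : 'I_m -> Fc, forall j, b j \in K &
  forall x, x \in K -> exists c : 'I_m -> F, x = \sum_j iota (c j) * b j >].
have ex : exists m, spans m by exists n; apply/asboolP; exists b.
have [m /asboolP[e eK espan] mmin] := ex_minnP ex.
exists m, e; split=> // x /espan[c xE].
exists (\row_j c j); split; first by rewrite xE; apply: eq_bigr => j _; rewrite mxE.
move=> d xd; apply/rowP => k; apply/eqP/negPn/negP => ck.
case: m e eK espan mmin c xE d xd k ck => [|m] e eK espan mmin c xE d xd k ck.
  by case: k ck.
suff /mmin : spans m by rewrite ltnn.
apply/asboolP; exists (e \o lift k) => [j|y /espan[f yE]]; first exact: eK.
pose g j := c j - d 0 j.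
have gk : g k != 0 by rewrite subr_eq0; move: ck; rewrite mxE.
have g0 : \sum_j iota (g j) * e j = 0.
  rewrite (eq_bigr (fun j => iota (c j) * e j - iota (d 0 j) * e j)); last first.
    by move=> j _; rewrite rmorphB mulrBl.
  by rewrite sumrB -xE -xd subrr.
exists (fun j => f (lift k j) - f k / g k * g (lift k j)).
have -> : y = \sum_j iota (f j - f k / g k * g j) * e j.
  transitivity (\sum_j iota (f j) * e j - iota (f k / g k) * \sum_j iota (g j) * e j).
    by rewrite g0 mulr0 subr0.
  rewrite mulr_sumr -sumrB.
  by apply: eq_bigr => j _; rewrite (rmorphB _ (f j)) (rmorphM _ (f k / g k)); ring.
by rewrite (bigD1_ord k) //= divfK // subrr rmorph0 mul0r add0r.
Qed.

(** * The cyclotomic fields F(zeta_N) *)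

Definition cyclo_field N : {pred Fc} := fixed_by (fun w => w (zeta N) = zeta N).

Lemma zeta_neq0 N : (0 < N)%N -> zeta N != 0.
Proof.
move=> N0; apply/eqP => z0; have := prim_expr_order (zeta_prim N0).
by rewrite z0 expr0n gtn_eqF // => /eqP; rewrite eq_sym oner_eq0.
Qed.

Lemma root_unity_integer N x : (0 < N)%N -> x ^+ N = 1 -> x \in OU.
Proof.
by move=> N0 xN; apply: (integral_unit_root N0); rewrite xN integral_unit1.
Qed.

Lemma zeta_unit N : (0 < N)%N -> zeta N \in OU.
Proof.
by move=> N0; apply: (root_unity_integer N0); apply/prim_expr_order/zeta_prim.
Qed.

Lemma gal_zeta (w : Om) N : (0 < N)%N -> exists k, w (zeta N) = zeta N ^+ k.
Proof.
move=> N0; have [|k ->] := prim_rootP (zeta_prim N0) (_ : w (zeta N) ^+ N = 1).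
  by rewrite -rmorphXn /= prim_expr_order ?rmorph1 ?zeta_prim.
by exists k.
Qed.

(** [tr] is the trace to F. Summing over i first, the powers of t(zeta_N) / zeta_N cancel for each
    conjugation t that moves zeta_N. When N is prime to p this writes x as an integral combination
    of traces. *)
Lemma cyclo_dual N : (0 < N)%N -> exists tr : Fc -> Fc,
  [/\ forall x, x \in cyclo_field N -> forall w : Om, w (tr x) = tr x,
      forall x, x \in mm -> tr x \in mm
    & forall x, x \in cyclo_field N ->
        \sum_(i < N) zeta N ^- i * tr (zeta N ^+ i * x) = N%:R * x].
Proof.
move=> N0; set z := zeta N; have z0 : z != 0 := zeta_neq0 N0.
pose X := [seq z ^+ i | i <- seq.iota 0 N].
have XP x : reflect (exists2 i, (i < N)%N & x = z ^+ i) (x \in X).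
  apply: (iffP mapP) => -[i]; first by rewrite mem_iota => /andP[_ iN] ->; exists i.
  by move=> iN ->; exists i; rewrite // mem_iota.
have [w x /XP[i _ ->]|gT [phi [phiM phi1]]] := finite_quotient (X := X).
  have [k wk] := gal_zeta w N0; apply/XP; exists ((k * i) %% N)%N.
    by rewrite ltn_mod.
  by rewrite rmorphXn /= wk -exprM (prim_expr_mod (zeta_prim N0)).
have fixE (w : Om) : phi w = 1%g <-> w z = z.
  rewrite phi1; split=> [wX|wz x /XP[i _ ->]]; last by rewrite rmorphXn /= wz.
  have [N1|N1] := leqP N 1; last by apply: wX; apply/XP; exists 1%N; rewrite ?expr1.
  have -> : z = 1; last exact: rmorph1.
  have NE : N = 1%N by apply/eqP; rewrite eqn_leq N1 N0.
  by rewrite -[LHS]expr1 -NE; apply/prim_expr_order/zeta_prim.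
have qfix x : x \in cyclo_field N -> x \in quotient_fixed phi.
  by move=> /asboolP xfix; apply/asboolP => w /fixE; apply: xfix.
pose T := fun _ : Om => True.
have zfix i : z ^+ i \in cyclo_field N by apply/asboolP => w wz; rewrite rmorphXn /= wz.
exists (partial_trace phi T); split.
- by move=> x /qfix xfix w; apply: gal_partial_trace.
- by move=> x; apply: partial_trace_mideal.
move=> x xM; have xfix := qfix _ xM.
have termE i : z ^- i * partial_trace phi T (z ^+ i * x) =
    \sum_(t in quotient_img phi T) (quotient_rep phi T t z / z) ^+ i * quotient_rep phi T t x.
  rewrite mulr_sumr; apply: eq_bigr => t _.
  by rewrite rmorphM rmorphXn /= expr_div_n; ring.
under eq_bigr do rewrite termE.
rewrite exchange_big /=.
have t1 : 1%g \in quotient_img phi T.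
  by rewrite -(quotient1 phiM); apply: quotient_mem.
rewrite (bigD1 1%g) //= [X in _ + X]big1 => [|t /andP[tT t1']].
  rewrite addr0; have [_ rep1] := quotient_repP t1; move/fixE: (rep1) => rz.
  have -> : quotient_rep phi T 1%g x = x by move/asboolP: xfix; apply.
  by rewrite rz divff // (eq_bigr (fun=> x)) ?sumr_const ?card_ord ?mulr_natl // => i _; rewrite expr1n mul1r.
rewrite -mulr_suml sum_root_unity; last first.
  rewrite expr_div_n -rmorphXn /= (prim_expr_order (zeta_prim N0)) rmorph1 divr1 //.
have [_ tE] := quotient_repP tT; case: eqP => [E|]; last by rewrite !mul0r.
case/eqP: t1'; rewrite -tE; apply/fixE.
by rewrite -[LHS](divfK z0) E mul1r.
Qed.

(** In the expansion of [cyclo_dual] the traces lie in F and in [mm], hence are divisible by pi: pi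
    remains a uniformizer. *)
Lemma cyclo_field_mideal_div N x : (0 < N)%N -> coprime N p ->
  x \in cyclo_field N -> x \in mm -> x / piF \in O.
Proof.
move=> N0 Np xM xm; have [tr [trfix trm trE]] := cyclo_dual N0.
have [[_ MB MD] _] := fixed_by_subextension (fun w : Om => w (zeta N) = zeta N).
have zM i : zeta N ^+ i * x \in cyclo_field N.
  by move/asboolP: xM => xM; apply/asboolP => w wz; rewrite rmorphM rmorphXn /= wz xM.
have -> : x / piF = N%:R^-1 * (\sum_(i < N) zeta N ^- i * (tr (zeta N ^+ i * x) / piF)).
  have NN : N%:R != 0 :> Fc by have := nat_notin_mideal Np; rewrite notin_mideal => /andP[].
  rewrite -[x in LHS](mulKf NN) -trE // -!mulrA; congr (_ * _).
  by rewrite mulr_suml; apply: eq_bigr => i _; rewrite mulrA.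
have := zeta_unit N0; rewrite integral_unitE => /and3P[_ zO zV].
rewrite rpredM ?nat_inv_integer //; apply: rpred_sum => i _.
rewrite -exprVn rpredM ?rpredX //; apply: fixed_mideal_div; first exact: trfix.
by apply: trm; rewrite midealM ?rpredX.
Qed.

(** The exponent j plays the role of the valuation. For integral x it is the largest power of pi
    dividing x, which exists by [mideal_archimedean]. *)
Lemma fixed_val (M : {pred Fc}) x : subextension iota M ->
  (forall x, x \in M -> x \in mm -> x / piF \in O) ->
  x \in M -> x != 0 -> exists j : int, x / piF ^ j \in OU.
Proof.
move=> Msub MP.
have pM n : piF ^+ n \in M by rewrite -rmorphXn; apply: base_subextension.
have [[_ _ MD] _] := Msub.
have main y : y \in M -> y != 0 -> y \in O -> exists j : nat, y / piF ^+ j \in OU.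
  move=> yM y0 yO.
  have [n nO] : exists n, y / piF ^+ n \notin O.
    apply: contrapT => /forallNP H; case/eqP: y0.
    apply: (mideal_archimedean piF_mideal piF_neq0) => n.
    by have /negP/negPn := H n.
  have [m mO mmin] := ex_minnP (ex_intro (fun n => y / piF ^+ n \notin O) n nO).
  case: m mO mmin => [|m] mO mmin; first by rewrite expr0 divr1 yO in mO.
  have yO' : y / piF ^+ m \in O by apply: contraT => /mmin; rewrite ltnn.
  exists m; rewrite in_integral_unit yO' /=; apply: contra mO => ym.
  by rewrite exprSr invfM mulrA; apply: MP => //; apply: MD.
move=> xM x0; case: (integer_or_inv x) => xO.
  by have [j jU] := main _ xM x0 xO; exists j.
have [|j jU] := main _ (subext_inv Msub xM) _ xO; first by rewrite invr_eq0.
exists (- j%:Z); suff -> : x / piF ^ (- j%:Z) = (x^-1 / piF ^+ j)^-1.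
  by rewrite integral_unitV.
by rewrite -exprnN invfM !invrK.
Qed.

Lemma cyclo_unramified N : (0 < N)%N -> coprime N p ->
  unramified abs iota (cyclo_field N).
Proof.
move=> N0 Np; have Msub := fixed_by_subextension (fun w : Om => w (zeta N) = zeta N).
have [tr [trfix _ trE]] := cyclo_dual N0.
have zM i : zeta N ^+ i \in cyclo_field N.
  by apply/asboolP => w wz; rewrite rmorphXn /= wz.
have NN : N%:R != 0 :> Fc by have := nat_notin_mideal Np; rewrite notin_mideal => /andP[].
split; last first.
  exists piF, piF; split=> //; last first.
    rewrite expr1 divff ?piF_neq0 // !inE oner_eq0 invr1 rpred1 !andbT /=.
    by rewrite andbb; case: Msub => -[].
  apply: (uniformizer_intro Msub (base_subextension Msub _) piF_neq0 piF_mideal) => x.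
  exact: cyclo_field_mideal_div.
split=> //; apply: (span_basis (b := fun i : 'I_N => zeta N ^- i / N%:R)).
  move=> i; apply/asboolP => w wz.
  by rewrite fmorph_div fmorphV rmorphXn /= wz rmorph_nat.
move=> x xM.
have /choice[c cE] : forall i : 'I_N, exists c, tr (zeta N ^+ i * x) = iota c.
  move=> i; apply/gal_base/trfix; move/asboolP: xM => xM.
  by apply/asboolP => w wz; rewrite rmorphM rmorphXn /= wz xM.
exists c; rewrite -[LHS](mulKf NN) -trE // mulr_sumr; apply: eq_bigr => i _.
by rewrite -cE; ring.
Qed.

Lemma zeta_Fnr N : (0 < N)%N -> coprime N p -> zeta N \in Fnr abs iota.
Proof.
move=> N0 Np; apply/asboolP => K _ /(_ _ (cyclo_unramified N0 Np)); apply.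
exact/asboolP.
Qed.

Lemma Fnr_Ft x : x \in Fnr abs iota -> x \in Ft abs iota p.
Proof.
move=> /asboolP xF; apply/asboolP => K Ksub KL; apply: xF => // L [Lfin Lram].
by apply: KL; split=> //; exists 1%N; rewrite ?coprime1n.
Qed.

(** * Tame extensions *)

Hypothesis zeta_compat : forall m n, (0 < m)%N -> (0 < n)%N ->
  zeta (m * n)%N ^+ m = zeta n.
Variable rad : nat -> Fc.
Hypothesis rad_pow : forall n, (0 < n)%N -> coprime n p -> rad n ^+ n = piF.
Hypothesis rad_compat : forall m n, (0 < m)%N -> (0 < n)%N -> coprime (m * n) p ->
  rad (m * n)%N ^+ m = rad n.

Notation FtF := (Ft abs iota p).

Lemma rad_neq0 n : (0 < n)%N -> coprime n p -> rad n != 0.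
Proof.
move=> n0 np; apply: contraTneq piF_neq0 => r0.
by rewrite -(rad_pow n0 np) r0 expr0n gtn_eqF // eqxx.
Qed.

Lemma root_unity_zeta N (xi : Fc) : (0 < N)%N -> xi ^+ N = 1 -> exists i, xi = zeta N ^+ i.
Proof. by move=> N0 xiN; have [i ->] := prim_rootP (zeta_prim N0) xiN; exists i. Qed.

Lemma gal_root_unity (w : Om) N xi : (0 < N)%N -> w (zeta N) = zeta N ->
  xi ^+ N = 1 -> w xi = xi.
Proof. by move=> N0 wz /(root_unity_zeta N0)[i ->]; rewrite rmorphXn /= wz. Qed.

Lemma gal_rad (w : Om) n : (0 < n)%N -> coprime n p ->
  exists k, w (rad n) = zeta n ^+ k * rad n.
Proof.
move=> n0 np; have r0 := rad_neq0 n0 np.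
have [|k kE] := @root_unity_zeta n (w (rad n) / rad n) n0.
  by rewrite expr_div_n -rmorphXn rad_pow //= gal_fix divff ?piF_neq0.
by exists k; rewrite -kE divfK.
Qed.

Lemma zeta_dvd N M : (0 < M)%N -> (N %| M)%N -> zeta M ^+ (M %/ N) = zeta N.
Proof.
move=> M0 NM; rewrite -[in zeta M](divnK NM) zeta_compat ?(dvdn_gt0 M0 NM) //.
by rewrite divn_gt0 ?(dvdn_gt0 M0 NM) // dvdn_leq.
Qed.

Lemma rad_dvd n m : (0 < m)%N -> coprime m p -> (n %| m)%N -> rad m ^+ (m %/ n) = rad n.
Proof.
move=> m0 mp nm; rewrite -[in rad m](divnK nm) rad_compat ?divnK ?(dvdn_gt0 m0 nm) //.
by rewrite divn_gt0 ?(dvdn_gt0 m0 nm) // dvdn_leq.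
Qed.

Lemma zeta_Ft N : (0 < N)%N -> coprime N p -> zeta N \in FtF.
Proof. by move=> N0 Np; apply/Fnr_Ft/zeta_Fnr. Qed.

Lemma tame_sub_Ft L : tame abs iota p L -> {subset L <= FtF}.
Proof. by move=> Lt x xL; apply/asboolP => K _ KL; apply: KL xL. Qed.

Lemma Ft_subextension : subextension iota FtF.
Proof.
split; first exact: compositum_divring_closed.
by move=> _ /asboolP[c ->]; apply: base_compositum.
Qed.

(* L has a uniformizer Z' that is a root of unity times a radical of pi, and an
   integer of L is, modulo every power of Z', a combination of Teichmuller
   representatives, which are roots of unity of order prime to p. *)
Lemma tame_radical L : tame abs iota p L -> exists e, [/\ (0 < e)%N, coprime e p,
  rad e \in FtF & forall w : Om,
    (forall N, (0 < N)%N -> coprime N p -> w (zeta N) = zeta N) ->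
    w (rad e) = rad e -> {in L, forall y, w y = y}].
Proof.
move=> Lt; have LFt := tame_sub_Ft Lt.
have [[Lsub _] [e [z [Z [zu Zu zZ]]] ep]] := Lt.
have e0 : (0 < e)%N by case: e ep {zZ} => //; rewrite /coprime gcd0n gtn_eqF ?prime_gt1.
have [zF z0 zm zP] := uniformizerP base_subext zu.
have [piB pi0 pim piP] := uniformizerP base_subext pi_uniformizer.
have [ZL Z0 Zm ZP] := uniformizerP Lsub Zu.
have piL : piF \in L := base_subextension Lsub pi.
have pizU : piF / z \in OU.
  by rewrite integral_unitE mulf_neq0 ?invr_eq0 // invf_div zP // piP.
have ZeU : z / Z ^+ e \in OU.
  by move: zZ; rewrite !inE integral_unitE => /and3P[-> /andP[_ ->] /andP[_ ->]].
(* The unit [eps] is a root of unity tau times a one-unit, which has an e-th root g in L as e is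
   prime to p. Replacing Z by g Z gives pi = tau Z'^e. *)
pose eps := piF / Z ^+ e.
have epsL : eps \in L by rewrite (subext_div Lsub) // (subext_exp Lsub).
have epsU : eps \in OU.
  suff -> : eps = piF / z * (z / Z ^+ e) by exact: integral_unitM.
  by rewrite mulrA divfK.
move: (epsU); rewrite in_integral_unit => /andP[epsO epsm].
have [tau [N [tauL N0 Np tauN epstau]]] := teichmuller Lsub epsL epsO epsm.
have := root_unity_integer N0 tauN; rewrite integral_unitE => /and3P[tau0 _ tauV].
have cm : eps / tau - 1 \in mm.
  by rewrite -[1](divff tau0) -mulrBl mulrC midealM.
have [g [gL gE gm]] := one_unit_root Lsub (subext_div Lsub epsL tauL) cm ep.
have := one_unit_notin gm; rewrite notin_mideal => /andP[g0 gV].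
pose Z' := g * Z; have Z'0 : Z' != 0 by rewrite mulf_neq0.
have Z'L : Z' \in L by rewrite (subext_mul Lsub).
have Z'm : Z' \in mm by rewrite midealM // one_unit_integer.
have Z'P x : x \in L -> x \in mm -> x / Z' \in O.
  by move=> xL xm; rewrite invfM mulrCA rpredM // ZP.
pose xi := rad e / Z'.
have xiE : xi ^+ e = tau.
  rewrite expr_div_n rad_pow // exprMn gE.
  have -> : eps / tau * Z ^+ e = piF / tau by rewrite mulrAC divfK ?expf_neq0.
  by rewrite invf_div mulrCA divff ?mulr1.
have xiN : xi ^+ (e * N) = 1 by rewrite exprM xiE.
have eN0 : (0 < e * N)%N by rewrite muln_gt0 e0.
have eNp : coprime (e * N) p by rewrite coprimeMl ep.
have radE : rad e = xi * Z' by rewrite divfK.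
exists e; split=> //.
  rewrite radE; apply: (subext_mul Ft_subextension); last exact: LFt.
  have [i ->] := root_unity_zeta eN0 xiN.
  by apply: (subext_exp Ft_subextension); apply: zeta_Ft.
move=> w wz wrad.
have wtau t M : (0 < M)%N -> coprime M p -> t ^+ M = 1 -> w t = t.
  by move=> M0 Mp; apply: gal_root_unity (wz M M0 Mp).
have wZ' : w Z' = Z'.
  have xi0 : xi != 0 by rewrite mulf_neq0 ?invr_eq0 ?rad_neq0.
  by apply: (mulfI xi0); rewrite -{1}(wtau xi _ eN0 eNp xiN) -rmorphM /= -radE.
(* Subtracting from y its Teichmuller representative, or 0, and dividing by Z', all fixed by w,
   gains one power of Z'. *)
have step k : forall y, y \in L -> y \in O -> (w y - y) / Z' ^+ k \in O.
  elim: k => [|k IH] y yL yO.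
    by rewrite expr0 divr1 rpredB ?gal_integer.
  have [t [tL wt ytm]] : exists t, [/\ t \in L, w t = t & y - t \in mm].
    have [ym|ym] := boolP (y \in mm).
      exists 0; rewrite rmorph0 subr0; split=> //.
      by rewrite -(subrr 1) (subext_sub Lsub) ?(subext1 Lsub).
    have [t [M [tL M0 Mp tM ytm]]] := teichmuller Lsub yL yO ym.
    by exists t; split=> //; apply: wtau tM.
  have -> : (w y - y) / Z' ^+ k.+1 = (w ((y - t) / Z') - (y - t) / Z') / Z' ^+ k.
    by rewrite fmorph_div rmorphB /= wt wZ' exprS invfM; ring.
  have ytL := subext_sub Lsub yL tL.
  by apply: IH; [rewrite (subext_div Lsub) | apply: Z'P].
have fixO y : y \in L -> y \in O -> w y = y.
  by move=> yL yO; apply/subr0_eq/(mideal_archimedean Z'm Z'0) => k; apply: step.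
move=> y yL; case: (integer_or_inv y) => yO; first exact: fixO.
by apply: invr_inj; rewrite -fmorphV /= fixO // (subext_inv Lsub).
Qed.

(** Membership in Ft is imposed because [sigma_rad] speaks of elements of the tame field;
    [tame_radical] supplies such n. *)
Definition tame_exponent n := [&& (0 < n)%N, coprime n p & rad n \in FtF].

(** For l the least common multiple, a Bezout relation writes [rad l] as a quotient of powers of
    [rad b] and [rad a]. *)
Lemma tame_exponent_lcm a b : tame_exponent a -> tame_exponent b ->
  exists l, [/\ tame_exponent l, (a %| l)%N & (b %| l)%N].
Proof.
move=> /and3P[a0 ap aFt] /and3P[b0 bp bFt].
have [u v uv _] := egcdnP b a0; set g := gcdn a b in uv.
have g0 : (0 < g)%N by rewrite gcdn_gt0 a0.
have /dvdnP[a1 aE] : (g %| a)%N := dvdn_gcdl a b.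
have /dvdnP[b1 bE] : (g %| b)%N := dvdn_gcdr a b.
have uv1 : (u * a1 = v * b1 + 1)%N.
  by apply/eqP; rewrite -(eqn_pmul2r g0) mulnDl mul1n -!mulnA -aE -bE uv.
have b10 : (0 < b1)%N by move: b0; rewrite bE muln_gt0 => /andP[].
have a10 : (0 < a1)%N by move: a0; rewrite aE muln_gt0 => /andP[].
have lE : (b1 * a = a1 * b)%N by rewrite aE bE mulnCA.
have lp : coprime (b1 * a) p.
  by rewrite coprimeMl ap andbT; move: bp; rewrite bE coprimeMl => /andP[].
exists (b1 * a)%N; split; [|exact: dvdn_mull|by rewrite lE dvdn_mull].
rewrite /tame_exponent muln_gt0 b10 a0 lp /=.
have ra : rad (b1 * a)%N ^+ b1 = rad a by rewrite rad_compat.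
have rb : rad (b1 * a)%N ^+ a1 = rad b by rewrite lE rad_compat // -lE.
have r0 : rad (b1 * a)%N != 0 by rewrite rad_neq0 // muln_gt0 b10.
have -> : rad (b1 * a)%N = rad b ^+ u / rad a ^+ v.
  rewrite -ra -rb -!exprM [(a1 * u)%N]mulnC uv1 exprD expr1 [(b1 * v)%N]mulnC.
  by rewrite mulrC mulKf ?expf_neq0.
by rewrite (subext_div Ft_subextension) ?(subext_exp Ft_subextension).
Qed.

Definition fixes_level N n (w : Om) := w (zeta N) = zeta N /\ w (rad n) = rad n.

(** A level stands for the field F(zeta_N, pi^(1/n)), which is Galois over F because n divides N. *)
Definition level N n := [&& (0 < N)%N, coprime N p, tame_exponent n & (n %| N)%N].

Lemma level_join N n N' n' : level N n -> level N' n' -> exists M m,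
  level M m /\ forall w, fixes_level M m w -> fixes_level N n w /\ fixes_level N' n' w.
Proof.
move=> /and4P[N0 Np ne nN] /and4P[N'0 N'p n'e n'N'].
have [m [me nm n'm]] := tame_exponent_lcm ne n'e; have /and3P[m0 mp _] := me.
have M0 : (0 < m * (N * N'))%N by rewrite !muln_gt0 m0 N0.
exists (m * (N * N'))%N, m; split.
  by rewrite /level M0 !coprimeMl mp Np N'p me dvdn_mulr.
have NM : (N %| m * (N * N'))%N by rewrite dvdn_mull // dvdn_mulr.
have N'M : (N' %| m * (N * N'))%N by rewrite dvdn_mull // dvdn_mull.
move=> w [wz wr]; split; split.
- by rewrite -(zeta_dvd M0 NM) rmorphXn /= wz.
- by rewrite -(rad_dvd m0 mp nm) rmorphXn /= wr.
- by rewrite -(zeta_dvd M0 N'M) rmorphXn /= wz.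
- by rewrite -(rad_dvd m0 mp n'm) rmorphXn /= wr.
Qed.

Lemma level1 : level 1 1.
Proof.
rewrite /level /tame_exponent coprime1n /= andbT -[rad 1]expr1 rad_pow ?coprime1n //.
exact: (base_subextension Ft_subextension).
Qed.

Definition level_field : {pred Fc} := fun x => `[< exists N n,
  level N n /\ forall w, fixes_level N n w -> w x = x >].

Lemma level_field_subextension : subextension iota level_field.
Proof.
have op2 (op : Fc -> Fc -> Fc) : (forall (w : Om) x y, w (op x y) = op (w x) (w y)) ->
    forall x y, x \in level_field -> y \in level_field -> op x y \in level_field.
  move=> wop x y /asboolP[N [n [l lx]]] /asboolP[N' [n' [l' l'y]]]; apply/asboolP.
  have [M [m [lM lMP]]] := level_join l l'; exists M, m; split=> // w /lMP[wx wy].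
  by rewrite wop lx // l'y.
split; first split.
- by apply/asboolP; exists 1%N, 1%N; split=> [|w _]; rewrite ?level1 ?rmorph1.
- by apply: op2 => w x y; rewrite rmorphB.
- by apply: (op2 (fun x y => x / y)) => w x y; rewrite fmorph_div.
move=> _ /asboolP[c ->]; apply/asboolP; exists 1%N, 1%N.
by split=> [|w _]; rewrite ?level1 ?gal_fix.
Qed.

(** If a tame L were not inside the union of the levels, an automorphism fixing that union would
    move an element of L; [tame_radical] forbids this. *)
Lemma Ft_level : {subset FtF <= level_field}.
Proof.
move=> x /asboolP; apply; first exact: level_field_subextension.
move=> L Lt y yL; have [e [e0 ep eFt eL]] := tame_radical Lt.
apply: contraT => ynot; have [w wE /eqP[]] := subextension_moves level_field_subextension ynot.
apply: eL => // [N N0 Np|]; apply: wE; apply/asboolP; last first.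
  by exists e, e; split=> [|w' []//]; rewrite /level /tame_exponent e0 ep eFt dvdnn.
exists N, 1%N; split=> [|w' []//]; have /and4P[_ _ t1 _] := level1.
by rewrite /level N0 Np t1 dvd1n.
Qed.

Lemma Ft_levels (S : seq Fc) : {subset S <= FtF} -> exists N n, level N n /\
  forall w, fixes_level N n w -> {in S, forall x, w x = x}.
Proof.
elim: S => [|x S IH] SF; first by exists 1%N, 1%N; split; [exact: level1 | ].
have [|N [n [l lS]]] := IH; first by move=> y yS; rewrite SF // inE yS orbT.
have /Ft_level/asboolP[N' [n' [l' l'x]]] : x \in FtF by rewrite SF ?mem_head.
have [M [m [lM lMP]]] := level_join l l'; exists M, m; split=> // w /lMP[wS wx] y.
by rewrite inE => /orP[/eqP->|]; [apply: l'x | apply: lS].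
Qed.

Variable sigma : GalGroup (tame_emb abs iota p).
Hypothesis sigma_nr : forall x : tame_field abs iota p,
  tame_val x \in Fnr abs iota -> sigma x = x.
Hypothesis sigma_rad : forall n (x : tame_field abs iota p),
  (0 < n)%N -> coprime n p -> tame_val x = rad n ->
  tame_val (sigma x) = zeta n * rad n.
Variable gT : finGroupType.
Hypothesis G_abelian : abelian [set: gT].
Variable h : {multiplicative GalGroup (tame_emb abs iota p) -> gT}.
Hypothesis h_continuous : gal_continuous h.

Notation hr := (h \o @res Qp abs F Fc iota p).

Lemma mulGC : commutative (fun x y : gT => x * y)%g.
Proof. by move=> x y; apply: (centsP G_abelian); rewrite inE. Qed.

Lemma hrM : {morph hr : v w / (v * w)%g}.
Proof.
move=> v w; have resM : res abs p (v * w)%g = (res abs p v * res abs p w)%g.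
  by apply: Defs.gal_eqP => x; apply: val_inj.
by rewrite /= resM gmulfM.
Qed.

(** Continuity at 1 tests finitely many elements of Ft, and these lie in a single level. *)
Lemma hr_level : exists N n, level N n /\ forall w, fixes_level N n w -> hr w = 1%g.
Proof.
have [S hS] := h_continuous 1%g.
have [|N [n [l lS]]] := Ft_levels (S := [seq tame_val x | x <- S]).
  by move=> _ /mapP[x _ ->]; apply: tame_valP.
exists N, n; split=> // w wl; have h1 : h 1%g = 1%g.
  by apply: (mulgI (h 1%g)); rewrite -gmulfM !mulg1.
rewrite -h1; apply: hS => x xS; apply: val_inj => /=.
by apply: lS => //; apply: map_f.
Qed.

(** The graph of sigma on Ft is a partial morphism, to be extended by [graph_extend]. *)
Lemma res_surj : exists sg : Om, res abs p sg = sigma.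
Proof.
pose X0 : set (Fc * Fc) := [set z | exists x : tame_field abs iota p,
  z = (tame_val x, tame_val (sigma x))]%classic.
have gX0 : morphism_graph iota X0.
  split.
  - by move=> c; exists (tame_emb abs iota p c); rewrite gal_fix.
  - by move=> _ _ [x ->] [y ->]; exists (x - y); rewrite rmorphB.
  - by move=> _ _ [x ->] [y ->]; exists (x * y); rewrite rmorphM.
  - move=> y [x [/esym x0 ->]]; have -> : x = 0 by apply: val_inj.
    by rewrite rmorph0.
have [sg sgP] := graph_extend Fc_alg gX0; exists sg.
apply: Defs.gal_eqP => x; apply: val_inj; apply: sgP; by exists x.
Qed.

(** * The image of sigma *)

Variables (N n : nat) (sg : Om).
Hypothesis levelNn : level N n.
Hypothesis hr_fixes : forall w, fixes_level N n w -> hr w = 1%g.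
Hypothesis res_sg : res abs p sg = sigma.

Notation s := (h sigma).
Notation e := (#[h sigma])%g.

Lemma level_gt0 : (0 < N)%N /\ (0 < n)%N.
Proof. by case/and4P: levelNn => N0 _ /and3P[n0 _ _] _. Qed.

Let N_gt0 := level_gt0.1.
Let n_gt0 := level_gt0.2.

Lemma level_coprime : coprime N p /\ coprime n p.
Proof. by case/and4P: levelNn => _ Np /and3P[_ np _] _. Qed.

Let N_coprime := level_coprime.1.
Let n_coprime := level_coprime.2.

Lemma level_dvd : (n %| N)%N.
Proof. by case/and4P: levelNn. Qed.

Lemma hr_sg : hr sg = s.
Proof. by rewrite /= res_sg. Qed.

Lemma hr1 : hr 1%g = 1%g.
Proof. exact: quotient1 hrM. Qed.

Lemma hrX w k : hr (w ^+ k)%g = (hr w ^+ k)%g.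
Proof. by elim: k => [|k IH]; [exact: hr1 | rewrite !expgS hrM IH]. Qed.

Lemma hrV w : hr w^-1%g = (hr w)^-1%g.
Proof. exact: (quotientV hrM). Qed.

Lemma gal_mulE (v w : Om) x : (v * w)%g x = v (w x).
Proof. by []. Qed.

Lemma gal_1E x : (1%g : Om) x = x.
Proof. by []. Qed.

Lemma sg_Fnr x : x \in Fnr abs iota -> sg x = x.
Proof.
move=> xF; pose y := TameField (Fnr_Ft xF).
by have := congr1 (@tame_val _ _ _ _ _ _) (sigma_nr (xF : tame_val y \in _)); rewrite -res_sg.
Qed.

Lemma sg_zeta M : (0 < M)%N -> coprime M p -> sg (zeta M) = zeta M.
Proof. by move=> M0 Mp; apply/sg_Fnr/zeta_Fnr. Qed.

Lemma sg_rad : sg (rad n) = zeta n * rad n.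
Proof.
case/and4P: levelNn => _ _ /and3P[_ _ rF] _; pose y := TameField rF.
by have := sigma_rad n_gt0 n_coprime (erefl : tame_val y = rad n); rewrite -res_sg.
Qed.

Lemma sgX_zeta M k : (0 < M)%N -> coprime M p -> (sg ^+ k)%g (zeta M) = zeta M.
Proof.
by move=> M0 Mp; elim: k => [|k IH]; rewrite ?gal_1E // expgS gal_mulE IH sg_zeta.
Qed.

Lemma sgX_rad k : (sg ^+ k)%g (rad n) = zeta n ^+ k * rad n.
Proof.
elim: k => [|k IH]; first by rewrite gal_1E expr0 mul1r.
by rewrite expgS gal_mulE IH rmorphM rmorphXn /= sg_zeta // sg_rad mulrA exprSr.
Qed.

Lemma fixes_zeta_n (w : Om) : w (zeta N) = zeta N -> w (zeta n) = zeta n.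
Proof. by move=> wz; rewrite -(zeta_dvd N_gt0 level_dvd) rmorphXn /= wz. Qed.

Lemma order_s_dvd : (e %| n)%N.
Proof.
rewrite order_dvdn -hr_sg -hrX; apply/eqP/hr_fixes.
split; first exact: sgX_zeta.
by rewrite sgX_rad (prim_expr_order (zeta_prim n_gt0)) mul1r.
Qed.

Let e_gt0 : (0 < e)%N := order_gt0 _.

Lemma order_s_coprime : coprime e p.
Proof. by apply: coprime_dvdl n_coprime; apply: order_s_dvd. Qed.

Lemma sg_rad_e : sg (rad e) = zeta e * rad e.
Proof.
rewrite -(rad_dvd n_gt0 n_coprime order_s_dvd) rmorphXn /= sg_rad exprMn.
by rewrite (zeta_dvd n_gt0 order_s_dvd).
Qed.

(** Kummer theory: w multiplies [rad n] by a power of zeta_n, just as a power of [sg] does. So [sg]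
    generates the inertia of the level. *)
Lemma zeta_fixed_sg (w : Om) : w (zeta N) = zeta N ->
  exists k, fixes_level N n ((sg ^+ k)^-1 * w)%g.
Proof.
move=> wz; have [k kE] := gal_rad w n_gt0 n_coprime; exists k.
split; rewrite gal_mulE.
  by rewrite wz -{1}(sgX_zeta k N_gt0 N_coprime) [LHS]gal_Kinv.
by rewrite kE -sgX_rad [LHS]gal_Kinv.
Qed.

(** If w raises zeta_n to the power k, then w sg and sg^k w agree on the level. Commutativity of G
    turns this into s^k = s, so k is 1 modulo e. *)
Lemma zeta_e_fixed (w : Om) : w (zeta e) = zeta e.
Proof.
have [k wk] := gal_zeta w n_gt0; have [j wr] := gal_rad w n_gt0 n_coprime.
have [i wi] := gal_zeta w N_gt0.
have sk : (s ^+ k = s)%g.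
  have l : fixes_level N n ((sg ^+ k * w)^-1 * (w * sg))%g.
    have cancel_at x y : (sg ^+ k * w)%g x = y -> (sg ^+ k * w)^-1%g y = x.
      by move=> <-; apply: gal_Kinv.
    split; rewrite gal_mulE; apply: cancel_at; rewrite !gal_mulE.
      by rewrite sg_zeta // wi rmorphXn /= sgX_zeta.
    rewrite wr sg_rad !rmorphM rmorphXn /= sgX_zeta // sgX_rad wk wr; ring.
  have := hr_fixes l; rewrite hrM hrV !hrM hrX hr_sg => /eqP.
  by rewrite -eq_mulVg1 [(hr w * s)%g]mulGC => /eqP/mulIg.
have ke : k = 1 %[mod e].
  by apply/eqP; rewrite -eq_expg_mod_order sk expg1.
rewrite -(zeta_dvd n_gt0 order_s_dvd) rmorphXn /= wk exprAC (zeta_dvd n_gt0 order_s_dvd).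
by rewrite -(prim_expr_mod (zeta_prim e_gt0)) ke (prim_expr_mod (zeta_prim e_gt0)) expr1.
Qed.

Lemma zeta_e_base : exists c, zeta e = iota c.
Proof. exact: gal_base zeta_e_fixed. Qed.

(** Multiplication by zeta_e acts freely on the q - 1 nonzero residues. As [residue_card] merely
    labels residues by ['I_q], without a group structure, orbits are counted. *)
Lemma order_s_residue q : residue_card abs iota pi q -> (e %| q.-1)%N.
Proof.
move=> [red [red_surj red_eq]]; have [c cE] := zeta_e_base.
have zU := zeta_unit e_gt0; move: (zU); rewrite integral_unitE => /and3P[z0 zO zV].
have /choice[lift liftP] : forall x : 'I_q, exists y, iota y \in O /\ red y = x.
  by move=> x; have [y] := red_surj x; exists y.
have cO k : iota (c ^+ k) \in O by rewrite rmorphXn -cE rpredX.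
pose f x := red (c * lift x).
have cyO y : iota y \in O -> iota (c * y) \in O by move=> yO; rewrite rmorphM -cE rpredM.
have fE k y : iota y \in O -> iter k f (red y) = red (c ^+ k * y).
  move=> yO; elim: k => [|k IH]; first by rewrite expr0 mul1r.
  have kO : iota (c ^+ k * y) \in O by rewrite rmorphM rpredM.
  rewrite iterS IH exprS -mulrA; have [lO lE] := liftP (red (c ^+ k * y)).
  rewrite /f; apply/red_eq; rewrite ?cyO //.
  have [z zOz zz] := (red_eq _ _ lO kO).1 lE; exists (c * z); first exact: cyO.
  by rewrite -mulrBr zz mulrCA.
have ce : c ^+ e = 1.
  by apply: (fmorph_inj iota); rewrite rmorphXn -cE rmorph1 (prim_expr_order (zeta_prim e_gt0)).
have fe x : iter e f x = x.
  by have [yO <-] := liftP x; rewrite fE // ce mul1r.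
have O0 : iota 0 \in O by rewrite rmorph0 rpred0.
have free x k : x != red 0 -> iter k f x = x -> (e %| k)%N.
  have [yO <-] := liftP x; set y := lift x in yO *; move=> y0.
  have kO : iota (c ^+ k * y) \in O by rewrite rmorphM rpredM.
  rewrite fE // => /(red_eq _ _ kO yO)[z zOz zE].
  rewrite (prim_order_dvd (zeta_prim e_gt0)); apply/eqP.
  apply: (root_unity_mideal order_s_coprime).
    by rewrite -exprM mulnC exprM (prim_expr_order (zeta_prim e_gt0)) expr1n.
  have : (zeta e ^+ k - 1) * iota y \in mm.
    rewrite cE -rmorphXn -(rmorph1 iota) -rmorphB -rmorphM mulrBl mul1r zE rmorphM mulrC.
    by rewrite midealM ?piF_mideal.
  case/mideal_prime => // ym; case/eqP: y0; apply/(red_eq _ _ yO O0).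
  have yfix (w : Om) : w (iota y) = iota y := gal_fix _ _.
  exists (y / pi); first by rewrite fmorph_div fixed_mideal_div.
  rewrite subr0 mulrC divfK //; apply: contraNneq piF_neq0 => ->.
  by rewrite rmorph0.
have f_inj : injective f.
  move=> x y fxy; rewrite -(fe x) -(fe y) -(prednK e_gt0) !iterSr.
  by rewrite fxy.
pose g := perm f_inj; have gE k x : (g ^+ k)%g x = iter k f x.
  by rewrite permX; elim: k => //= k ->; rewrite permE.
have ge : (g ^+ e = 1)%g by apply/permP => x; rewrite gE fe perm1.
have f0 : f (red 0) = red 0 by have := fE 1%N _ O0; rewrite mulr0.
pose A := [set x : 'I_q | x != red 0].
have cardA : #|A| = q.-1.
  have -> : A = [set~ red 0] by apply/setP => x; rewrite !inE.
  by rewrite cardsC1 card_ord.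
have g_acts : [acts <[g]>%g, on A | 'P]%g.
  apply/actsP => _ /cycleP[k ->] x; rewrite !inE /= /aperm gE.
  have iter0 : iter k f (red 0) = red 0 by elim: k => //= k ->.
  have iter_inj : injective (iter k f) by elim: {iter0} k => [|k IH] y z //= /f_inj/IH.
  by rewrite -{1}iter0 (inj_eq iter_inj).
rewrite -cardA -(acts_sum_card_orbit g_acts); apply: dvdn_sum => _ /imsetP[x xA ->].
have x0 : x != red 0 by rewrite inE in xA.
have stab : ('C_<[g]>[x | 'P])%g = 1%g.
  apply/trivgP/fintype.subsetP => _ /setIP[/cycleP[k ->]] /astab1P /=; rewrite /aperm gE => kx.
  have /dvdnP[i ->] := free _ _ x0 kx.
  by rewrite inE mulnC expgM ge expg1n.
rewrite card_orbit stab indexg1; apply: (free x) => //.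
by rewrite -gE expg_order perm1.
Qed.

Lemma zeta_e_exponent (w : Om) k : let m := exponent [set: gT] in
  w (zeta m) = zeta m ^+ k -> (s ^+ k = s)%g.
Proof.
move=> m wk; have m0 : (0 < m)%N := exponent_gt0 _.
have em : (e %| m)%N by apply: dvdn_exponent; rewrite inE.
have := zeta_e_fixed w; rewrite -(zeta_dvd m0 em) rmorphXn /= wk exprAC (zeta_dvd m0 em).
rewrite -{2}[zeta e]expr1 => /eqP; rewrite (eq_prim_root_expr (zeta_prim e_gt0)) => /eqP ke.
by apply/eqP; rewrite -[X in _ == X]expg1 eq_expg_mod_order; apply/eqP.
Qed.

(** The cyclotomic character is 1 modulo e because zeta_e lies in F. So the twisted action fixes s,
    and being bijective sends no other element to s. *)
Lemma prime_f_Lambda : in_Lambda zeta iota (prime_f iota pi s).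
Proof.
split=> [t|w t]; rewrite /prime_f.
  by case: ifP => _; rewrite ?piF_neq0 ?oner_eq0.
set m := exponent [set: gT]; have m0 : (0 < m)%N := exponent_gt0 _.
rewrite /twisted_act /cyclotomic_char -/m.
have [k0 wk0] := gal_zeta w m0.
set k := xget _ _; have wk : w (zeta m) = zeta m ^+ k.
  exact: (@xgetPex _ 0%N [set k : nat | w (zeta m) = zeta m ^+ k]%classic (ex_intro _ k0 wk0)).
have km : coprime k m.
  rewrite -(prim_root_exp_coprime k (zeta_prim m0)) -wk.
  by rewrite fmorph_primitive_root zeta_prim.
have kG : coprime #|[set: gT]| k.
  have [k_0|k_gt0] := posnP k.
    move: km; rewrite k_0 /coprime gcd0n => /eqP m1.
    have : [set: gT]%G :==: 1%g by rewrite trivg_exponent -[exponent _]/m m1.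
    by move=> /eqP ->; rewrite cards1 gcd1n.
  by rewrite coprime_has_primes ?cardG_gt0 // -primes_exponent -coprime_has_primes // coprime_sym.
have sk := zeta_e_exponent wk.
have -> : (t ^+ expg_invn [set: gT] k == s)%g = (t == s).
  apply/eqP/eqP => [tE|->]; last first.
    by rewrite -{1}sk expgK ?inE.
  by rewrite -[t](expgK kG) ?inE // -expgM mulnC expgM tE sk.
by case: ifP => _; rewrite ?gal_fix ?rmorph1.
Qed.

(** Being fixed by the inertia of the level, x lies in F(zeta_N), where pi is a uniformizer. *)
Lemma sg_fixed_val x : (forall w, fixes_level N n w -> w x = x) -> sg x = x ->
  x != 0 -> exists j : int, x / piF ^ j \in OU.
Proof.
move=> xfix sgx; apply: (fixed_val (M := cyclo_field N)).
- exact: fixed_by_subextension.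
- by move=> y; apply: cyclo_field_mideal_div.
apply/asboolP => w wz; have [k /xfix] := zeta_fixed_sg wz.
rewrite gal_mulE => /(congr1 (sg ^+ k)%g); rewrite [LHS]gal_invK => ->.
by elim: k => [|k IH]; rewrite ?gal_1E // expgSr gal_mulE sgx.
Qed.

(** * The square root of the inverse different *)

Notation K := (fixed_field hr).
Notation all_gal := (fun _ : Om => True).
Notation ker_hr := (fun w : Om => hr w = 1%g).
Notation TK := (partial_trace hr all_gal).

Lemma K_subextension : subextension iota K.
Proof. exact: fixed_by_subextension. Qed.

Lemma K_fixed x (w : Om) : x \in K -> hr w = 1%g -> w x = x.
Proof. by move=> /asboolP; apply. Qed.

Lemma K_level x w : x \in K -> fixes_level N n w -> w x = x.
Proof. by move=> xK /hr_fixes; apply: K_fixed. Qed.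

Lemma gal_K (w : Om) x : x \in K -> w x \in K.
Proof.
move=> xK; apply/asboolP => v v1.
have vw : hr (v * w)%g = hr w by rewrite hrM v1 mul1g.
exact: (quotient_act hrM xK vw).
Qed.

Lemma TK_base x : x \in K -> exists c, TK x = iota c.
Proof. by move=> xK; apply: gal_base => w; apply: (gal_partial_trace hrM). Qed.

Lemma level_quotient : exists (gM : finGroupType) (phi : Om -> gM),
  {morph phi : v w / (v * w)%g} /\ forall w, phi w = 1%g <-> fixes_level N n w.
Proof.
have zN := zeta_prim N_gt0; have zn := zeta_prim n_gt0.
pose X := [seq zeta N ^+ i | i <- seq.iota 0 N] ++ [seq zeta n ^+ i * rad n | i <- seq.iota 0 n].
have mod_mem (M : nat) (f : nat -> Fc) k : (0 < M)%N -> (forall i, f (i %% M)%N = f i) ->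
    f k \in [seq f i | i <- seq.iota 0 M].
  by move=> M0 fM; rewrite -fM map_f // mem_iota ltn_mod.
have inz k : zeta N ^+ k \in X.
  by rewrite mem_cat mod_mem // => i; rewrite prim_expr_mod.
have inr k : zeta n ^+ k * rad n \in X.
  rewrite mem_cat (mod_mem n (fun i => zeta n ^+ i * rad n)) ?orbT // => i.
  by rewrite prim_expr_mod.
have [w x|gM [phi [phiM phi1]]] := finite_quotient (X := X).
  have [k wk] := gal_zeta w N_gt0; have [j wj] := gal_zeta w n_gt0.
  have [r wr] := gal_rad w n_gt0 n_coprime.
  rewrite mem_cat => /orP[] /mapP[i _ ->]; first by rewrite rmorphXn /= wk -exprM inz.
  by rewrite rmorphM rmorphXn /= wj wr -exprM mulrA -exprD inr.
exists gM, phi; split=> // w; rewrite phi1; split=> [wX|[wz wr] x].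
  by split; [rewrite -[zeta N]expr1 wX | rewrite -[rad n]mul1r -(expr0 (zeta n)) wX].
rewrite mem_cat => /orP[] /mapP[i _ ->]; first by rewrite rmorphXn /= wz.
by rewrite rmorphM rmorphXn /= wr fixes_zeta_n.
Qed.

Lemma ker_hr_subgroup : [/\ ker_hr 1%g, forall v w, ker_hr v -> ker_hr w -> ker_hr (v * w)%g
  & forall v, ker_hr v -> ker_hr v^-1%g].
Proof.
split; first exact: hr1.
  by move=> v w v1 w1; rewrite hrM v1 w1 mulg1.
by move=> v v1; rewrite hrV v1 invg1.
Qed.

Section LevelQuotient.

Variables (gM : finGroupType) (phi : Om -> gM).
Hypothesis phiM : {morph phi : v w / (v * w)%g}.
Hypothesis phi1 : forall w, phi w = 1%g <-> fixes_level N n w.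

Let phi_ker w : phi w = 1%g -> hr w = 1%g.
Proof. by move=> /phi1/hr_fixes. Qed.

Let Msub := fixed_by_subextension (fun w => phi w = 1%g).
Notation M := (quotient_fixed phi).

Lemma zeta_level : zeta N \in M.
Proof. by apply/asboolP => w /phi1[]. Qed.

Lemma rad_level : rad n \in M.
Proof. by apply/asboolP => w /phi1[]. Qed.

Definition level_elt (ij : 'I_N * 'I_n) := zeta N ^+ ij.1 * rad n ^+ ij.2.

Lemma level_elt_M ij : level_elt ij \in M.
Proof.
by rewrite (subext_mul Msub) ?(subext_exp Msub) ?zeta_level ?rad_level.
Qed.

(** The sum factors into two geometric sums over roots of unity, both nonzero only when v and w
    agree on the level. Thus the [level_elt] and their inverses are dual up to the factor N n. *)
Lemma level_orthogonality (v w : Om) :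
  \sum_ij (v (level_elt ij))^-1 * w (level_elt ij) = (phi v == phi w)%:R * (N * n)%:R.
Proof.
have z0 := zeta_neq0 N_gt0; have r0 := rad_neq0 n_gt0 n_coprime.
transitivity ((\sum_(i < N) (w (zeta N) / v (zeta N)) ^+ i) *
              (\sum_(j < n) (w (rad n) / v (rad n)) ^+ j)).
  rewrite big_distrlr /= pair_bigA /=; apply: eq_bigr => -[i j] _ /=.
  rewrite /level_elt !rmorphM !rmorphXn /= !expr_div_n invfM; ring.
rewrite !sum_root_unity; first last.
- by rewrite expr_div_n -!rmorphXn /= (prim_expr_order (zeta_prim N_gt0)) !rmorph1 divr1.
- rewrite expr_div_n -!rmorphXn /= rad_pow //= !gal_fix divff //; exact: piF_neq0.
rewrite natrM mulrACA; congr (_ * _); rewrite -natrM mulnb; congr ((nat_of_bool _)%:R).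
have divE (a b : Fc) : b != 0 -> (a / b == 1) = (a == b).
  by move=> b0; rewrite -(inj_eq (mulIf b0)) divfK // mul1r.
rewrite !divE ?fmorph_eq0 //; apply/andP/eqP => [[/eqP wz /eqP wr]|vw].
  have : phi (v^-1 * w)%g = 1%g.
    by apply/phi1; split; rewrite gal_mulE ?wz ?wr [LHS]gal_Kinv.
  by rewrite phiM (quotientV phiM) => /eqP; rewrite -eq_mulVg1 => /eqP.
by split; apply/eqP; apply: (quotient_act phiM) => //; rewrite ?zeta_level ?rad_level.
Qed.

Notation trU := (partial_trace phi ker_hr).

Lemma trU_K x : x \in M -> trU x \in K.
Proof.
move=> xM; have [U1 UM UV] := ker_hr_subgroup; apply/asboolP => w w1.
exact: (gal_partial_trace phiM).
Qed.

(** Summing [level_orthogonality] over the kernel of h on both sides brings the dual families down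
    to K. *)
Lemma level_dual (w : Om) :
  \sum_ij trU (level_elt ij)^-1 * w (trU (level_elt ij)) =
  (hr w == 1%g)%:R * (#|quotient_img phi ker_hr| * (N * n))%:R.
Proof.
have [U1 UM UV] := ker_hr_subgroup; set I := quotient_img phi ker_hr.
pose r := quotient_rep phi ker_hr.
have rP t : t \in I -> hr (r t) = 1%g /\ phi (r t) = t by exact: quotient_repP.
transitivity (\sum_(k in I) \sum_(k' in I) (phi (r k) == phi (w * r k')%g)%:R * (N * n)%:R : Fc).
  transitivity (\sum_(k in I) \sum_(k' in I) \sum_ij
      (r k (level_elt ij))^-1 * (w * r k')%g (level_elt ij)).
    rewrite (eq_bigr (fun k => \sum_ij \sum_(k' in I)
        (r k (level_elt ij))^-1 * (w * r k')%g (level_elt ij))); last first.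
      by move=> k _; rewrite exchange_big.
    rewrite exchange_big /=; apply: eq_bigr => ij _.
    rewrite rmorph_sum big_distrlr /=; apply: eq_bigr => k _; apply: eq_bigr => k' _.
    by rewrite fmorphV.
  by apply: eq_bigr => k _; apply: eq_bigr => k' _; apply: level_orthogonality.
have [w1|w1] := eqVneq (hr w) 1%g; last first.
  rewrite mul0r big1 // => k kI; rewrite big1 // => k' k'I.
  case: eqP => [E|_]; last by rewrite mul0r.
  case/eqP: w1; have := quotient_ker phiM hrM phi_ker E.
  by rewrite hrM (rP k kI).1 (rP k' k'I).1 mulg1.
rewrite mul1r [RHS]natrM [RHS]mulr_natl -sumr_const; apply: eq_bigr => k kI.
have Iw : phi w \in I by apply: quotient_mem.
have k'I : ((phi w)^-1 * k)%g \in I.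
  by rewrite -(quotientV phiM) (quotient_img_mulr phiM UM UV) // UV.
rewrite (bigD1 ((phi w)^-1 * k)%g) //= big1 ?addr0 => [|k' /andP[k'I' k'k]].
  by rewrite phiM (rP _ k'I).2 (rP _ kI).2 mulKVg eqxx mul1r.
rewrite phiM (rP _ k'I').2 (rP _ kI).2; case: eqP => [E|_]; last by rewrite mul0r.
by rewrite E mulKg eqxx in k'k.
Qed.

(** The sum over i of zeta_N^(-i) Tr(zeta_N^i) is N times the order of the inertia group of the
    level. That order divides n, so the sum is a unit and some Tr(zeta_N^i) is one; z is the
    intermediate trace to K. *)
Lemma level_trace_unit : exists z, [/\ z \in K, z \in O & TK z \notin mm].
Proof.
have [U1 UM UV] := ker_hr_subgroup.
pose TM := partial_trace phi all_gal.
have rP t : t \in quotient_img phi all_gal -> phi (quotient_rep phi all_gal t) = t.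
  by move=> /quotient_repP[].
have z0 := zeta_neq0 N_gt0.
have zU := zeta_unit N_gt0; move: (zU); rewrite integral_unitE => /and3P[_ zO zV].
have zM i : zeta N ^+ i \in M by rewrite (subext_exp Msub) ?zeta_level.
have sumE : \sum_(i < N) zeta N ^- i * TM (zeta N ^+ i) = (#[phi sg]%g * N)%:R.
  transitivity (\sum_(t in quotient_img phi all_gal)
      \sum_(i < N) (quotient_rep phi all_gal t (zeta N) / zeta N) ^+ i).
    rewrite exchange_big /=; apply: eq_bigr => i _; rewrite mulr_sumr.
    by apply: eq_bigr => t _; rewrite rmorphXn /= expr_div_n mulrC.
  rewrite natrM mulr_natl -sumr_const big_mkcond [RHS]big_mkcond /=.
  apply: eq_bigr => t _; case: ifP => [tI|tI]; last first.
    case: ifP => // /cycleP[k tk]; case/negP: (negbT tI); rewrite tk.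
    by apply/quotient_imgP; exists (sg ^+ k)%g => //; elim: k {tk} => [|k IH];
      [exact: (quotient1 phiM) | rewrite !expgS phiM IH].
  have phiX k : phi (sg ^+ k)%g = (phi sg ^+ k)%g.
    by elim: k => [|k IH]; [exact: (quotient1 phiM) | rewrite !expgS phiM IH].
  rewrite sum_root_unity; last first.
    by rewrite expr_div_n -rmorphXn /= (prim_expr_order (zeta_prim N_gt0)) rmorph1 divr1.
  rewrite -(inj_eq (mulIf z0)) divfK // mul1r.
  have -> : (quotient_rep phi all_gal t (zeta N) == zeta N) = (t \in <[phi sg]>%g).
    apply/eqP/cycleP => [/zeta_fixed_sg[k /phi1]|[k tk]].
      rewrite phiM (quotientV phiM) rP // phiX => /eqP; rewrite -eq_mulVg1 => /eqP <-.
      by exists k.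
    apply: (etrans _ (sgX_zeta k N_gt0 N_coprime)).
    apply: (quotient_act phiM zeta_level).
    by rewrite rP // phiX.
  by case: ifP; rewrite ?mul1r ?mul0r.
have [i iT] : exists i, TM (zeta N ^+ i) \notin mm.
  apply: contrapT => /forallNP H.
  have : (#[phi sg]%g * N)%:R \in mm.
    rewrite -sumE; apply: mideal_sum => i _; rewrite -exprVn midealM ?rpredX //.
    by apply/negPn/negP; apply: H.
  apply/negP/nat_notin_mideal; rewrite coprimeMl N_coprime andbT.
  apply: coprime_dvdl n_coprime; rewrite order_dvdn.
  have phiX k : phi (sg ^+ k)%g = (phi sg ^+ k)%g.
    by elim: k => [|k IH]; [exact: (quotient1 phiM) | rewrite !expgS phiM IH].
  rewrite -phiX; apply/eqP/phi1; split; first exact: sgX_zeta.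
  by rewrite sgX_rad (prim_expr_order (zeta_prim n_gt0)) mul1r.
exists (trU (zeta N ^+ i)); split; first exact: trU_K.
  by apply: partial_trace_integer; rewrite rpredX.
by rewrite (partial_trace_tower phiM hrM).
Qed.

End LevelQuotient.

(** These families give expansions by traces, the comparison of the two notions of trace, and the
    inverse of the resolvend. *)
Lemma K_dual : exists m (c y : 'I_m -> Fc), [/\ forall l, c l \in K, forall l, y l \in K
  & forall w : Om, \sum_l c l * w (y l) = (hr w == 1%g)%:R].
Proof.
have [gM [phi [phiM phi1]]] := level_quotient.
set d := (#|quotient_img phi ker_hr| * (N * n))%N.
have d0 : d%:R != 0 :> Fc.
  rewrite ((pcharf0P _).1 Fc_char0) /d -lt0n !muln_gt0 N_gt0 n_gt0 !andbT card_gt0.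
  apply/set0Pn; exists 1%g; rewrite -(quotient1 phiM).
  by apply: quotient_mem; have [] := ker_hr_subgroup.
pose f (l : 'I_#|{: 'I_N * 'I_n}|) := level_elt (enum_val l).
have fM l : f l \in quotient_fixed phi by apply: level_elt_M.
have Msub := fixed_by_subextension (fun w => phi w = 1%g).
have fVM l : (f l)^-1 \in quotient_fixed phi by rewrite (subext_inv Msub).
exists #|{: 'I_N * 'I_n}|, (fun l => partial_trace phi ker_hr (f l)^-1 / d%:R),
  (fun l => partial_trace phi ker_hr (f l)); split.
- move=> l; rewrite (subext_div K_subextension) ?trU_K //.
  by rewrite -(rmorph_nat iota) (base_subextension K_subextension).
- by move=> l; rewrite trU_K.
move=> w; have := level_dual phiM phi1 w; rewrite -/d => dualE.
apply: (mulIf d0); rewrite -dualE mulr_suml.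
rewrite (reindex_onto enum_rank enum_val) => [|l _]; last exact: enum_valK.
rewrite (eq_bigl xpredT) => [|ij]; last by rewrite enum_rankK eqxx.
apply: eq_bigr => ij _; rewrite /f enum_rankK mulrAC divfK //.
Qed.

Lemma K_trace_unit : exists z, [/\ z \in K, z \in O & TK z \notin mm].
Proof. by have [gM [phi [phiM phi1]]] := level_quotient; apply: level_trace_unit phiM phi1. Qed.

Lemma K_dual_expand m (c y : 'I_m -> Fc) x : (forall l, y l \in K) ->
  (forall w : Om, \sum_l c l * w (y l) = (hr w == 1%g)%:R) -> x \in K ->
  x = \sum_l c l * TK (y l * x).
Proof.
move=> yK dual xK; transitivity (\sum_(t in quotient_img hr all_gal)
    (\sum_l c l * quotient_rep hr all_gal t (y l)) * quotient_rep hr all_gal t x).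
  have t1 : 1%g \in quotient_img hr all_gal by rewrite -hr1; apply: quotient_mem.
  rewrite (bigD1 1%g) //= dual; have [_ r1] := quotient_repP t1.
  rewrite r1 eqxx mul1r (K_fixed xK r1) big1 ?addr0 // => t /andP[tI t1'].
  by rewrite dual; have [_ ->] := quotient_repP tI; rewrite (negPf t1') mul0r.
under eq_bigr do rewrite mulr_suml.
rewrite exchange_big /=; apply: eq_bigr => l _; rewrite mulr_sumr.
by apply: eq_bigr => t _; rewrite rmorphM mulrA.
Qed.

(** Expanding x b_i by the dual families yields the matrix entries. The matrix trace becomes the sum
    of the traces of x y_l c_l, and the products c_l y_l add up to 1. *)
Lemma K_trace x t : x \in K -> is_trace iota K x t -> iota t = TK x.
Proof.
move=> xK [m [b [Mx [[bK bspan] xb ->]]]]; have [d [c [y [cK yK dual]]]] := K_dual.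
have KM := subext_mul K_subextension.
have uniq_coord z (u v : 'I_m -> F) : z \in K ->
    z = \sum_j iota (u j) * b j -> z = \sum_j iota (v j) * b j -> u =1 v.
  move=> zK uE vE j; have [r [_ rU]] := bspan z zK.
  have toR (f : 'I_m -> F) : z = \sum_j iota (f j) * b j -> r = \row_j f j.
    by move=> fE; apply: rU; rewrite {1}fE; apply: eq_bigr => i _; rewrite mxE.
  by have /rowP/(_ j) := etrans (esym (toR u uE)) (toR v vE); rewrite !mxE.
have /choice[g gE] : forall l, exists g : 'I_m -> F, c l = \sum_j iota (g j) * b j.
  by move=> l; have [r [rE _]] := bspan _ (cK l); exists (r 0).
have /choice[tr trE] : forall z, exists t, z \in K -> TK z = iota t.
  move=> z; have [/TK_base[t' tE]|zK] := boolP (z \in K); first by exists t'.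
  by exists 0.
have MxE i j : Mx i j = \sum_l g l j * tr (y l * (x * b i)).
  apply: (uniq_coord (x * b i) (Mx i) (fun j => \sum_l g l j * tr (y l * (x * b i)))) => //.
    by rewrite KM.
  rewrite {1}(K_dual_expand yK dual (KM _ _ xK (bK i))).
  under [RHS]eq_bigr do rewrite rmorph_sum mulr_suml.
  rewrite exchange_big /=; apply: eq_bigr => l _.
  rewrite trE ?KM // gE mulr_suml; apply: eq_bigr => k _; rewrite rmorphM; ring.
rewrite /mxtrace rmorph_sum; under eq_bigr do rewrite MxE rmorph_sum.
transitivity (\sum_l TK (x * y l * c l)).
  rewrite exchange_big /=; apply: eq_bigr => l _.
  transitivity (\sum_i TK (iota (g l i) * (y l * (x * b i)))).
    apply: eq_bigr => i _; rewrite rmorphM -trE ?KM // /partial_trace mulr_sumr.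
    by apply: eq_bigr => k _; rewrite [RHS]rmorphM /= gal_fix.
  rewrite /partial_trace exchange_big /=; apply: eq_bigr => k _.
  rewrite -rmorph_sum; congr (_ _); rewrite gE mulr_sumr; apply: eq_bigr => i _; ring.
rewrite /partial_trace exchange_big /=; apply: eq_bigr => k _.
rewrite -rmorph_sum; congr (_ _).
have d1 : \sum_l c l * y l = 1 by have := dual 1%g; rewrite hr1 eqxx.
rewrite -[RHS]mulr1 -d1 mulr_sumr; by apply: eq_bigr => l _; ring.
Qed.

Lemma K_trace_exists m (b : 'I_m -> Fc) x : is_basis iota K b -> x \in K ->
  exists t, is_trace iota K x t.
Proof.
move=> bB xK; have [bK bspan] := bB.
have /choice[r rE] : forall i, exists r : 'rV[F]_m, x * b i = \sum_j iota (r 0 j) * b j.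
  by move=> i; have [r [rE _]] := bspan _ (subext_mul K_subextension xK (bK i)); exists r.
exists (\tr (\matrix_(i, j) r i 0 j)), m, b, (\matrix_(i, j) r i 0 j); split=> // i.
by rewrite rE; apply: eq_bigr => j _; rewrite mxE.
Qed.

Notation Idl := (sqrt_inverse_different abs iota K).
Notation Dif := (inverse_different abs iota K).

Variable a : {ffun gT -> Fc}.
Hypothesis a_Fh : a \in galois_algebra hr.
Hypothesis a_gen : sqrt_module abs hr =i integral_span abs iota a.

Lemma a_Idl t : a t \in Idl.
Proof.
suff : a \in sqrt_module abs hr by rewrite inE => /andP[_ /forallP].
rewrite a_gen; apply/asboolP; exists [ffun u => (u == 1%g)%:R] => [u|t'].
  by rewrite ffunE rmorph_nat rpred_nat.
rewrite (bigD1 1%g) //= big1 => [|u u1].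
  by rewrite !ffunE eqxx rmorph1 mul1r addr0 mulg1.
by rewrite ffunE (negPf u1) rmorph0 mul0r.
Qed.

(** The value a(1) lies in [Idl], which excludes the empty default of [xget]: the hypothesis on a
    itself provides the existence of the square root. *)
Lemma Idl_spec :
  is_fractional_ideal abs iota K Idl /\ ideal_mul Idl Idl =i Dif.
Proof.
have := a_Idl 1%g; rewrite /sqrt_inverse_different.
by case: xgetP => [I _ []|_].
Qed.

Let Idl_ideal := Idl_spec.1.
Let Idl_square := Idl_spec.2.

Lemma Idl_sub x : x \in Idl -> x \in K.
Proof. by case: Idl_ideal => IK _ _ _ _; apply: IK. Qed.

Lemma Idl_scale c x : c \in K -> c \in O -> x \in Idl -> c * x \in Idl.
Proof. by case: Idl_ideal => _ _ _ IM _ cK cO; apply: IM; rewrite inE cK. Qed.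

Lemma Idl_mul x y : x \in Idl -> y \in Idl -> x * y \in Dif.
Proof.
move=> xI yI; rewrite -Idl_square; apply/asboolP; exists [:: (x, y)].
  by move=> u; rewrite inE => /eqP -> /=; rewrite xI yI.
by rewrite big_seq1.
Qed.

(** Membership in the inverse different carries a matrix trace, hence a basis; 0 is a member, as an
    empty sum of products. *)
Lemma K_has_basis : exists m (b : 'I_m -> Fc), is_basis iota K b.
Proof.
have : 0 \in Dif.
  by rewrite -Idl_square; apply/asboolP; exists [::]; rewrite ?big_nil.
move=> /asboolP[_ /(_ 1)]; rewrite mulr1; case=> [|t [m [b [Mx [bB _ _]]]] _].
  by rewrite inE (subext1 K_subextension) /= rpred1.
by exists m, b.
Qed.

Lemma DifP x : x \in Dif <-> x \in K /\ forall y, y \in K -> y \in O -> TK (x * y) \in O.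
Proof.
have KM := subext_mul K_subextension.
split=> [/asboolP[xK xD]|[xK xD]].
  split=> // y yK yO; have [|t tT tO] := xD y; first by rewrite inE yK.
  by rewrite -(K_trace _ tT) ?KM.
apply/asboolP; split=> // y; rewrite inE => /andP[yK yO].
have [m [b bB]] := K_has_basis; have [t tT] := K_trace_exists bB (KM _ _ xK yK).
by exists t => //; rewrite (K_trace _ tT) ?KM // xD.
Qed.

(* Tameness enters here: the trace of K is surjective on integers. *)
Lemma Dif_bound x : x \in Dif -> x * piF \in mm.
Proof.
move=> /DifP[xK xD]; have [z [zK zO zT]] := K_trace_unit.
have piK : piF \in K := base_subextension K_subextension pi.
apply: contraT; rewrite notin_mideal mulf_eq0 negb_or => /andP[/andP[x0 _] xpiO].
case/negP: zT; have yK : z * (x * piF)^-1 \in K.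
  by rewrite (subext_div K_subextension) // (subext_mul K_subextension).
have := xD _ yK (rpredM zO xpiO).
have -> : x * (z * (x * piF)^-1) = iota pi^-1 * z.
  transitivity (x / x * (piF^-1 * z)); last by rewrite divff // mul1r fmorphV.
  by rewrite invfM; ring.
have -> : TK (iota pi^-1 * z) = TK z / piF.
  rewrite /partial_trace mulr_suml; apply: eq_bigr => t _.
  by rewrite rmorphM /= gal_fix fmorphV mulrC.
by move=> TO; rewrite -(divfK piF_neq0 (TK z)) midealM ?piF_mideal.
Qed.

Lemma Idl_bound x : x \in Idl -> x ^+ 2 * piF \in mm.
Proof. by move=> xI; apply: Dif_bound; apply: Idl_mul. Qed.

(** The conjugates of w(x) / x under the powers of w have product 1, by telescoping. Whichever of
    this quotient and its inverse is integral, the remaining conjugates show that the other is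
    too. *)
Lemma gal_K_unit (w : Om) x : x \in K -> x != 0 -> w x / x \in OU.
Proof.
move=> xK x0; set k := #[hr w]%g; have k0 : (0 < k)%N := order_gt0 _.
have prodE j : \prod_(i < j) (w ^+ i)%g (w x / x) = (w ^+ j)%g x / x.
  elim: j => [|j IH]; first by rewrite big_ord0 gal_1E divff.
  rewrite big_ord_recr /= IH fmorph_div /= -gal_mulE -expgSr mulrC.
  by rewrite mulrA divfK // fmorph_eq0.
have prod1 : \prod_(i < k) (w ^+ i)%g (w x / x) = 1.
  by rewrite prodE (K_fixed xK) ?divff // hrX expg_order.
have inv_int y : y \in O -> \prod_(i < k) (w ^+ i)%g y = 1 -> y^-1 \in O.
  move=> yO; rewrite -(prednK k0) big_ord_recl gal_1E => y1.
  have y0 : y != 0.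
    by apply: contra_eq_neq y1 => ->; rewrite mul0r eq_sym oner_eq0.
  have -> : y^-1 = \prod_(i < k.-1) (w ^+ bump 0 i)%g y.
    by apply: (mulfI y0); rewrite y1 divff.
  by apply: rpred_prod => i _; rewrite gal_integer.
have z0 : w x / x != 0 by rewrite mulf_neq0 ?invr_eq0 // fmorph_eq0.
rewrite integral_unitE z0 /=; case: (integer_or_inv (w x / x)) => zO.
  by rewrite zO inv_int.
rewrite zO andbT -[_ / _]invrK inv_int //.
by under eq_bigr do rewrite fmorphV; rewrite prodfV prod1 invr1.
Qed.

(** Up to a unit, x^e is the product of the conjugates of x under the powers of [sg], which is fixed
    by [sg]. *)
Lemma K_val x : x \in K -> x != 0 -> exists j : int, x ^+ e / piF ^ j \in OU.
Proof.
move=> xK x0; pose nu := \prod_(i < e) (sg ^+ i)%g x.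
have sgx : (sg ^+ e)%g x = x by rewrite (K_fixed xK) // hrX hr_sg expg_order.
have nu0 : nu != 0 by apply/prodf_neq0 => i _; rewrite fmorph_eq0.
have nu_sg : sg nu = nu.
  pose f k := (sg ^+ k)%g x; rewrite rmorph_prod.
  transitivity (\prod_(i < e) f i.+1); first by apply: eq_bigr => i _; rewrite /f expgS.
  have f0 : f 0%N != 0 by rewrite fmorph_eq0.
  apply: (mulfI f0); rewrite /nu -(big_mkord xpredT f) -(big_mkord xpredT (fun i => f i.+1)).
  by rewrite -big_nat_recl // big_nat_recr //= mulrC /f sgx.
have nuU : x ^+ e / nu \in OU.
  rewrite -integral_unitV invf_div -(card_ord e) -prodr_const -prodf_div.
  elim/big_rec: _ => [|i y _ yU]; first exact: integral_unit1.
  by rewrite integral_unitM ?gal_K_unit.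
have nuK w : fixes_level N n w -> w nu = nu.
  move=> wl; rewrite rmorph_prod; apply: eq_bigr => i _; apply: K_level => //.
  exact: gal_K.
have [j jU] := sg_fixed_val nuK nu_sg nu0; exists j.
have -> : x ^+ e / piF ^ j = (x ^+ e / nu) * (nu / piF ^ j) by rewrite mulrA divfK.
exact: integral_unitM.
Qed.

Lemma piF_Xz_mideal (k : int) : piF ^ k \in mm -> 0 < k.
Proof.
move=> km; rewrite ltNge; apply: contraL km => k0.
rewrite notin_mideal expfz_neq0 ?piF_neq0 //= -[_^-1]/(piF ^ k)^-1 invr_expz.
have : 0 <= - k by rewrite oppr_ge0.
by case: (- k) => // m _; rewrite -exprnP rpredX // mideal_integer // piF_mideal.
Qed.

Lemma integral_unit_mul_mideal x y : x \in OU -> (x * y \in mm) = (y \in mm).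
Proof.
rewrite integral_unitE => /and3P[x0 xO xV]; apply/idP/idP => [xym|]; last exact: midealM.
by rewrite -(mulKf x0 y) midealM.
Qed.

(** An element of least valuation generates. In units of v(pi), the bound j/e > -1/2 reads 2 j + e >
    0, so the minimum can be taken over natural numbers. *)
Lemma Idl_principal : exists y0, [/\ y0 \in Idl, y0 != 0 & forall x, x \in Idl -> x / y0 \in O].
Proof.
have piE j : piF ^ j != 0 by rewrite expfz_neq0 ?piF_neq0.
have bound x j : x \in Idl -> x ^+ e / piF ^ j \in OU -> 0 < 2 * j + e%:Z.
  move=> xI jU; apply: piF_Xz_mideal.
  rewrite -(integral_unit_mul_mideal _ (integral_unitX 2 jU)).
  have -> : (x ^+ e / piF ^ j) ^+ 2 * piF ^ (2 * j + e%:Z) = (x ^+ 2 * piF) ^+ e.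
    have -> : piF ^ (2 * j + e%:Z) = (piF ^ j) ^+ 2 * piF ^+ e.
      by rewrite expfzDr ?piF_neq0 // exprnP exprz_exp [2 * j]mulrC.
    by rewrite [RHS]exprMn expr_div_n mulrA divfK ?expf_neq0 // -!exprM mulnC.
  by rewrite midealX // Idl_bound.
have [_ [x1 x1I x10] _ _ _] := Idl_ideal.
pose P m := `[< exists x, exists j : int, [/\ x \in Idl, x != 0,
   x ^+ e / piF ^ j \in OU & 2 * j + e%:Z = m%:Z] >].
have exP : exists m, P m.
  have [j jU] := K_val (Idl_sub x1I) x10; exists (absz (2 * j + e%:Z)); apply/asboolP.
  by exists x1, j; split=> //; rewrite gez0_abs // ltW // (bound x1 j).
have [m /asboolP[y0 [j [y0I y00 jU jm]]] mmin] := ex_minnP exP.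
exists y0; split=> // x xI; have [->|x0] := eqVneq x 0; first by rewrite mul0r rpred0.
have [j' jU'] := K_val (Idl_sub xI) x0.
have jj : j <= j'.
  have /mmin : P (absz (2 * j' + e%:Z)).
    apply/asboolP; exists x, j'; split=> //.
    by rewrite gez0_abs // ltW // (bound x j').
  by rewrite -lez_nat (gez0_abs (ltW (bound x j' xI jU'))) -jm lerD2r ler_pM2l.
apply: (integer_root e_gt0); rewrite expr_div_n.
have -> : x ^+ e / y0 ^+ e = (x ^+ e / piF ^ j') * (y0 ^+ e / piF ^ j)^-1 * piF ^ (j' - j).
  rewrite expfzDr ?piF_neq0 // -invr_expz invf_div.
  transitivity (x ^+ e / y0 ^+ e * (piF ^ j / piF ^ j) * (piF ^ j' / piF ^ j')).
    by rewrite !(divff (piE _)) !mulr1.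
  by move: (x ^+ e) (y0 ^+ e)^-1 (piF ^ j) (piF ^ j') => A B C D; ring.
apply: rpredM; first apply: rpredM.
- by move: jU'; rewrite integral_unitE => /and3P[].
- by move: jU; rewrite integral_unitE => /and3P[].
have : 0 <= j' - j by rewrite subr_ge0.
by case: (j' - j) => // k _; rewrite -exprnP rpredX // mideal_integer // piF_mideal.
Qed.

Lemma Idl_gal (w : Om) x : x \in Idl -> w x \in Idl.
Proof.
move=> xI; have [x0|x0] := eqVneq x 0; first by rewrite x0 rmorph0 -x0.
have xK := Idl_sub xI; rewrite -(divfK x0 (w x)) Idl_scale //.
  by rewrite (subext_div K_subextension) ?gal_K.
by have := gal_K_unit w xK x0; rewrite integral_unitE => /and3P[].
Qed.

(** With y0 a generator, x y0 lies in the inverse different, which is the square of [Idl]; so y0^2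
    divides x y0, and y0 divides x. *)
Lemma Idl_selfdual x : x \in K -> (forall y, y \in Idl -> TK (x * y) \in O) -> x \in Idl.
Proof.
move=> xK xD; have [y0 [y0I y00 gen]] := Idl_principal.
have KM := subext_mul K_subextension; have KD := subext_div K_subextension.
have : x * y0 \in Dif.
  apply/DifP; split=> [|y yK yO]; first by rewrite KM // Idl_sub.
  by rewrite -mulrA xD // mulrC Idl_scale.
rewrite -Idl_square => /asboolP[r rI xE].
rewrite -(divfK y00 x); apply: Idl_scale => //; first by rewrite KD // Idl_sub.
have -> : x / y0 = (x * y0) / y0 / y0 by rewrite mulfK.
rewrite xE !mulr_suml big_seq; apply: rpred_sum => u /rI/andP[u1 u2].
have -> : u.1 * u.2 / y0 / y0 = (u.1 / y0) * (u.2 / y0) by rewrite -!mulrA; congr (_ * _); rewrite mulrCA.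
by rewrite rpredM ?gen.
Qed.

(** * The resolvend *)

Section GroupAlgebra.

Implicit Types x y z : {ffun gT -> Fc}.

Lemma gconvC x y : gconv x y = gconv y x.
Proof.
apply/ffunP => t; rewrite !ffunE (reindex_inj (inj_comp (mulgI t) invg_inj)) /=.
apply: eq_bigr => u _; rewrite invMg invgK mulgKV mulrC; congr (_ * _).
by rewrite mulGC.
Qed.

Lemma gconvA x y z : gconv x (gconv y z) = gconv (gconv x y) z.
Proof.
apply/ffunP => t; rewrite !ffunE.
under eq_bigr do rewrite ffunE mulr_sumr.
under [RHS]eq_bigr do rewrite ffunE mulr_suml.
rewrite [RHS]exchange_big /=; apply: eq_bigr => u _.
rewrite (reindex_inj (mulgI u^-1%g)) /=; apply: eq_bigr => v _.
by rewrite mulrA invMg invgK mulgA mulgK.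
Qed.

Lemma gconv_delta x v t : gconv x (gdelta Fc v) t = x (t * v^-1)%g.
Proof.
rewrite ffunE (bigD1 (t * v^-1)%g) //= big1 => [|u uv].
  by rewrite ffunE invMg invgK mulgKV eqxx mulr1 addr0.
rewrite ffunE; case: eqP => [E|_]; last by rewrite mulr0.
by case/eqP: uv; rewrite -E invMg invgK mulgA mulgV mul1g.
Qed.

Lemma gconv1 x : gconv x (gdelta Fc (1%g : gT)) = x.
Proof. by apply/ffunP => t; rewrite gconv_delta invg1 mulg1. Qed.

Lemma gconv_mul_delta (v v' : gT) : gconv (gdelta Fc v) (gdelta Fc v') = gdelta Fc (v * v')%g.
Proof.
by apply/ffunP => t; rewrite gconv_delta !ffunE -(inj_eq (mulIg v')) mulgKV.
Qed.

Lemma gconvACA x y z x' : gconv (gconv x y) (gconv z x') = gconv (gconv x z) (gconv y x').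
Proof. by rewrite -!gconvA; congr gconv; rewrite !gconvA (gconvC y z). Qed.

Definition gflip x : {ffun gT -> Fc} := [ffun t => x t^-1%g].

Lemma gflip_conv x y : gflip (gconv x y) = gconv (gflip x) (gflip y).
Proof.
apply/ffunP => t; rewrite !ffunE (reindex_inj invg_inj) /=.
apply: eq_bigr => u _; rewrite !ffunE invgK; congr (_ * y _).
by rewrite invMg invgK mulGC.
Qed.

Lemma gal_coef_conv (w : Om) x y :
  gal_coef w (gconv x y) = gconv (gal_coef w x) (gal_coef w y).
Proof.
apply/ffunP => t; rewrite !ffunE rmorph_sum; apply: eq_bigr => u _.
by rewrite rmorphM /= !ffunE.
Qed.

Lemma gal_coef_delta (w : Om) (v : gT) : gal_coef w (gdelta Fc v) = gdelta Fc v.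
Proof. by apply/ffunP => t; rewrite !ffunE rmorph_nat. Qed.

Definition gchar (chi : Ghat Fc gT) x := \sum_t x t * chi t.

Lemma Ghat1 (chi : Ghat Fc gT) : chi 1%g = 1.
Proof. by case: chi => c /= /andP[/eqP]. Qed.

Lemma GhatM (chi : Ghat Fc gT) t u : chi (t * u)%g = chi t * chi u.
Proof. by case: chi => c /= /andP[_ /forallP/(_ t)/forallP/(_ u)/eqP]. Qed.

Lemma GhatX (chi : Ghat Fc gT) t k : chi (t ^+ k)%g = chi t ^+ k.
Proof.
by elim: k => [|k IH]; rewrite ?Ghat1 // expgS GhatM IH exprS.
Qed.

Lemma gchar_conv chi x y : gchar chi (gconv x y) = gchar chi x * gchar chi y.
Proof.
rewrite /gchar; under eq_bigr do rewrite ffunE mulr_suml.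
rewrite exchange_big mulr_suml /=; apply: eq_bigr => u _.
rewrite (reindex_inj (mulgI u)) mulr_sumr /=; apply: eq_bigr => v _.
by rewrite mulKg GhatM; ring.
Qed.

End GroupAlgebra.

Notation r := (resolvend a).

Lemma galois_algebraP (b : {ffun gT -> Fc}) : b \in galois_algebra hr <->
  forall (w : Om) t, w (b t) = b (hr w * t)%g.
Proof. by split=> /asboolP. Qed.

Lemma gal_resolvend (w : Om) : gal_coef w r = gconv r (gdelta Fc (hr w)).
Proof.
apply/ffunP => t; rewrite gconv_delta !ffunE invMg invgK.
exact: ((galois_algebraP a).1 a_Fh w t^-1%g).
Qed.

Notation H := (quotient_img hr all_gal).
Notation rep := (quotient_rep hr all_gal).

Lemma Idl0 : 0 \in Idl.
Proof.
have [y0 [y0I _ _]] := Idl_principal; rewrite -(mul0r y0) Idl_scale ?rpred0 //.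
by rewrite -(subrr 1) (subext_sub K_subextension) ?(subext1 K_subextension).
Qed.

Lemma IdlD x y : x \in Idl -> y \in Idl -> x + y \in Idl.
Proof. by case: Idl_ideal => _ _ ID _ _; apply: ID. Qed.

(* The element of A_h supported on the coset H v with value x at v. *)
Definition coset_elt (v : gT) (x : Fc) : {ffun gT -> Fc} :=
  [ffun t => if (t * v^-1)%g \in H then rep (t * v^-1)%g x else 0].

Lemma coset_elt_module v x : x \in Idl -> coset_elt v x \in sqrt_module abs hr.
Proof.
move=> xI; rewrite inE; apply/andP; split; last first.
  by apply/forallP => t; rewrite ffunE; case: ifP => _; [apply: Idl_gal | apply: Idl0].
apply/galois_algebraP => w t; rewrite !ffunE.
have wH := @quotient_img_mulr _ _ hrM all_gal (fun _ _ _ _ => I) (fun _ _ => I) w (t * v^-1)%g I.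
rewrite -mulgA wH; case: ifP => tH; last by rewrite rmorph0.
rewrite -gal_mulE; apply: (quotient_act hrM (Idl_sub xI)).
have [_ ->] := quotient_repP (etrans wH tH).
by rewrite hrM; have [_ ->] := quotient_repP tH.
Qed.

Lemma coset_elt_span v x : x \in Idl -> exists2 c : {ffun gT -> F},
  forall t, iota (c t) \in O & forall t, coset_elt v x t = \sum_u iota (c u) * a (t * u)%g.
Proof.
move=> /(coset_elt_module v); rewrite a_gen => /asboolP[c cO cE]; exists c => // t.
by rewrite cE; apply: eq_bigr => u _; rewrite ffunE.
Qed.

(** After scaling by a power of p, the function supported on H with value y_l at 1 belongs to A_h,
    so it is a combination of translates of a. Weighting by the dual c_l leaves the indicator of
    1. *)
Lemma resolvend_inv : exists R, gconv r R = gdelta Fc (1%g : gT).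
Proof.
have [m [c [y [cK yK dual]]]] := K_dual; have [y0 [y0I y00 _]] := Idl_principal.
have /choice[k kO] := fun l => clear_denom (y l / y0).
have pK : pc \in K by rewrite -(rmorph_nat iota) (base_subextension K_subextension).
have yI l : pc ^+ k l * y l \in Idl.
  rewrite -(divfK y00 (y l)) mulrA Idl_scale //.
  rewrite (subext_mul K_subextension) ?(subext_exp K_subextension) //.
  exact: (subext_div K_subextension (yK l) (Idl_sub y0I)).
have /choice[d dE] : forall l, exists d : {ffun gT -> F}, forall t,
    coset_elt 1%g (pc ^+ k l * y l) t = \sum_u iota (d u) * a (t * u)%g.
  by move=> l; have [d _ dE] := coset_elt_span 1%g (yI l); exists d.
exists [ffun u => \sum_l c l / pc ^+ k l * iota (d l u)]; rewrite gconvC.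
apply/ffunP => t; rewrite !ffunE.
transitivity (\sum_l c l / pc ^+ k l * coset_elt 1%g (pc ^+ k l * y l) t^-1%g).
  under [RHS]eq_bigr do rewrite dE mulr_sumr.
  rewrite [RHS]exchange_big /=; apply: eq_bigr => u _.
  rewrite !ffunE mulr_suml invMg invgK; apply: eq_bigr => l _; rewrite mulrA //.
have cE l : c l / pc ^+ k l * coset_elt 1%g (pc ^+ k l * y l) t^-1%g =
    if t^-1%g \in H then c l * rep t^-1%g (y l) else 0.
  rewrite ffunE invg1 mulg1; case: ifP => _; last by rewrite mulr0.
  rewrite rmorphM rmorphXn rmorph_nat /= mulrA divfK // expf_neq0 //.
  exact: pc_neq0.
under eq_bigr do rewrite cE.
have H1 : 1%g \in H by rewrite -hr1; apply: quotient_mem.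
case: (boolP (t^-1%g \in H)) => tH; last first.
  by rewrite big1 //; case: eqP => // t1; rewrite t1 invg1 H1 in tH.
by rewrite dual; have [_ ->] := quotient_repP tH; rewrite invg_eq1.
Qed.

Section Inverse.

Variable R : {ffun gT -> Fc}.
Hypothesis rR : gconv r R = gdelta Fc (1%g : gT).

(** Since w multiplies r by h(w), it multiplies the inverse by h(w)^-1; on coefficients this is the
    rule defining F_h, as G is abelian. *)
Lemma R_galois : R \in galois_algebra hr.
Proof.
apply/galois_algebraP => w t.
have E : gconv (gal_coef w R) (gdelta Fc (hr w)) = R.
  have := congr1 (gal_coef w) rR; rewrite gal_coef_conv gal_coef_delta gal_resolvend => wrR.
  rewrite -[LHS]gconv1 -rR gconvA [X in gconv X R](_ : _ = gdelta Fc (1%g : gT)).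
    by rewrite gconvC gconv1.
  by rewrite -wrR gconvC (gconvC (gal_coef w R)) gconvA.
rewrite -[in RHS]E gconv_delta ffunE.
by have -> : (hr w * t * (hr w)^-1 = t)%g by rewrite mulGC mulKg.
Qed.

Lemma R_dual v : \sum_t R t * a (t * v)%g = (v == 1%g)%:R.
Proof.
transitivity (gconv R r v^-1%g); last by rewrite gconvC rR ffunE invg_eq1.
by rewrite ffunE; apply: eq_bigr => t _; rewrite ffunE invMg !invgK mulGC.
Qed.

(** A coset element is a combination of translates of a with coefficients c in O_F. Pairing it with
    R gives the trace of R(t) y on one side and c(1) on the other. *)
Lemma R_Idl t : R t \in Idl.
Proof.
have /galois_algebraP RG := R_galois.
have RK : R t \in K by apply/asboolP => w w1; rewrite RG w1 mul1g.
apply: Idl_selfdual => // y yI; have [c cO cE] := coset_elt_span t yI.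
suff -> : TK (R t * y) = iota (c 1%g) by [].
transitivity (\sum_u R u * coset_elt t y u).
  rewrite (reindex_inj (mulIg t)) /= [RHS](bigID (fun u => u \in H)) /= addrC big1 => [|u uH].
    rewrite add0r; apply: eq_bigr => u uH.
    rewrite rmorphM /= RG ffunE mulgK uH.
    by have [_ ->] := quotient_repP uH.
  by rewrite ffunE mulgK (negPf uH) mulr0.
under eq_bigr do rewrite cE mulr_sumr.
rewrite exchange_big /= (bigD1 1%g) //= [X in _ + X]big1 => [|u u1].
  under eq_bigr do rewrite mulrCA.
  by rewrite -mulr_sumr R_dual eqxx mulr1 addr0.
under eq_bigr do rewrite mulrCA.
by rewrite -mulr_sumr R_dual (negPf u1) mulr0.
Qed.

Lemma R_span : exists2 C : {ffun gT -> Fc}, forall t, C t \in O &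
  R = gconv (gflip C) (gflip r).
Proof.
have : R \in sqrt_module abs hr.
  by rewrite inE R_galois; apply/forallP => t; apply: R_Idl.
rewrite a_gen => /asboolP[c cO cE]; exists [ffun u => iota (c u)] => [t|].
  by rewrite ffunE.
rewrite -gflip_conv; apply/ffunP => t; rewrite cE !ffunE.
by apply: eq_bigr => u _; rewrite !ffunE invMg !invgK.
Qed.

End Inverse.

(** * The Stickelberger element *)

Hypothesis G_odd : odd #|gT|.

Notation ze := (zeta e).
Notation re := (rad e).

Lemma ze_order : ze ^+ e = 1.
Proof. exact: prim_expr_order (zeta_prim e_gt0). Qed.

Lemma re_neq0 : re != 0.
Proof. exact: (rad_neq0 e_gt0 order_s_coprime). Qed.

Lemma e_neq0 : e%:R != 0 :> Fc.
Proof. by have := nat_notin_mideal order_s_coprime; rewrite notin_mideal => /andP[]. Qed.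

Definition half_e := (e.-1./2)%N.

(** Here the odd order of G enters. *)
Lemma half_eE : e = (half_e.*2).+1.
Proof.
have oe : odd e by apply: dvdn_odd G_odd; rewrite -cardsT; apply: order_dvdG; rewrite inE.
rewrite /half_e; case: (e) oe => //= k /negPf ok.
by rewrite -[in LHS](odd_double_half k) ok.
Qed.

Lemma ze_expz_eq1 (k : int) : ze ^ k = 1 -> exists j : int, k = e%:Z * j.
Proof.
move=> k1; suff /dvdzP[j ->] : (e%:Z %| k)%Z by exists j; rewrite mulrC.
rewrite dvdzE /= (prim_order_dvd (zeta_prim e_gt0)); apply/eqP.
case: k k1 => k; first by [].
by rewrite NegzE -exprnN abszN => /(congr1 GRing.inv); rewrite invrK invr1.
Qed.

Lemma ze_expz_small (k : int) : ze ^ k = 1 -> (absz k < e)%N -> k = 0.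
Proof.
move=> /ze_expz_eq1[j ->]; rewrite abszM absz_nat -{2}[e]muln1 ltn_pmul2l //.
by case: j => [[|j]|j] //; rewrite mulr0.
Qed.

(* The faithful character of the cyclic group generated by s. *)
Definition lam (t : gT) : Fc := ze ^+ xget 0%N [set i : nat | t = (s ^+ i)%g]%classic.

Lemma lam_exp i : lam (s ^+ i)%g = ze ^+ i.
Proof.
have := @xgetPex _ 0%N [set j : nat | (s ^+ i = s ^+ j)%g]%classic (ex_intro _ i erefl).
rewrite /lam; set j := xget _ _ => /= /eqP; rewrite eq_expg_mod_order => /eqP ij.
by apply/eqP; rewrite (eq_prim_root_expr (zeta_prim e_gt0)) ij.
Qed.

Notation C := (<[s]>%g).

Lemma lamM t u : t \in C -> u \in C -> lam (t * u)%g = lam t * lam u.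
Proof. by move=> /cycleP[i ->] /cycleP[j ->]; rewrite -expgD !lam_exp exprD. Qed.

Lemma lam1 : lam 1%g = 1.
Proof. by rewrite -(expg0 s) lam_exp expr0. Qed.

Lemma lams : lam s = ze.
Proof. by rewrite -{1}(expg1 s) lam_exp expr1. Qed.

Lemma lam_neq0 t : lam t != 0.
Proof. by rewrite expf_neq0 // zeta_neq0. Qed.

Lemma lamV t : t \in C -> lam t^-1%g = (lam t)^-1.
Proof.
move=> tC; apply: (mulfI (lam_neq0 t)); rewrite -lamM ?groupV //.
by rewrite mulgV lam1 divff // lam_neq0.
Qed.

Lemma lam_eq1 t : t \in C -> lam t = 1 -> t = 1%g.
Proof.
move=> /cycleP[i ->]; rewrite lam_exp => /eqP.
by rewrite -(prim_order_dvd (zeta_prim e_gt0)) order_dvdn => /eqP.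
Qed.

Lemma sum_lam (k : int) : (absz k < e)%N -> \sum_(t in C) lam t ^ k = (k == 0)%:R * e%:R.
Proof.
move=> ke; case: eqP => [->|k0].
  by rewrite mul1r sumr_const.
set S := \sum_(_ in _) _; rewrite mul0r.
have : ze ^ k * S = S.
  rewrite {2}/S (reindex_inj (mulgI s)) mulr_sumr /=.
  apply: eq_big => [t|t tC]; first by rewrite groupMl // cycle_id.
  by rewrite lamM ?cycle_id // expfzMl lams.
move=> /eqP; rewrite -subr_eq0 -{2}[S]mul1r -mulrBl mulf_eq0 subr_eq0.
by move=> /orP[/eqP/ze_expz_small/(_ ke)/k0|/eqP].
Qed.

(** Lists the symmetric representatives modulo e in increasing order, so that [rev_ord] is
    negation. *)
Definition kap (l : 'I_e) : int := l%:Z - half_e%:Z.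

Lemma kap_rev l : kap (rev_ord l) = - kap l.
Proof.
have := ltn_ord l; have := half_eE; rewrite /kap /=.
by move: (nat_of_ord l) half_e => i k; move: (e) => E; lia.
Qed.

Lemma kap_bound l : (absz (kap l) <= half_e)%N.
Proof.
have := ltn_ord l; have := half_eE; rewrite /kap /=.
by move: (nat_of_ord l) half_e => i k; move: (e) => E; lia.
Qed.

Lemma kap_sub l l' : (absz (kap l - kap l') < e)%N.
Proof.
have := ltn_ord l; have := ltn_ord l'; rewrite /kap.
by move: (nat_of_ord l) (nat_of_ord l') half_e => i j k; move: (e) => E; lia.
Qed.

Lemma kap_inj l l' : kap l = kap l' -> l = l'.
Proof. by move=> /addIr[ll']; apply: val_inj. Qed.

Lemma kap_surj (v : int) : (absz v <= half_e)%N -> exists l, kap l = v.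
Proof.
move=> vb; have l_lt : (absz (v + half_e%:Z)%R < e)%N.
  by have := half_eE; move: half_e vb => k; move: (e) => E; lia.
by exists (Ordinal l_lt); rewrite /kap /=; move: half_e vb => k; lia.
Qed.

(* theta is the element of the group algebra whose image under a character chi
   is rad e ^ (- upsilon chi s). *)
Definition theta : {ffun gT -> Fc} :=
  [ffun t => if t \in C then e%:R^-1 * \sum_l (re * lam t) ^ (- kap l) else 0].

(** Orthogonality on <s> keeps only the pairs of opposite exponents, whose powers of [re] cancel. *)
Lemma theta_flip : gconv theta (gflip theta) = gdelta Fc (1%g : gT).
Proof.
apply/ffunP => g; rewrite !ffunE.
have [gC|gC] := boolP (g \in C); last first.
  rewrite big1 => [|t _]; last first.
    rewrite !ffunE; case: ifP => tC; last by rewrite mul0r.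
    by rewrite groupV groupMl ?groupV // (negPf gC) mulr0.
  by case: eqP => // g1; rewrite g1 group1 in gC.
transitivity (e%:R^-1 * e%:R^-1 * \sum_l \sum_l'
    re ^ (- kap l - kap l') * lam g ^ kap l' * \sum_(t in C) lam t ^ (- kap l - kap l')).
  rewrite [LHS](bigID (mem C)) /= [X in _ + X]big1 ?addr0 => [|t tC]; last first.
    by rewrite ffunE (negPf tC) mul0r.
  rewrite (eq_bigr (fun l => \sum_(t in C) \sum_l' re ^ (- kap l - kap l') *
      lam g ^ kap l' * lam t ^ (- kap l - kap l'))); last first.
    move=> l _; rewrite exchange_big /=; apply: eq_bigr => l' _.
    by rewrite mulr_sumr.
  rewrite exchange_big mulr_sumr /=; apply: eq_bigr => t tC.
  rewrite !ffunE tC groupV groupMl ?groupV // gC mulrACA; congr (_ * _).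
  rewrite big_distrlr /=; apply: eq_bigr => l _; apply: eq_bigr => l' _.
  rewrite lamV ?groupM ?groupV // lamM ?groupV // lamV // !expfzMl.
  rewrite invfM invrK expfzMl [re ^ (- kap l - _)]expfzDr ?re_neq0 //.
  rewrite [lam t ^ (- kap l - _)]expfzDr ?lam_neq0 //.
  have -> : (lam g)^-1 ^ (- kap l') = lam g ^ kap l' by rewrite exprz_inv opprK.
  move: (re ^ (- kap l)) (re ^ (- kap l')) (lam t ^ (- kap l)) (lam t ^ (- kap l')).
  move: (lam g ^ kap l') => A1 A2 A3 A4 A5; ring.
have inner l : \sum_l' re ^ (- kap l - kap l') * lam g ^ kap l' *
    (\sum_(t in C) lam t ^ (- kap l - kap l')) = lam g ^ (- kap l) * e%:R.
  have sE l' : \sum_(t in C) lam t ^ (- kap l - kap l') = (rev_ord l == l')%:R * e%:R.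
    rewrite sum_lam -kap_rev ?kap_sub // subr_eq0; congr ((nat_of_bool _)%:R * _).
    by apply/eqP/eqP => [/kap_inj|->].
  under eq_bigr do rewrite sE.
  rewrite (bigD1 (rev_ord l)) //= big1 ?addr0 => [|l' /negPf ll'].
    by rewrite eqxx mul1r kap_rev subrr expr0z mul1r.
  by rewrite eq_sym ll' mul0r mulr0.
under eq_bigr do rewrite inner.
rewrite -mulr_suml; transitivity (e%:R^-1 * \sum_l lam g ^ (- kap l)).
  by rewrite -mulrA [_ * e%:R]mulrC mulKf ?e_neq0.
have lg0 := lam_neq0 g.
have -> : \sum_l lam g ^ (- kap l) = lam g ^ half_e%:Z * \sum_(i < e) (lam g)^-1 ^+ i.
  rewrite mulr_sumr; apply: eq_bigr => l _.
  by rewrite /kap opprB expfzDr // -exprnN exprVn.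
rewrite sum_root_unity; last first.
  by have /cycleP[i ->] := gC; rewrite lam_exp -exprVn -exprM mulnC exprM exprVn ze_order invr1 expr1n.
have [->|g1] := eqVneq g 1%g; first by rewrite lam1 invr1 eqxx exp1rz !mul1r mulVf ?e_neq0.
case: eqP => [E|_]; last by rewrite mul0r !mulr0.
by case/eqP: g1; apply: lam_eq1 => //; rewrite -[lam g]invrK E invr1.
Qed.

(** Fourier inversion on <s>: chi restricts to lam^v, and only the index with [kap] equal to v
    survives. *)
Lemma gchar_theta (chi : Ghat Fc gT) (v : int) : chi s = ze ^ v ->
  (absz v <= half_e)%N -> gchar chi theta = re ^ (- v).
Proof.
move=> chiE vb; have chiC t : t \in C -> chi t = lam t ^ v.
  move=> /cycleP[i ->]; rewrite GhatX chiE lam_exp.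
  by rewrite -[RHS]/((ze ^ i%:Z) ^ v) -[LHS]/((ze ^ v) ^ i%:Z) !exprz_exp mulrC.
rewrite /gchar (bigID (mem C)) /= [X in _ + X]big1 ?addr0 => [|t tC]; last first.
  by rewrite ffunE (negPf tC) mul0r.
transitivity (e%:R^-1 * \sum_l re ^ (- kap l) * \sum_(t in C) lam t ^ (v - kap l)).
  rewrite (eq_bigr (fun l => \sum_(t in C) re ^ (- kap l) * lam t ^ (v - kap l))); last first.
    by move=> l _; rewrite mulr_sumr.
  rewrite exchange_big mulr_sumr /=; apply: eq_bigr => t tC.
  rewrite ffunE tC chiC // -mulrA mulr_suml; congr (_ * _); apply: eq_bigr => l _.
  by rewrite expfzMl [lam t ^ (v - _)]expfzDr ?lam_neq0 // -mulrA; congr (_ * _); rewrite mulrC.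
have [l0 l0E] := kap_surj vb.
have sE l : \sum_(t in C) lam t ^ (v - kap l) = (l == l0)%:R * e%:R.
  rewrite sum_lam -l0E ?kap_sub // subr_eq0; congr ((nat_of_bool _)%:R * _).
  by apply/eqP/eqP => [/kap_inj|->].
under eq_bigr do rewrite sE.
rewrite (bigD1 l0) //= big1 ?addr0 => [|l /negPf ll']; last by rewrite ll' mul0r mulr0.
by rewrite eqxx mul1r mulrCA mulVf ?e_neq0 // mulr1 l0E.
Qed.

Lemma gal_theta (w : Om) : exists i, gal_coef w theta = gconv theta (gdelta Fc (s ^+ i)%g).
Proof.
have [i wi] := gal_rad w e_gt0 order_s_coprime.
(* This exponent represents - i: multiplying [re] by zeta_e^i = lam(s^i) shifts the argument by
   s^i. *)
exists (e - i %% e)%N; apply/ffunP => t; rewrite gconv_delta !ffunE.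
have siV : ((s ^+ (e - i %% e))^-1 = s ^+ i)%g.
  apply/eqP; rewrite eq_invg_mul -expgD -order_dvdn /dvdn -modnDmr subnK ?modnn //.
  by rewrite ltnW // ltn_mod.
have siC : (s ^+ i)%g \in C := mem_cycle _ _.
rewrite siV groupMr //; case: ifP => tC; last by rewrite rmorph0.
rewrite rmorphM fmorphV rmorph_nat rmorph_sum; congr (_ * _); apply: eq_bigr => l _.
have wlam : w (lam t) = lam t.
  by have /cycleP[j ->] := tC; rewrite lam_exp rmorphXn /= zeta_e_fixed.
have wX (x : Fc) (k : int) : w (x ^ k) = w x ^ k by rewrite fmorphXz.
rewrite [LHS]wX rmorphM /= wi wlam lamM // lam_exp; congr (_ ^ _).
by rewrite [ze ^+ i * re]mulrC -mulrA [ze ^+ i * _]mulrC.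
Qed.

Lemma subext_expz L x (k : int) : subextension iota L -> x \in L -> x ^ k \in L.
Proof.
move=> Lsub xL; case: k => k; first exact: subext_exp.
by rewrite NegzE -exprnN (subext_inv Lsub) // (subext_exp Lsub).
Qed.

Lemma ze_K : ze \in K.
Proof. by have [c ->] := zeta_e_base; apply: (base_subextension K_subextension). Qed.

Lemma lamX_unit t (k : int) : lam t ^ k \in OU.
Proof. by rewrite integral_unitXz // integral_unitX // zeta_unit. Qed.

Lemma Idl_sum (J : finType) (P : pred J) (E : J -> Fc) :
  (forall i, P i -> E i \in Idl) -> \sum_(i | P i) E i \in Idl.
Proof. by move=> EI; elim/big_ind: _ => //; [exact: Idl0 | exact: IdlD]. Qed.

(* The valuation of x is k / e modulo Z v(pi) and exceeds - v(pi) / 2. *)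
Lemma eigen_integer x (k : int) : x \in Idl -> sg x = ze ^ k * x ->
  (absz k <= half_e)%N -> x * re ^ (- k) \in O.
Proof.
move=> xI sgx kb; set y := x * _; have r0 := re_neq0.
have [->|y0] := eqVneq y 0; first exact: rpred0.
have xE : x = y * re ^ k by rewrite /y -mulrA -expfzDr // addNr expr0z mulr1.
have ysg : sg y = y.
  rewrite /y rmorphM fmorphXz /= sgx sg_rad_e expfzMl mulrACA -[X in X * _]expfzDr ?zeta_neq0 //.
  by rewrite subrr expr0z mul1r.
have yl w : fixes_level N n w -> w y = y.
  move=> wl; rewrite /y rmorphM fmorphXz /= (K_level (Idl_sub xI) wl).
  by rewrite -(rad_dvd n_gt0 n_coprime order_s_dvd) rmorphXn /= wl.2.
have [j [U jU yE]] : exists j : int, exists2 U, U \in OU & y = U * piF ^ j.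
  have [j jU] := sg_fixed_val yl ysg y0; exists j, (y / piF ^ j) => //.
  by rewrite divfK // expfz_neq0 // piF_neq0.
have repi : re ^ e%:Z = piF by rewrite -exprnP rad_pow // order_s_coprime.
(* Up to the unit U^(2e) this is (x^2 pi)^e, which [Idl_bound] puts in [mm]. *)
have /piF_Xz_mideal pos : piF ^ (2 * e%:Z * j + 2 * k + e%:Z) \in mm.
  rewrite -(integral_unit_mul_mideal _ (integral_unitX (2 * e) jU)).
  have -> : U ^+ (2 * e) * piF ^ (2 * e%:Z * j + 2 * k + e%:Z) = (x ^+ 2 * piF) ^+ e.
    rewrite xE yE exprMn -exprM 2!exprMn -!mulrA; congr (_ * _).
    have -> : (piF ^ j) ^+ (2 * e) = piF ^ (2 * e%:Z * j).
      by rewrite exprnP exprz_exp mulrC PoszM.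
    have -> : (re ^ k) ^+ (2 * e) = piF ^ (2 * k).
      by rewrite exprnP exprz_exp -repi exprz_exp PoszM; congr (_ ^ _); ring.
    by rewrite 2?expfzDr ?piF_neq0 // -!mulrA.
  by rewrite midealX // Idl_bound.
have j0 : 0 <= j.
  rewrite leNgt; apply/negP => j_lt0.
  have ej : e%:Z * j <= - e%:Z.
    have j1 : j <= -1 by rewrite -ltzD1 addNr.
    by rewrite -mulrN1 ler_pM2l // ltz_nat.
  apply: (eigen_valuation_arith kb half_eE ej); move: pos; by rewrite -mulrA.
move: jU; rewrite integral_unitE => /and3P[_ UO _]; rewrite yE rpredM //.
by case: j j0 {U UO yE pos} => // j _; rewrite -exprnP rpredX // mideal_integer // piF_mideal.
Qed.

Notation u := (gconv r theta).

Lemma u_integer t : u t \in O.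
Proof.
(* The eigencomponents of a on the coset t^-1 <s>: the shift of v by s^-1 below shows that [sg] acts
   on them by zeta_e^(kap l). *)
pose x l := \sum_(v in C) lam v ^ (- kap l) * a (t^-1 * v)%g.
have -> : u t = e%:R^-1 * \sum_l x l * re ^ (- kap l).
  rewrite gconvC ffunE (bigID (mem C)) /= [X in _ + X]big1 ?addr0 => [|v vC]; last first.
    by rewrite ffunE (negPf vC) mul0r.
  rewrite (eq_bigr (fun l => \sum_(v in C) lam v ^ (- kap l) * a (t^-1 * v)%g * re ^ (- kap l))); last first.
    by move=> l _; rewrite mulr_suml.
  rewrite exchange_big mulr_sumr /=; apply: eq_bigr => v vC.
  rewrite !ffunE vC invMg invgK -mulrA mulr_suml; congr (_ * _); apply: eq_bigr => l _.
  by rewrite expfzMl -[LHS]mulrA [LHS]mulrC.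
rewrite rpredM ?nat_inv_integer ?order_s_coprime //; apply: rpred_sum => l _.
apply: eigen_integer; last exact: kap_bound.
  apply: Idl_sum => v _; have := lamX_unit v (- kap l); rewrite integral_unitE => /and3P[_ lO _].
  apply: Idl_scale => //; last exact: a_Idl.
  apply: (subext_expz _ K_subextension); rewrite /lam.
  exact: (subext_exp K_subextension _ ze_K).
rewrite rmorph_sum /x (reindex_inj (mulgI s^-1%g)) mulr_sumr /=.
apply: eq_big => [v|v]; first by rewrite groupMl // groupV cycle_id.
rewrite groupMl ?groupV ?cycle_id // => vC.
rewrite rmorphM fmorphXz /= ((galois_algebraP a).1 a_Fh) hr_sg.
have -> : sg (lam (s^-1 * v)%g) = lam (s^-1 * v)%g.
  by rewrite /lam rmorphXn /= zeta_e_fixed.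
rewrite lamM ?groupV ?cycle_id // lamV ?cycle_id // lams expfzMl exprz_inv opprK.
have -> : (s * (t^-1 * (s^-1 * v)) = t^-1 * v)%g.
  by rewrite mulgA [(s * t^-1)%g]mulGC -mulgA mulKVg.
by rewrite mulrA.
Qed.

Lemma resolvend_calH : in_calH iota predT r.
Proof.
have [R rR] := resolvend_inv; split; last by move=> w; exists (hr w); apply: gal_resolvend.
by split=> //; exists R; rewrite gconvC in rR *; split=> //; rewrite gconvC.
Qed.

Lemma u_calH : in_calH iota O u.
Proof.
have [R rR] := resolvend_inv; have [D DO RE] := R_span rR.
split; last first.
  move=> w; have [i iE] := gal_theta w; exists (hr w * s ^+ i)%g.
  by rewrite gal_coef_conv gal_resolvend iE gconvACA gconv_mul_delta.
split; first exact: u_integer.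
have uV : gconv u (gconv (gflip D) (gflip u)) = gdelta Fc (1%g : gT).
  rewrite gflip_conv [gconv (gflip D) _]gconvA -RE gconvACA theta_flip.
  by rewrite rR gconv1.
exists (gconv (gflip D) (gflip u)); split=> //; last by rewrite gconvC.
move=> t; rewrite ffunE; apply: rpred_sum => v _; rewrite ffunE rpredM ?DO //.
by rewrite ffunE u_integer.
Qed.

Lemma upsilonP (chi : Ghat Fc gT) : chi s = ze ^ upsilon zeta chi s /\
  (absz (upsilon zeta chi s) <= half_e)%N.
Proof.
have boundE (v : int) : ((1 - e%:Z)%:Q / 2 <= v%:Q <= (e%:Z - 1)%:Q / 2) = (absz v <= half_e)%N.
  rewrite ler_pdivrMr // ler_pdivlMr // -[2]/(2%:~R) -!intrM !ler_int.
  by have := half_eE; move: half_e => m; move: (e) => E eE; lia.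
have chie : chi s ^+ e = 1 by rewrite -GhatX expg_order Ghat1.
have [i iE] := root_unity_zeta e_gt0 chie.
have ex : exists v : int, (1 - e%:Z)%:Q / 2 <= v%:Q <= (e%:Z - 1)%:Q / 2 /\ chi s = ze ^ v.
  have ie : (i %% e < e)%N by rewrite ltn_mod.
  have iE' : chi s = ze ^+ (i %% e) by rewrite prim_expr_mod ?zeta_prim.
  (* Residues in the upper half are shifted by - e into the symmetric interval. *)
  have [le|lt] := leqP (i %% e) half_e; first by exists (i %% e)%N%:Z; rewrite boundE.
  exists ((i %% e)%N%:Z - e%:Z); rewrite boundE; split.
    by have := half_eE; move: lt ie; move: (i %% e)%N half_e => q m; move: (e) => E; lia.
  by rewrite expfzDr ?zeta_neq0 // -exprnN ze_order invr1 mulr1.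
have [b chiE] := xgetPex 0 (ex : exists v, [set v : int | _ /\ _]%classic v).
by split; [exact: chiE | rewrite -boundE].
Qed.

Lemma gchar_resolvend (chi : Ghat Fc gT) :
  gchar chi r = gchar chi u * re ^ upsilon zeta chi s.
Proof.
have [chiE vb] := upsilonP chi; rewrite gchar_conv (gchar_theta chiE vb).
by rewrite -mulrA -expfzDr ?re_neq0 // addNr expr0z mulr1.
Qed.

(** As psi evaluates to 1 at s, the total exponent S of [re] is a multiple e M; then re^S = pi^M,
    and M is the Stickelberger pairing. For s = 1 every upsilon vanishes and f_s is 1. *)
Lemma geval_resolvend psi : in_AGhat psi ->
  geval r psi = geval u psi * Theta zeta (prime_f iota pi s) psi.
Proof.
move=> psiA; pose S := \sum_(chi <- finsupp psi) upsilon zeta chi s * psi chi.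
have prodX (J : eqType) (x : Fc) (q : seq J) (f : J -> int) : x != 0 ->
    \prod_(i <- q) x ^ f i = x ^ (\sum_(i <- q) f i).
  move=> x0; elim: q => [|i q IH]; first by rewrite !big_nil expr0z.
  by rewrite !big_cons IH expfzDr.
have -> : geval r psi = geval u psi * re ^ S.
  rewrite /S -prodX ?re_neq0 // -big_split; apply: eq_bigr => chi _ /=.
  by rewrite -/(gchar chi r) -/(gchar chi u) gchar_resolvend expfzMl exprz_exp.
congr (_ * _); have [M SM] : exists M, S = e%:Z * M.
  apply: ze_expz_eq1; rewrite -prodX ?zeta_neq0 // -[RHS](psiA s).
  by apply: eq_bigr => chi _; rewrite -exprz_exp -(upsilonP chi).1.
have stickE : stickelberger zeta psi s = M%:~R.
  have eQ : e%:R != 0 :> rat by rewrite pnatr_eq0 -lt0n.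
  transitivity (S%:~R / e%:R : rat); last first.
    by rewrite SM intrM mulrC mulKf.
  rewrite /stickelberger /S rmorph_sum mulr_suml; apply: eq_bigr => chi _ /=.
  by rewrite intrM mulrA [_%:~R * _]mulrC.
rewrite /Theta (bigD1 s) //= stickE numq_int /prime_f eqxx /= big1 => [|t ts].
  rewrite mulr1 SM; case: eqP => [s1|_] /=; last first.
    by rewrite -exprz_exp -exprnP rad_pow ?order_s_coprime.
  rewrite exp1rz -SM /S big1 ?expr0z // => chi _.
  have := (upsilonP chi).2; rewrite /half_e {2}s1 order1 leqn0 absz_eq0 => /eqP->.
  by rewrite mul0r.
by rewrite (negPf ts) exp1rz.
Qed.

Lemma level_resolvend q : residue_card abs iota pi q ->
  [/\ (e %| q.-1)%N, in_Lambda zeta iota (prime_f iota pi s), in_calH iota predT r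
    & exists2 x, in_calH iota O x & forall psi : ZGhat Fc gT, in_AGhat psi ->
        geval r psi = geval x psi * Theta zeta (prime_f iota pi s) psi].
Proof.
move=> qP; split; [exact: order_s_residue | exact: prime_f_Lambda | exact: resolvend_calH |].
by exists u; [exact: u_calH | move=> psi; apply: geval_resolvend].
Qed.

End LocalTameResolvends.

Theorem theorem8p5
  (p : nat) (p_prime : prime p)
  (Qp : fieldType) (abs : Qp -> rat) (QpP : is_Qp p abs)
  (F : fieldExtType Qp)
  (Fc : closedFieldType) (iota : {rmorphism F -> Fc})
  (Fc_algebraic : forall x : Fc, algebraicOver iota x)
  (gT : finGroupType) (G_abelian : abelian [set: gT]) (G_odd : odd #|gT|)
  (pi : F) (pi_uniformizer : is_uniformizer abs iota (base_field iota) (iota pi))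
  (q : nat) (q_card : residue_card abs iota pi q)
  (zeta : nat -> Fc)
  (zeta_prim : forall n, (0 < n)%N -> n.-primitive_root (zeta n))
  (zeta_compat : forall m n, (0 < m)%N -> (0 < n)%N ->
     zeta (m * n)%N ^+ m = zeta n)
  (rad : nat -> Fc)
  (rad_pow : forall n, (0 < n)%N -> coprime n p -> rad n ^+ n = iota pi)
  (rad_compat : forall m n, (0 < m)%N -> (0 < n)%N -> coprime (m * n) p ->
     rad (m * n)%N ^+ m = rad n)
  (sigma : GalGroup (tame_emb abs iota p))
  (sigma_nr : forall x : tame_field abs iota p,
     tame_val x \in Fnr abs iota -> sigma x = x)
  (sigma_rad : forall n (x : tame_field abs iota p),
     (0 < n)%N -> coprime n p -> tame_val x = rad n ->
     tame_val (sigma x) = zeta n * rad n)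
  (h : {multiplicative GalGroup (tame_emb abs iota p) -> gT})
  (h_continuous : gal_continuous h)
  (a : {ffun gT -> Fc})
  (a_Fh : a \in galois_algebra (h \o @res Qp abs F Fc iota p))
  (a_gen : sqrt_module abs (h \o @res Qp abs F Fc iota p)
             =i integral_span abs iota a) :
  [/\ (#[h sigma]%g %| q.-1)%N,
      in_Lambda zeta iota (prime_f iota pi (h sigma)),
      in_calH iota predT (resolvend a)
    & exists2 u, in_calH iota (integers abs iota) u &
        forall psi : ZGhat Fc gT, in_AGhat psi ->
          geval (resolvend a) psi =
          geval u psi * Theta zeta (prime_f iota pi (h sigma)) psi].
Proof.
have [N [n [levelNn hr_fixes]]] := hr_level p_prime QpP Fc_algebraic
  pi_uniformizer zeta_prim zeta_compat rad_pow rad_compat h_continuous.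
have [sg sgE] := res_surj Fc_algebraic sigma.
exact: (level_resolvend p_prime QpP Fc_algebraic pi_uniformizer zeta_prim
  zeta_compat rad_pow rad_compat sigma_nr sigma_rad G_abelian
  levelNn hr_fixes sgE a_Fh a_gen G_odd q_card).
Qed.
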